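(* Let $\mathcal M$ be a minimal time-like surface of general type in $\mathbb R^n_1$. Then $\mathcal M$ admits locally canonical coordinates, i.e. around every point of $\mathcal M$ there exist canonical coordinates.
   Context: Double numbers: $\mathbb D=\{t=u+\mathrm j v:\ u,v\in\mathbb R\}$ with $\mathrm j^2=1$; $\bar t=u-\mathrm j v$, $|t|^2=t\bar t=u^2-v^2$, $\mathrm{Re}\,t=u$, $\mathrm{Im}\,t=v$; $\mathbb D_0=\{t\in\mathbb D:|t|^2=0\}$. Put $\frac{\partial}{\partial t}=\frac12\left(\frac{\partial}{\partial u}+\mathrm j\frac{\partial}{\partial v}\right)$, $\frac{\partial}{\partial\bar t}=\frac12\left(\frac{\partial}{\partial u}-\mathrm j\frac{\partial}{\partial v}\right)$. Space: $\mathbb R^n_1$ ($n\ge 3$) is $\mathbb R^n$ with $a\cdot b=-a_1b_1+a_2b_2+\dots+a_nb_n$, and $\mathbb D^n_1=\mathbb D^n$ carries the $\mathbb D$-bilinear extension of this product; $a^2=a\cdot a$. Surfaces: a time-like surface $\mathcal M=(\mathcal D,\mathrm x)$ in $\mathbb R^n_1$ is given by a smooth immersion $\mathrm x(u,v):\mathcal D\to\mathbb R^n_1$ of a domain $\mathcal D\subset\mathbb R^2\cong\mathbb D$ (via $t=u+\mathrm jv$) whose induced metric is indefinite. $E=\mathrm x_u^2$, $F=\mathrm x_u\cdot\mathrm x_v$, $G=\mathrm x_v^2$; coordinates $(u,v)$ are isothermal if $E=-G$, $F=0$; they are always ordered so that $E<0$. $T_p(\mathcal M)$ is the tangent space, $N_p(\mathcal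 M)$ its orthogonal complement in $\mathbb R^n_1$; $a^\bot$ is the orthogonal projection of $a\in\mathbb D^n_1$ to the $\mathbb D$-linear span of $N_p(\mathcal M)$. With $\nabla$ the canonical flat connection, $\sigma(X,Y)=(\nabla_XY)^\bot$ is the second fundamental form; $\mathrm H=\frac12(-\sigma(X_1,X_1)+\sigma(X_2,X_2))$ for an orthonormal tangent basis with $X_1^2=-1$, $X_2^2=1$; $\mathcal M$ is minimal if $\mathrm H=0$ everywhere. In isothermal coordinates put $\Phi(t)=2\frac{\partial\mathrm x}{\partial t}=\mathrm x_u+\mathrm j\,\mathrm x_v\in\mathbb D^n_1$, $\Phi'=\frac{\partial\Phi}{\partial t}$, and ${\Phi'^{\bot}}^2=\Phi'^\bot\cdot\Phi'^\bot\in\mathbb D$. A point $p$ of a minimal time-like surface is degenerate if ${\Phi'^{\bot}}^2(p)\in\mathbb D_0$ (this does not depend on the isothermal coordinates). A minimal time-like surface is of general type if it has no degenerate points. Isothermal coordinates with $E<0$ on a minimal time-like surface are canonical if ${\Phi'^{\bot}}^2=1$ identically. *)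

(* Defs.v *)
From HB Require Import structures.
From mathcomp Require Import all_boot all_order all_algebra.
From mathcomp Require Import all_classical all_reals all_analysis.
From mathcomp Require Import ring.

Set Implicit Arguments.
Unset Strict Implicit.
Unset Printing Implicit Defensive.

Import Order.TTheory GRing.Theory Num.Theory.
Import numFieldNormedType.Exports.

Local Open Scope classical_set_scope.
Local Open Scope ring_scope.

(* ------------------------------------------------------------------------ *)
(* Double numbers u + j v with j ^ 2 = 1.                                   *)

Record dnum (R : Type) : Type := DNum { dRe : R; dIm : R }.

Definition pair_of_dnum (R : Type) (t : dnum R) : R * R := (dRe t, dIm t).
Definition dnum_of_pair (R : Type) (p : R * R) : dnum R := DNum p.1 p.2.

Lemma pair_of_dnumK (R : Type) : cancel (@pair_of_dnum R) (@dnum_of_pair R).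
Proof. by case. Qed.

HB.instance Definition _ (R : eqType) := Equality.copy (dnum R)
  (can_type (@pair_of_dnumK R)).
HB.instance Definition _ (R : choiceType) := Choice.copy (dnum R)
  (can_type (@pair_of_dnumK R)).

Definition dnum_zero (R : comNzRingType) : dnum R := DNum 0 0.
Definition dnum_opp (R : comNzRingType) (s : dnum R) : dnum R :=
  DNum (- dRe s) (- dIm s).
Definition dnum_add (R : comNzRingType) (s t : dnum R) : dnum R :=
  DNum (dRe s + dRe t) (dIm s + dIm t).
Definition dnum_one (R : comNzRingType) : dnum R := DNum 1 0.
Definition dnum_mul (R : comNzRingType) (s t : dnum R) : dnum R :=
  DNum (dRe s * dRe t + dIm s * dIm t) (dRe s * dIm t + dIm s * dRe t).

Lemma dnum_addA (R : comNzRingType) : associative (@dnum_add R).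
Proof. by move=> [a b] [c d] [e f]; congr DNum; rewrite /= addrA. Qed.

Lemma dnum_addC (R : comNzRingType) : commutative (@dnum_add R).
Proof. by move=> [a b] [c d]; congr DNum; rewrite /= addrC. Qed.

Lemma dnum_add0 (R : comNzRingType) :
  left_id (dnum_zero R) (@dnum_add R).
Proof. by move=> [a b]; congr DNum; rewrite /= add0r. Qed.

Lemma dnum_addN (R : comNzRingType) :
  left_inverse (dnum_zero R) (@dnum_opp R) (@dnum_add R).
Proof. by move=> [a b]; congr DNum; rewrite /= addNr. Qed.

HB.instance Definition _ (R : comNzRingType) :=
  GRing.isZmodule.Build (dnum R) (@dnum_addA R) (@dnum_addC R)
    (@dnum_add0 R) (@dnum_addN R).

Lemma dnum_mulA (R : comNzRingType) : associative (@dnum_mul R).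
Proof. by move=> [a b] [c d] [e f]; congr DNum => /=; ring. Qed.

Lemma dnum_mulC (R : comNzRingType) : commutative (@dnum_mul R).
Proof. by move=> [a b] [c d]; congr DNum => /=; ring. Qed.

Lemma dnum_mul1 (R : comNzRingType) : left_id (dnum_one R) (@dnum_mul R).
Proof. by move=> [a b]; congr DNum => /=; ring. Qed.

Lemma dnum_mulDl (R : comNzRingType) :
  left_distributive (@dnum_mul R) (@dnum_add R).
Proof. by move=> [a b] [c d] [e f]; congr DNum => /=; ring. Qed.

Lemma dnum_one_neq0 (R : comNzRingType) : dnum_one R != dnum_zero R.
Proof. by apply/eqP => -[] /eqP; rewrite oner_eq0. Qed.

HB.instance Definition _ (R : comNzRingType) :=
  GRing.Zmodule_isComNzRing.Build (dnum R) (@dnum_mulA R) (@dnum_mulC R)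
    (@dnum_mul1 R) (@dnum_mulDl R) (@dnum_one_neq0 R).

Definition dreal (R : comNzRingType) (a : R) : dnum R := DNum a 0.
Definition dj (R : comNzRingType) : dnum R := DNum 0 1.
Definition dconj (R : comNzRingType) (t : dnum R) : dnum R :=
  DNum (dRe t) (- dIm t).

Definition D0 (R : comNzRingType) : set (dnum R) :=
  [set t | t * dconj t = 0].

(* ------------------------------------------------------------------------ *)
(* The Lorentz product.  Taking A := R gives the product of R^n_1, and      *)
(* taking A := dnum R gives its bilinear extension to D^n_1.                *)

Definition lprod (A : comNzRingType) (n : nat) (a b : 'rV[A]_n) : A :=
  \sum_(i < n) (if i == 0%N :> nat then - (a 0 i * b 0 i) else a 0 i * b 0 i).

(* Orthogonal projection of a to S; it is the vector w below whenever there
   is exactly one such w, which is the case for nondegenerate subspaces S. *)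
Definition oproj (A : comNzRingType) (n : nat) (S : set 'rV[A]_n)
    (a : 'rV[A]_n) : 'rV[A]_n :=
  xget 0 [set w | S w /\ forall z, S z -> lprod (a - w) z = 0].

Definition dvec (R : comNzRingType) (n : nat) (a : 'rV[R]_n) :
  'rV[dnum R]_n := map_mx (@dreal R) a.

(* The D-linear span of a set of real vectors. *)
Definition dspan (R : comNzRingType) (n : nat) (S : set 'rV[R]_n) :
    set 'rV[dnum R]_n :=
  [set z | exists m (c : 'I_m -> dnum R) (w : 'I_m -> 'rV[R]_n),
      (forall i, S (w i)) /\ z = \sum_(i < m) c i *: dvec (w i)].

(* ------------------------------------------------------------------------ *)
(* Calculus on the plane.  Maps are total; only their values on the open    *)
(* set under consideration matter.                                          *)

Definition eu (R : realType) : R * R := (1, 0).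
Definition ev (R : realType) : R * R := (0, 1).

Fixpoint Ck (R : realType) (k : nat) (U : set (R * R)) (f : R * R -> R) :
    Prop :=
  (forall p, U p -> {for p, continuous f}) /\
  if k is k'.+1 then
    [/\ forall p, U p -> derivable f p (eu R) /\ derivable f p (ev R),
        Ck k' U ('D_(eu R) f) &
        Ck k' U ('D_(ev R) f)]
  else True.

Definition smooth (R : realType) (U : set (R * R)) (f : R * R -> R) : Prop :=
  forall k, Ck k U f.

Definition smooth_vec (R : realType) (n : nat) (U : set (R * R))
    (x : R * R -> 'rV[R]_n) : Prop :=
  forall i, smooth U (fun p => x p 0 i).

Definition smooth_map (R : realType) (U : set (R * R))
    (phi : R * R -> R * R) : Prop :=
  smooth U (fun p => (phi p).1) /\ smooth U (fun p => (phi p).2).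

Definition domain (R : realType) (U : set (R * R)) : Prop :=
  [/\ open U, connected U & U !=set0].

Definition diffeomorphism (R : realType) (U V : set (R * R))
    (phi : R * R -> R * R) : Prop :=
  [/\ open U, open V, set_bij U V phi, smooth_map U phi &
      exists2 psi, smooth_map V psi & forall p, U p -> psi (phi p) = p].

Definition partial (R : realType) (n : nat) (e : R * R)
    (x : R * R -> 'rV[R]_n) : R * R -> 'rV[R]_n :=
  fun p => \row_i 'D_e (fun q => x q 0 i) p.

Definition dpartial (R : realType) (n : nat) (e : R * R)
    (F : R * R -> 'rV[dnum R]_n) : R * R -> 'rV[dnum R]_n :=
  fun p => \row_i DNum ('D_e (fun q => dRe (F q 0 i)) p)
                       ('D_e (fun q => dIm (F q 0 i)) p).

(* d/dt = (d/du + j d/dv) / 2 *)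
Definition ddt (R : realType) (n : nat) (F : R * R -> 'rV[dnum R]_n) :
    R * R -> 'rV[dnum R]_n :=
  fun p => dreal (2^-1) *:
    (dpartial (eu R) F p + dj R *: dpartial (ev R) F p).

(* ------------------------------------------------------------------------ *)
(* Surfaces x : U -> R^n_1.  Points of the surface are points of the        *)
(* parameter domain, and tangent vectors (fields) are given by their        *)
(* components in the frame x_u, x_v.                                        *)

Definition pushforward (R : realType) (n : nat) (x : R * R -> 'rV[R]_n)
    (p X : R * R) : 'rV[R]_n :=
  X.1 *: partial (eu R) x p + X.2 *: partial (ev R) x p.

Definition tangent_space (R : realType) (n : nat) (x : R * R -> 'rV[R]_n)
    (p : R * R) : set 'rV[R]_n :=
  range (pushforward x p).

Definition normal_space (R : realType) (n : nat) (x : R * R -> 'rV[R]_n)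
    (p : R * R) : set 'rV[R]_n :=
  [set w | forall z, tangent_space x p z -> lprod w z = 0].

Definition metric (R : realType) (n : nat) (x : R * R -> 'rV[R]_n)
    (p X Y : R * R) : R :=
  lprod (pushforward x p X) (pushforward x p Y).

Definition immersion (R : realType) (n : nat) (U : set (R * R))
    (x : R * R -> 'rV[R]_n) : Prop :=
  smooth_vec U x /\
  forall p, U p -> injective (pushforward x p).

Definition timelike_surface (R : realType) (n : nat) (U : set (R * R))
    (x : R * R -> 'rV[R]_n) : Prop :=
  [/\ domain U, immersion U x &
      forall p, U p ->
        (exists X, metric x p X X < 0) /\ (exists Y, 0 < metric x p Y Y)].

(* The flat derivative of the tangent field Y along X, as a field of R^n. *)
Definition flat_derivative (R : realType) (n : nat)
    (x : R * R -> 'rV[R]_n) (X Y : R * R -> R * R) (p : R * R) : 'rV[R]_n :=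
  let y := fun q => pushforward x q (Y q) in
  (X p).1 *: partial (eu R) y p + (X p).2 *: partial (ev R) y p.

Definition second_form (R : realType) (n : nat) (x : R * R -> 'rV[R]_n)
    (X Y : R * R -> R * R) (p : R * R) : 'rV[R]_n :=
  oproj (normal_space x p) (flat_derivative x X Y p).

Definition orthonormal_basis (R : realType) (n : nat)
    (x : R * R -> 'rV[R]_n) (p X1 X2 : R * R) : Prop :=
  [/\ metric x p X1 X1 = - 1, metric x p X2 X2 = 1 & metric x p X1 X2 = 0].

(* The second fundamental form is tensorial, so the tangent vectors X1, X2
   at p are extended by the fields with constant components. *)
Definition mean_curvature (R : realType) (n : nat) (x : R * R -> 'rV[R]_n)
    (p X1 X2 : R * R) : 'rV[R]_n :=
  2^-1 *: (- second_form x (cst X1) (cst X1) p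
           + second_form x (cst X2) (cst X2) p).

Definition minimal_surface (R : realType) (n : nat) (U : set (R * R))
    (x : R * R -> 'rV[R]_n) : Prop :=
  forall p, U p -> forall X1 X2, orthonormal_basis x p X1 X2 ->
    mean_curvature x p X1 X2 = 0.

Definition isothermal (R : realType) (n : nat) (U : set (R * R))
    (x : R * R -> 'rV[R]_n) : Prop :=
  forall p, U p ->
    let E := lprod (partial (eu R) x p) (partial (eu R) x p) in
    let F := lprod (partial (eu R) x p) (partial (ev R) x p) in
    let G := lprod (partial (ev R) x p) (partial (ev R) x p) in
    [/\ E = - G, F = 0 & E < 0].

Definition Phi (R : realType) (n : nat) (x : R * R -> 'rV[R]_n) :
    R * R -> 'rV[dnum R]_n :=
  fun p => 2%:R *: ddt (fun q => dvec (x q)) p.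

(* The square of the D-normal part of Phi'. *)
Definition Phi'_perp_sq (R : realType) (n : nat) (x : R * R -> 'rV[R]_n)
    (p : R * R) : dnum R :=
  let w := oproj (dspan (normal_space x p)) (ddt (Phi x) p) in lprod w w.

(* New coordinates on a part of the surface with parameter domain U: phi maps
   the domain V of the new coordinates to the old ones, so that the surface is
   parametrized by x \o phi on V. *)
Definition coordinates_around (R : realType) (U : set (R * R)) (p : R * R)
    (V : set (R * R)) (phi : R * R -> R * R) : Prop :=
  [/\ domain V, diffeomorphism V (phi @` V) phi, phi @` V `<=` U &
      (phi @` V) p].

Definition degenerate (R : realType) (n : nat) (U : set (R * R))
    (x : R * R -> 'rV[R]_n) (p : R * R) : Prop :=
  exists (V : set (R * R)) (phi : R * R -> R * R) (q : R * R),
    [/\ coordinates_around U p V phi, isothermal V (x \o phi),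
        V q, phi q = p & D0 (Phi'_perp_sq (x \o phi) q)].

Definition general_type (R : realType) (n : nat) (U : set (R * R))
    (x : R * R -> 'rV[R]_n) : Prop :=
  forall p, U p -> ~ degenerate U x p.

Definition canonical_coordinates (R : realType) (n : nat) (V : set (R * R))
    (x : R * R -> 'rV[R]_n) : Prop :=
  isothermal V x /\ forall q, V q -> Phi'_perp_sq x q = 1.

(* Main.v *)
Require Import Defs.
From mathcomp Require Import all_boot all_order all_algebra.
From mathcomp Require Import all_classical all_reals all_analysis.
From mathcomp Require Import ring lra.

(* With W^2 = F^2 - E G, the conjugate form of dx is
   *dx = ((E x_v - F x_u) du + (F x_v - G x_u) dv) / W; minimality says exactly
   that it is closed.  The forms (dx + *dx) / 2 and (dx - *dx) / 2 are closed,
   of rank one and null-valued, hence equal to th+ a+ and th- a-, where th+ and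
   th- are closed scalar forms and da+ = th+ b+, da- = th- b-.  By the Poincare
   lemma and the inverse function theorem there are coordinates (u, v) with
   th+ = du + dv and th- = du - dv; they are isothermal and the square of the
   normal part of Phi' has real part 2 (b+^2 + b-^2) and imaginary part
   2 (b+^2 - b-^2).  Both squares are nonnegative because the normal space is
   spacelike, and nonzero because the surface has no degenerate point.
   Replacing th by the form (4 b^2)^(1/4) th, which is still closed, makes both
   squares equal to 1/4. *)

Set Implicit Arguments.
Unset Strict Implicit.
Unset Printing Implicit Defensive.

Import Order.TTheory GRing.Theory Num.Theory.
Import numFieldNormedType.Exports.

Local Open Scope classical_set_scope.
Local Open Scope ring_scope.

(** * Mean value theorem on boxes *)

(** No isothermal chart is given at the start, so everything is computed in the original
    coordinates, and the two null directions come from the two square roots W and - W of F^2 - E G.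
    The conjugate form is closed for two separate reasons. The normal part of its exterior
    derivative is that of (E x_vv - 2 F x_uv + G x_uu) / W, a multiple of the mean curvature. The
    tangential part vanishes because the products of the conjugate form with x_u and x_v are only 0,
    W and - W, with W^2 = F^2 - E G. The exponent 1/4 arises as follows: replacing th by L th turns
    a into a / L and b into b / L^2 plus a multiple of a; that multiple does not affect the square,
    a being null and orthogonal to b, so b^2 becomes b^2 / L^4. The form L th stays closed because
    da = th b forces db, hence dL, to be proportional to th. Degeneracy is defined through an
    isothermal chart, so a chart is built twice: from the raw forms, in order to exploit general
    type, and again from the rescaled ones. The requirement E < 0 amounts to a+ . a- < 0 and is met
    by changing the signs of th- and a- if necessary. *)

Definition box (R : realType) (p : R * R) (r : R) : set (R * R) :=
  [set z | `|z.1 - p.1| < r /\ `|z.2 - p.2| < r].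

Lemma ball_box (R : realType) (p : R * R) (r : R) : ball p r = box p r.
Proof.
apply/seteqP; split=> z [] /=.
  by rewrite /ball /= => h1 h2; split; rewrite distrC.
by move=> h1 h2; split; rewrite /ball /= distrC.
Qed.

Lemma box_center (R : realType) (p : R * R) (r : R) : 0 < r -> box p r p.
Proof. by move=> r0; split; rewrite subrr normr0. Qed.

Lemma nbhs_box (R : realType) (p : R * R) (A : set (R * R)) :
  nbhs p A <-> exists2 r, 0 < r & box p r `<=` A.
Proof.
split=> [/nbhs_ballP [r /= r0 h]|[r r0 h]].
  by exists r => //; rewrite -ball_box.
by apply/nbhs_ballP; exists r => //=; rewrite ball_box.
Qed.

Lemma box_open (R : realType) (p : R * R) (r : R) : open (box p r).
Proof.
rewrite openE => z [h1 h2]; apply/nbhs_box.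
exists (Num.min (r - `|z.1 - p.1|) (r - `|z.2 - p.2|)).
  by rewrite lt_min !subr_gt0 h1 h2.
move=> w [] /=; rewrite !lt_min => /andP[k1 _] /andP[_ k2]; split.
  rewrite (_ : w.1 - p.1 = (w.1 - z.1) + (z.1 - p.1)); last by ring.
  by apply: (le_lt_trans (ler_normD _ _)); rewrite -ltrBrDr.
rewrite (_ : w.2 - p.2 = (w.2 - z.2) + (z.2 - p.2)); last by ring.
by apply: (le_lt_trans (ler_normD _ _)); rewrite -ltrBrDr.
Qed.

Lemma box_subset (R : realType) (p : R * R) (r s : R) :
  r <= s -> box p r `<=` box p s.
Proof. by move=> rs z [h1 h2]; split; apply: lt_le_trans rs. Qed.

(** The endpoints come in either order, so that increments of both signs are treated alike. *)
Definition between (R : realType) (a b : R) : set R :=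
  [set s | Num.min a b <= s <= Num.max a b].

Lemma between_norm (R : realType) (a b s : R) :
  between a b s -> `|s - a| <= `|b - a|.
Proof.
rewrite /between /= ge_min le_max => /andP[/orP[] h1 /orP[] h2];
  rewrite ler_norml; have [k|k] := leP 0 (b - a);
  rewrite ?(ger0_norm k) ?(ltr0_norm k); apply/andP; split; lra.
Qed.

Lemma between_dist (R : realType) (a b s c r : R) :
  between a b s -> `|a - c| < r -> `|b - c| < r -> `|s - c| < r.
Proof.
rewrite /between /= ge_min le_max !ltr_norml => /andP[/orP[] h1 /orP[] h2]
  /andP[h3 h4] /andP[h5 h6]; apply/andP; split; lra.
Qed.

Lemma MVT_between (R : realType) (g : R -> R) (a b : R) :
  (forall s, between a b s -> derivable g s 1) ->
  exists2 c, between a b c & g b - g a = 'D_1 g c * (b - a).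
Proof.
rewrite /between /=.
wlog ab : a b / a <= b => [H|] dg.
  have [ab|ba] := orP (le_total a b); first exact: H.
  have [s|c hc e] := H _ _ ba; first by rewrite minC maxC; exact: dg.
  exists c; first by rewrite minC maxC.
  by rewrite -opprB e; ring.
have dgi s : s \in `]a, b[ -> is_derive s 1 g ('D_1 g s).
  rewrite in_itv /= => /andP[h1 h2].
  apply: DeriveDef => //; apply: dg.
  by rewrite ge_min le_max (ltW h1) (ltW h2) orbT.
have cg : {within `[a, b], continuous g}.
  apply: derivable_within_continuous => s; rewrite in_itv /= => /andP[h1 h2].
  by apply: dg; rewrite ge_min le_max h1 h2 orbT.
have [c cab e] := MVT_segment ab dgi cg.
exists c => //; move: cab; rewrite in_itv /= => /andP[h1 h2].
by rewrite ge_min le_max h1 h2 orbT.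
Qed.

(** The two difference quotients are the same function of h, so one-variable theorems carry over to
    directional derivatives without any limit argument. *)
Lemma line_quotient (R : realType) (f : R * R -> R) (p e : R * R) (g : R -> R)
    (t : R) : (forall h, g (h + t) = f (h *: e + p)) ->
  (fun h => h^-1 *: ((f \o shift p) (h *: e) - f p)) =
  (fun h => h^-1 *: ((g \o shift t) (h *: 1) - g t)).
Proof.
move=> gf; apply/funext => h /=.
rewrite gf [h *: 1]mulr1; congr (_ *: (_ - _)).
by have := gf 0; rewrite add0r scale0r add0r.
Qed.

Lemma line_derivable (R : realType) (f : R * R -> R) (p e : R * R)
    (g : R -> R) (t : R) : (forall h, g (h + t) = f (h *: e + p)) ->
  derivable f p e = derivable g t 1.
Proof. by move=> gf; rewrite /derivable (line_quotient gf). Qed.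

Lemma line_derive (R : realType) (f : R * R -> R) (p e : R * R)
    (g : R -> R) (t : R) : (forall h, g (h + t) = f (h *: e + p)) ->
  'D_e f p = 'D_1 g t.
Proof. by move=> gf; rewrite /derive (line_quotient gf). Qed.

Lemma line_eu (R : realType) (f : R * R -> R) (s v : R) (h : R) :
  f (h + s, v) = f (h *: eu R + (s, v)).
Proof.
by congr (f (_, _)); rewrite /= ?scaler0 ?add0r // [h *: 1]mulr1.
Qed.

Lemma line_ev (R : realType) (f : R * R -> R) (s v : R) (h : R) :
  f (s, h + v) = f (h *: ev R + (s, v)).
Proof.
by congr (f (_, _)); rewrite /= ?scaler0 ?add0r // [h *: 1]mulr1.
Qed.

Lemma MVT_eu (R : realType) (f : R * R -> R) (a b v : R) :
  (forall s, between a b s -> derivable f (s, v) (eu R)) ->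
  exists2 c, between a b c & f (b, v) - f (a, v) = 'D_(eu R) f (c, v) * (b - a).
Proof.
move=> df; have [s /df|c hc e] := @MVT_between R (fun s => f (s, v)) a b.
  by rewrite (line_derivable (g := fun s => f (s, v)) (line_eu f s v)).
exists c => //; rewrite e; congr (_ * _).
by rewrite (line_derive (g := fun s => f (s, v)) (line_eu f c v)).
Qed.

Lemma MVT_ev (R : realType) (f : R * R -> R) (a b u : R) :
  (forall s, between a b s -> derivable f (u, s) (ev R)) ->
  exists2 c, between a b c & f (u, b) - f (u, a) = 'D_(ev R) f (u, c) * (b - a).
Proof.
move=> df; have [s /df|c hc e] := @MVT_between R (fun s => f (u, s)) a b.
  by rewrite (line_derivable (g := fun s => f (u, s)) (line_ev f u s)).
exists c => //; rewrite e; congr (_ * _).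
by rewrite (line_derive (g := fun s => f (u, s)) (line_ev f u c)).
Qed.

(* Caratheodory's form of differentiability at a point of continuity of the
   two partial derivatives. *)
Lemma caratheodory (R : realType) (f : R * R -> R) (z : R * R) :
  (\forall w \near z, derivable f w (eu R) /\ derivable f w (ev R)) ->
  {for z, continuous ('D_(eu R) f)} -> {for z, continuous ('D_(ev R) f)} ->
  exists A B : R * R -> R,
    [/\ A @ z --> 'D_(eu R) f z, B @ z --> 'D_(ev R) f z &
        \forall w \near z,
          f w - f z = A w * (w.1 - z.1) + B w * (w.2 - z.2)].
Proof.
move=> /nbhs_box[r r0 df] cu cv.
(* The increment is split at the corner (z.1, w.2), with one mean value point on each leg. Outside
   the box the dummy value z satisfies the bounds, so [choice] can produce a total function. *)
have H w : exists cd : R * R, [/\ `|cd.1 - z.1| <= `|w.1 - z.1|,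
    `|cd.2 - z.2| <= `|w.2 - z.2| & box z r w ->
    f w - f z = 'D_(eu R) f (cd.1, w.2) * (w.1 - z.1) +
                'D_(ev R) f (z.1, cd.2) * (w.2 - z.2)].
  have [[h1 h2]|nw] := pselect (box z r w); last first.
    by exists z; rewrite !subrr normr0.
  have [s hs|c hc ec] := @MVT_eu R f z.1 w.1 w.2.
    apply: (proj1 (df (s, w.2) _)); split=> //=.
    by apply: between_dist hs _ h1; rewrite subrr normr0.
  have [s hs|d hd ed] := @MVT_ev R f z.2 w.2 z.1.
    apply: (proj2 (df (z.1, s) _)); split=> /=; first by rewrite subrr normr0.
    by apply: between_dist hs _ h2; rewrite subrr normr0.
  exists (c, d); split => /=; try exact: between_norm.
  by move=> _; rewrite -ec -ed -!surjective_pairing; ring.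
have {H} [cd Hcd] := choice H.
have C0 : forall e, 0 < e -> \forall w \near z, box z e ((cd w).1, w.2).
  move=> e e0; apply/nbhs_box; exists e => // w [h1 h2].
  by have [k _ _] := Hcd w; split=> //=; apply: le_lt_trans h1.
have D0 : forall e, 0 < e -> \forall w \near z, box z e (z.1, (cd w).2).
  move=> e e0; apply/nbhs_box; exists e => // w [h1 h2].
  have [_ k _] := Hcd w; split=> /=; first by rewrite subrr normr0.
  exact: le_lt_trans h2.
exists (fun w => 'D_(eu R) f ((cd w).1, w.2)),
       (fun w => 'D_(ev R) f (z.1, (cd w).2)); split.
- apply: (cvg_comp (fun w => ((cd w).1, w.2)) ('D_(eu R) f)) cu => A.
  move=> /nbhs_box[e e0 eA]; apply: filterS (C0 _ e0) => w; exact: eA.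
- apply: (cvg_comp (fun w => (z.1, (cd w).2)) ('D_(ev R) f)) cv => A.
  move=> /nbhs_box[e e0 eA]; apply: filterS (D0 _ e0) => w; exact: eA.
- apply/nbhs_box; exists r => // w bw; by have [_ _ ->] := Hcd w.
Qed.

(** * Smooth functions of two variables *)

Lemma is_deriveE (R : realType) (f : R * R -> R) (p e : R * R) (d : R) :
  is_derive p e f d <-> h^-1 * (f (h *: e + p) - f p) @[h --> 0^'] --> d.
Proof.
split=> [[df <-]|df]; first exact: df.
by split; [exact: (cvgP d)|exact: cvg_lim].
Qed.

Lemma shift_cvg (R : realType) (p e : R * R) :
  h *: e + p @[h --> (0 : R)] --> p.
Proof.
rewrite -[X in _ --> X]add0r -(scale0r e).
by apply: cvgD; [apply: cvgZ; [exact: cvg_id|exact: cvg_cst]|exact: cvg_cst].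
Qed.

Lemma shift_continuous (R : realType) (T : topologicalType) (f : R * R -> T)
    (p e : R * R) : {for p, continuous f} ->
  f (h *: e + p) @[h --> (0 : R)^'] --> f p.
Proof.
move=> cf; apply: cvg_within_filter.
exact: (cvg_comp (fun h : R => h *: e + p) f (@shift_cvg R p e)) cf.
Qed.

Lemma is_derive_local (R : realType) (U : set (R * R)) (f g : R * R -> R)
    (p e : R * R) (d : R) : open U -> U p -> (forall q, U q -> f q = g q) ->
  is_derive p e f d -> is_derive p e g d.
Proof.
move=> oU Up fg [df <-]; have fgn : \forall q \near p, f q = g q.
  by apply: (filterS fg); apply: open_nbhs_nbhs.
by split; [exact: near_eq_derivable df|rewrite (near_eq_derive _ fgn)].
Qed.

(** Rationalizing, the quotient of the root is the quotient of f divided by the sum of the two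
    roots, whose limit is not zero. *)
Lemma is_derive_sqrt (R : realType) (f : R * R -> R) (p e : R * R) (d : R) :
  {for p, continuous f} -> 0 < f p -> is_derive p e f d ->
  is_derive p e (fun q => Num.sqrt (f q)) (d * (2 * Num.sqrt (f p))^-1).
Proof.
move=> cf fp /is_deriveE df; apply/is_deriveE.
have sp : 0 < Num.sqrt (f p) by rewrite sqrtr_gt0.
have cs : Num.sqrt (f (h *: e + p)) @[h --> 0^'] --> Num.sqrt (f p).
  apply: (cvg_comp (fun h : R => f (h *: e + p)) Num.sqrt).
    exact: shift_continuous.
  exact: sqrt_continuous.
have : (h^-1 * (f (h *: e + p) - f p) *
   (Num.sqrt (f (h *: e + p)) + Num.sqrt (f p))^-1) @[h --> 0^'] -->
   d * (Num.sqrt (f p) + Num.sqrt (f p))^-1.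
  apply: cvgM => //; apply: cvgV; first by rewrite gt_eqF // addr_gt0.
  by apply: cvgD => //; exact: cvg_cst.
rewrite mulr_natl mulr2n; apply: cvg_trans; apply: near_eq_cvg.
have fpos : \forall h \near (0 : R)^', 0 < f (h *: e + p).
  exact: cvgr_gt (@shift_continuous _ _ _ _ e cf) _ fp.
near=> h.
have hp : 0 < f (h *: e + p) by near: h.
have sh : 0 < Num.sqrt (f (h *: e + p)) by rewrite sqrtr_gt0.
rewrite -mulrA; congr (_ * _).
rewrite -{1}(sqr_sqrtr (ltW hp)) -{1}(sqr_sqrtr (ltW fp)) subr_sqr mulfK //.
by rewrite gt_eqF // addr_gt0.
Unshelve. all: by end_near. Qed.

(** [Ck] speaks of these two directions only; quantifying over them lets one argument serve both. *)
Definition is_axis (R : realType) (e : R * R) : Prop := e = eu R \/ e = ev R.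

Lemma axis_eu (R : realType) : is_axis (eu R). Proof. by left. Qed.
Lemma axis_ev (R : realType) : is_axis (ev R). Proof. by right. Qed.
#[global] Hint Resolve axis_eu axis_ev : core.

Lemma CkS (R : realType) (k : nat) (U : set (R * R)) (f : R * R -> R) :
  Ck k.+1 U f <-> (forall p, U p -> {for p, continuous f}) /\
    forall e, is_axis e ->
      (forall p, U p -> derivable f p e) /\ Ck k U ('D_e f).
Proof.
split=> [[cf [df fu fv]]|[cf df]].
  by split=> // e [] ->; split=> // p /df [].
split=> //; have [du fu] := df _ (axis_eu R); have [dv fv] := df _ (axis_ev R).
by split=> // p Up; split; [exact: du|exact: dv].
Qed.

Lemma Ck_continuous (R : realType) (k : nat) (U : set (R * R))
    (f : R * R -> R) :
  Ck k U f -> forall p, U p -> {for p, continuous f}.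
Proof. by case: k => [|k] []. Qed.

Lemma CkW (R : realType) (k : nat) (U : set (R * R)) (f : R * R -> R) :
  Ck k.+1 U f -> Ck k U f.
Proof.
elim: k f => [|k IH] f /CkS[cf df]; first by [].
by apply/CkS; split=> // e /df[dfe /IH].
Qed.

Lemma Ck_subset (R : realType) (k : nat) (U V : set (R * R))
    (f : R * R -> R) : V `<=` U -> Ck k U f -> Ck k V f.
Proof.
move=> VU; elim: k f => [|k IH] f; first by case=> cf _; split=> // p /VU /cf.
move=> /CkS[cf df]; apply/CkS; split=> [p /VU /cf //|e /df[dfe /IH]].
by split=> // p /VU /dfe.
Qed.

Lemma continuous_local (R : realType) (U : set (R * R)) (f g : R * R -> R)
    (p : R * R) : open U -> U p -> (forall q, U q -> f q = g q) ->
  {for p, continuous f} -> {for p, continuous g}.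
Proof.
move=> oU Up fg cf.
have fgn : \forall q \near p, f q = g q.
  by apply: (filterS fg); apply: open_nbhs_nbhs.
rewrite /prop_for /continuous_at -fg //; apply: cvg_trans cf.
exact: near_eq_cvg.
Qed.

Lemma Ck_local (R : realType) (k : nat) (U : set (R * R))
    (f g : R * R -> R) : open U -> (forall p, U p -> f p = g p) ->
  Ck k U f -> Ck k U g.
Proof.
move=> oU; elim: k f g => [|k IH] f g fg.
  by case=> cf _; split=> // p Up; exact: continuous_local oU Up fg (cf p Up).
move=> fk; have cg p : U p -> {for p, continuous g}.
  by move=> Up; exact: continuous_local oU Up fg (Ck_continuous fk Up).
move/CkS: fk => [cf df]; apply/CkS; split=> // e /df[dfe fe].
have gd p : U p -> is_derive p e g ('D_e f p).
  by move=> Up; apply: is_derive_local oU Up fg (derivableP (dfe p Up)).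
split=> [p /gd [] //|]; apply: IH fe => p Up.
by have [_ ->] := gd p Up.
Qed.

(** The induction step of all closure properties below: a formula for the derivative is known only
    on U, whereas [Ck] speaks of the total function ['D_e f]; openness of U bridges the gap. *)
Lemma Ck_is_derive (R : realType) (k : nat) (U : set (R * R))
    (f : R * R -> R) : open U -> (forall p, U p -> {for p, continuous f}) ->
  (forall e, is_axis e -> exists2 g, Ck k U g &
     forall p, U p -> is_derive p e f (g p)) -> Ck k.+1 U f.
Proof.
move=> oU cf H; apply/CkS; split=> // e /H[g gk fg].
split=> [p /fg [] //|]; apply: Ck_local gk => // p /fg [_ ->] //.
Qed.

Lemma Ck_derivable (R : realType) (k : nat) (U : set (R * R))
    (f : R * R -> R) (p e : R * R) : Ck k.+1 U f -> U p -> is_axis e ->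
  is_derive p e f ('D_e f p).
Proof. by move=> /CkS[_ df] Up /df[dfe _]; apply: derivableP; exact: dfe. Qed.

Lemma Ck_derive (R : realType) (k : nat) (U : set (R * R))
    (f : R * R -> R) (e : R * R) : Ck k.+1 U f -> is_axis e ->
  Ck k U ('D_e f).
Proof. by move=> /CkS[_ df] /df[]. Qed.

Lemma Ck_cst (R : realType) (k : nat) (U : set (R * R)) (c : R) :
  open U -> Ck k U (fun=> c).
Proof.
move=> oU; elim: k c => [|k IH] c; first by split=> // p _; exact: cvg_cst.
apply: Ck_is_derive => // [p _|e _]; first exact: cvg_cst.
by exists (fun=> 0) => // p _; exact: is_derive_cst.
Qed.

Lemma Ck_add (R : realType) (k : nat) (U : set (R * R)) (f g : R * R -> R) :
  open U -> Ck k U f -> Ck k U g -> Ck k U (fun p => f p + g p).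
Proof.
move=> oU; elim: k f g => [|k IH] f g fk gk.
  split=> // p Up; exact: cvgD (Ck_continuous fk Up) (Ck_continuous gk Up).
apply: Ck_is_derive => // [p Up|e ae].
  exact: cvgD (Ck_continuous fk Up) (Ck_continuous gk Up).
exists (fun p => 'D_e f p + 'D_e g p); first by apply: IH; exact: Ck_derive.
by move=> p Up; exact: is_deriveD (Ck_derivable fk Up ae) (Ck_derivable gk Up ae).
Qed.

Lemma Ck_mul (R : realType) (k : nat) (U : set (R * R)) (f g : R * R -> R) :
  open U -> Ck k U f -> Ck k U g -> Ck k U (fun p => f p * g p).
Proof.
move=> oU; elim: k f g => [|k IH] f g fk gk.
  split=> // p Up; exact: cvgM (Ck_continuous fk Up) (Ck_continuous gk Up).
apply: Ck_is_derive => // [p Up|e ae].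
  exact: cvgM (Ck_continuous fk Up) (Ck_continuous gk Up).
exists (fun p => f p * 'D_e g p + g p * 'D_e f p).
  by apply: Ck_add => //; apply: IH; do ?[exact: Ck_derive|exact: CkW].
move=> p Up.
exact: is_deriveM (Ck_derivable fk Up ae) (Ck_derivable gk Up ae).
Qed.

(** The derivative of 1/f contains 1/f again, at one order less, so the induction runs with f fixed.
    The square root is treated in the same way. *)
Lemma Ck_inv (R : realType) (k : nat) (U : set (R * R)) (f : R * R -> R) :
  open U -> (forall p, U p -> f p != 0) -> Ck k U f ->
  Ck k U (fun p => (f p)^-1).
Proof.
move=> oU f0; elim: k => [|k IH] fk.
  by split=> // p Up; apply: cvgV (Ck_continuous fk Up); exact: f0.
apply: Ck_is_derive => // [p Up|e ae].
  by apply: cvgV (Ck_continuous fk Up); exact: f0.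
have gk := IH (CkW fk).
exists (fun p => (- 1) * ((f p)^-1 * (f p)^-1) * 'D_e f p).
  apply: Ck_mul => //; last exact: Ck_derive.
  by apply: Ck_mul => //; [exact: Ck_cst|exact: Ck_mul].
move=> p Up; have [dfp _] := Ck_derivable fk Up ae.
split; first exact: derivableV (f0 _ Up) dfp.
by rewrite deriveV ?f0 // mulN1r -expr2 exprVn.
Qed.

Lemma Ck_sqrt (R : realType) (k : nat) (U : set (R * R)) (f : R * R -> R) :
  open U -> (forall p, U p -> 0 < f p) -> Ck k U f ->
  Ck k U (fun p => Num.sqrt (f p)).
Proof.
move=> oU f0; elim: k => [|k IH] fk.
  split=> // p Up; apply: (cvg_comp f Num.sqrt (Ck_continuous fk Up)).
  exact: sqrt_continuous.
apply: Ck_is_derive => // [p Up|e ae].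
  apply: (cvg_comp f Num.sqrt (Ck_continuous fk Up)); exact: sqrt_continuous.
have gk := IH (CkW fk).
exists (fun p => 'D_e f p * (2 * Num.sqrt (f p))^-1).
  apply: Ck_mul => //; first exact: Ck_derive.
  apply: Ck_inv => //; last by apply: Ck_mul => //; exact: Ck_cst.
  by move=> p Up; rewrite gt_eqF // mulr_gt0 // sqrtr_gt0 f0.
move=> p Up; apply: is_derive_sqrt (Ck_derivable fk Up ae).
  exact: Ck_continuous fk _ Up.
exact: f0.
Qed.

Lemma C1_caratheodory (R : realType) (k : nat) (U : set (R * R))
    (f : R * R -> R) (z : R * R) : open U -> U z -> Ck k.+1 U f ->
  exists A B : R * R -> R,
    [/\ A @ z --> 'D_(eu R) f z, B @ z --> 'D_(ev R) f z &
        \forall w \near z,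
          f w - f z = A w * (w.1 - z.1) + B w * (w.2 - z.2)].
Proof.
move=> oU Uz fk; apply: caratheodory.
- apply: (@filterS _ _ _ U); last exact: open_nbhs_nbhs.
  by move=> w Uw; split; [have [] := Ck_derivable fk Uw (axis_eu R)|
    have [] := Ck_derivable fk Uw (axis_ev R)].
- exact: Ck_continuous (Ck_derive fk (axis_eu R)) _ Uz.
- exact: Ck_continuous (Ck_derive fk (axis_ev R)) _ Uz.
Qed.

(** With g in Caratheodory's form the quotient of the composite is a sum of products of limits;
    there is no division by increments of [phi], which may vanish. *)
Lemma chain_rule (R : realType) (k : nat) (U : set (R * R)) (g : R * R -> R)
    (phi : R * R -> R * R) (q e : R * R) (d1 d2 : R) :
  open U -> U (phi q) -> Ck k.+1 U g -> {for q, continuous phi} ->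
  is_derive q e (fun z => (phi z).1) d1 ->
  is_derive q e (fun z => (phi z).2) d2 ->
  is_derive q e (fun z => g (phi z))
    ('D_(eu R) g (phi q) * d1 + 'D_(ev R) g (phi q) * d2).
Proof.
move=> oU Uq gk cphi /is_deriveE dp1 /is_deriveE dp2; apply/is_deriveE.
have [A [B [cA cB AB]]] := C1_caratheodory oU Uq gk.
have cl : phi (h *: e + q) @[h --> 0^'] --> phi q.
  exact: shift_continuous.
have cl' (C : R * R -> R) (c : R) : C @ phi q --> c ->
    C (phi (h *: e + q)) @[h --> 0^'] --> c.
  exact: (cvg_comp (fun h : R => phi (h *: e + q)) C cl).
have E : \forall h \near (0 : R)^',
  A (phi (h *: e + q)) * (h^-1 * ((phi (h *: e + q)).1 - (phi q).1)) +
  B (phi (h *: e + q)) * (h^-1 * ((phi (h *: e + q)).2 - (phi q).2)) =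
  h^-1 * (g (phi (h *: e + q)) - g (phi q)).
  have := cl _ AB; rewrite /nbhs /= => cAB.
  by apply: filterS cAB => h /= ->; ring.
apply: cvg_trans (near_eq_cvg E) _.
by apply: cvgD; [exact: (cvgM (cl' _ _ cA) dp1)|
  exact: (cvgM (cl' _ _ cB) dp2)].
Qed.

Lemma pair_continuous (R : realType) (phi : R * R -> R * R) (q : R * R) :
  {for q, continuous (fun z => (phi z).1)} ->
  {for q, continuous (fun z => (phi z).2)} -> {for q, continuous phi}.
Proof.
move=> c1 c2; rewrite (_ : phi = fun z => ((phi z).1, (phi z).2)).
  exact: (cvg_pair c1 c2).
by apply/funext => z; case: (phi z).
Qed.

(** The induction passes from g to its partial derivatives, so g is smooth of all orders, while
    [phi] has just the order k that the bootstrap in [inverse_function] can offer. *)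
Lemma Ck_comp (R : realType) (k : nat) (U V : set (R * R)) (g : R * R -> R)
    (phi : R * R -> R * R) : open U -> open V -> smooth U g ->
  (forall q, V q -> U (phi q)) -> Ck k V (fun z => (phi z).1) ->
  Ck k V (fun z => (phi z).2) -> Ck k V (fun z => g (phi z)).
Proof.
move=> oU oV + VU; elim: k g => [|k IH] g gs p1 p2.
  split=> // q Vq; apply: (cvg_comp phi g); last first.
    exact: Ck_continuous (gs 0%N) _ (VU _ Vq).
  by apply: pair_continuous; [exact: Ck_continuous p1 _ Vq|
    exact: Ck_continuous p2 _ Vq].
have cphi q : V q -> {for q, continuous phi}.
  move=> Vq; by apply: pair_continuous; [exact: Ck_continuous p1 _ Vq|
    exact: Ck_continuous p2 _ Vq].
apply: Ck_is_derive => // [q Vq|e ae].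
  apply: (cvg_comp phi g); first exact: cphi.
  exact: Ck_continuous (gs 0%N) _ (VU _ Vq).
exists (fun q => 'D_(eu R) g (phi q) * 'D_e (fun z => (phi z).1) q +
  'D_(ev R) g (phi q) * 'D_e (fun z => (phi z).2) q).
  have IHD d : is_axis d -> Ck k V (fun z => 'D_d g (phi z)).
    move=> ad; apply: (IH ('D_d g)); do ?exact: CkW.
    by move=> j; exact: Ck_derive (gs j.+1) ad.
  by apply: Ck_add => //; apply: Ck_mul => //; do ?[exact: IHD|exact: Ck_derive].
move=> q Vq; apply: chain_rule oU (VU _ Vq) (gs 1%N) (cphi _ Vq) _ _.
  exact: Ck_derivable p1 Vq ae.
exact: Ck_derivable p2 Vq ae.
Qed.

(** * Symmetry of second derivatives and the Poincare lemma *)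

(** The second difference of f over a small square of side t equals t^2 times either mixed
    derivative at some point of the square; continuity at p then makes both values agree up to any
    e. *)
Lemma schwarz (R : realType) (U : set (R * R)) (f : R * R -> R) (p : R * R) :
  open U -> U p -> Ck 2 U f -> 'D_(ev R) ('D_(eu R) f) p = 'D_(eu R) ('D_(ev R) f) p.
Proof.
move=> oU Up f2.
set g := 'D_(ev R) ('D_(eu R) f); set k := 'D_(eu R) ('D_(ev R) f).
have cg : {for p, continuous g}.
  exact: Ck_continuous (Ck_derive (Ck_derive f2 (axis_eu R)) (axis_ev R)) _ Up.
have ck : {for p, continuous k}.
  exact: Ck_continuous (Ck_derive (Ck_derive f2 (axis_ev R)) (axis_eu R)) _ Up.
apply/eqP; rewrite -subr_eq0 -normr_le0; apply/ler_addgt0Pr => e e0.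
rewrite add0r.
have e2 : 0 < e / 2 by rewrite divr_gt0.
have /nbhs_box[r r0 rU] : \forall z \near p,
    [/\ U z, `|g p - g z| < e / 2 & `|k p - k z| < e / 2].
  have n1 : \forall z \near p, `|g p - g z| < e / 2.
    exact: (cvgr_dist_lt _ _ cg _ e2).
  have n2 : \forall z \near p, `|k p - k z| < e / 2.
    exact: (cvgr_dist_lt _ _ ck _ e2).
  have n3 : nbhs p U by exact: open_nbhs_nbhs.
  by apply: filterS (filterI n3 (filterI n1 n2)) => z [Uz [g1 k1]].
case: p => u v in Up g k cg ck rU *.
set t := r / 2; have t0 : 0 < t by rewrite divr_gt0.
have tr : t < r by rewrite /t; lra.
have tu : u + t - u = t by ring.
have tv : v + t - v = t by ring.
have bt c d : between u (u + t) c -> between v (v + t) d -> box (u, v) r (c, d).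
  move=> hc hd; split => /=.
    by apply: between_dist hc _ _; rewrite ?subrr ?normr0 // addrC addKr gtr0_norm.
  by apply: between_dist hd _ _; rewrite ?subrr ?normr0 // addrC addKr gtr0_norm.
have bu : between u (u + t) u by rewrite /between /= ge_min le_max !lexx.
have bu' : between u (u + t) (u + t).
  by rewrite /between /= ge_min le_max !lexx !orbT.
have bv : between v (v + t) v by rewrite /between /= ge_min le_max !lexx.
have bv' : between v (v + t) (v + t).
  by rewrite /between /= ge_min le_max !lexx !orbT.
have UU c d : between u (u + t) c -> between v (v + t) d -> U (c, d).
  by move=> hc hd; have [] := rU _ (bt c d hc hd).
have du c d : U (c, d) -> is_derive c 1 (fun s => f (s, d)) ('D_(eu R) f (c, d)).
  move=> Uc; rewrite (line_derive (g := fun s => f (s, d)) (line_eu f c d)).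
  apply: derivableP; rewrite -(line_derivable (line_eu f c d)).
  by have [] := Ck_derivable f2 Uc (axis_eu R).
have dv c d : U (c, d) -> is_derive d 1 (fun s => f (c, s)) ('D_(ev R) f (c, d)).
  move=> Uc; rewrite (line_derive (g := fun s => f (c, s)) (line_ev f c d)).
  apply: derivableP; rewrite -(line_derivable (line_ev f c d)).
  by have [] := Ck_derivable f2 Uc (axis_ev R).
have [c1 hc1 [d1 hd1 E1]] : exists2 c, between u (u + t) c &
    exists2 d, between v (v + t) d &
    f (u + t, v + t) - f (u + t, v) - (f (u, v + t) - f (u, v)) =
    g (c, d) * t * t.
  have dF c : between u (u + t) c ->
      is_derive c 1 ((fun s => f (s, v + t)) - (fun s => f (s, v)))
        ('D_(eu R) f (c, v + t) - 'D_(eu R) f (c, v)).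
    by move=> hc; apply: is_deriveB; apply: du; exact: UU.
  have [c hc /= E] := @MVT_between R
    ((fun s => f (s, v + t)) - (fun s => f (s, v))) u (u + t)
    (fun c hc => @ex_derive _ _ _ _ _ _ _ (dF c hc)).
  have [d hd E'] := @MVT_ev R ('D_(eu R) f) v (v + t) c
    (fun d hd => @ex_derive _ _ _ _ _ _ _
      (Ck_derivable (Ck_derive f2 (axis_eu R)) (UU _ _ hc hd) (axis_ev R))).
  exists c; first exact: hc.
  exists d; first exact: hd.
  move: E; have [_ ->] := dF c hc; rewrite E' !fctE tu tv => ->.
  by rewrite /g.
have [c2 hc2 [d2 hd2 E2]] : exists2 c, between u (u + t) c &
    exists2 d, between v (v + t) d &
    f (u + t, v + t) - f (u + t, v) - (f (u, v + t) - f (u, v)) =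
    k (c, d) * t * t.
  have dF d : between v (v + t) d ->
      is_derive d 1 ((fun s => f (u + t, s)) - (fun s => f (u, s)))
        ('D_(ev R) f (u + t, d) - 'D_(ev R) f (u, d)).
    by move=> hd; apply: is_deriveB; apply: dv; exact: UU.
  have [d hd /= E] := @MVT_between R
    ((fun s => f (u + t, s)) - (fun s => f (u, s))) v (v + t)
    (fun c hc => @ex_derive _ _ _ _ _ _ _ (dF c hc)).
  have [c hc E'] := @MVT_eu R ('D_(ev R) f) u (u + t) d
    (fun c hc => @ex_derive _ _ _ _ _ _ _
      (Ck_derivable (Ck_derive f2 (axis_ev R)) (UU _ _ hc hd) (axis_eu R))).
  exists c; first exact: hc.
  exists d; first exact: hd.
  move: E; have [_ ->] := dF d hd; rewrite E' !fctE tu tv -/k => <-.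
  by ring.
have [_ G1 _] := rU _ (bt _ _ hc1 hd1); have [_ _ K2] := rU _ (bt _ _ hc2 hd2).
rewrite -[X in `|X|]/(g (u, v) - k (u, v)).
move: E1 E2 G1 K2; move: (g (c1, d1)) (k (c2, d2)) (g (u, v)) (k (u, v)).
move=> gc kc gp kp E1 E2 G1 K2.
have gk : gc = kc.
  have tn : t != 0 by rewrite gt_eqF.
  by apply: (mulIf tn); apply: (mulIf tn); rewrite -E1 -E2.
rewrite (_ : gp - kp = (gp - gc) - (kp - kc)); last by rewrite gk; ring.
apply: le_trans (ler_normB _ _) _; rewrite [leRHS](splitr e).
by apply: lerD; apply: ltW.
Qed.

(** The integral starts at the left end of the closed interval of half the radius, a compact set on
    which g is continuous and therefore integrable. *)
Lemma primitive (R : realType) (g : R -> R) (a r : R) : 0 < r ->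
  (forall s, `|s - a| < r -> {for s, continuous g}) ->
  exists G : R -> R, forall s, `|s - a| < r / 2 -> is_derive s 1 G (g s).
Proof.
move=> r0 cg; set r' := r / 2.
have ig : lebesgue_measure.-integrable `[a - r', a + r'] (EFin \o g).
  apply: continuous_compact_integrable; first exact: segment_compact.
  apply: continuous_in_subspaceT => s; rewrite inE /= in_itv /= => /andP[h1 h2].
  apply: cg; rewrite ltr_norml; apply/andP; split; move: h1 h2; rewrite /r'; lra.
exists (fun x => (\int[lebesgue_measure]_(t in `[a - r', x]) g t)%R) => s.
rewrite ltr_norml => /andP[h1 h2].
have sa : s < a + r' by lra.
have as' : a - r' < s by lra.
have cs : {for s, continuous g}.
  by apply: cg; rewrite ltr_norml; apply/andP; split; move: h1 h2; rewrite /r'; lra.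
have [dF F'] := continuous_FTC1_closed sa ig as' cs.
by split; [exact: dF|rewrite -derive1E].
Qed.

Lemma between_compact (R : realType) (a b : R) : compact (between a b).
Proof.
rewrite (_ : between a b = `[Num.min a b, Num.max a b]%classic).
  exact: segment_compact.
by apply/seteqP; split=> s; rewrite /between /= in_itv.
Qed.

(** The tube lemma: compactness of the segment gives one neighbourhood of u that works for every
    w. *)
Lemma between_uniform (R : realType) (f : R * R -> R) (u a b e : R) : 0 < e ->
  (forall w, between a b w -> {for (u, w), continuous f}) ->
  \forall s \near u, forall w, between a b w -> `|f (s, w) - f (u, w)| < e.
Proof.
move=> e0 cf.
have /compact_near_coveringP H := @between_compact R a b.
have := H R (nbhs u) (fun s w => `|f (s, w) - f (u, w)| < e) _.
apply => w /cf cfw.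
have e2 : 0 < e / 2 by rewrite divr_gt0.
have /nbhs_box[r r0 hr] : \forall z \near (u, w), `|f (u, w) - f z| < e / 2.
  exact: (cvgr_dist_lt _ _ cfw _ e2).
exists ([set w' | `|w' - w| < r], [set s | `|s - u| < r]) => /=.
  split; apply/nbhs_ballP; exists r => //= z; rewrite /ball /= distrC; exact.
move=> [w' s] /= [h1 h2].
rewrite (_ : f (s, w') - f (u, w') =
  (f (u, w) - f (u, w')) - (f (u, w) - f (s, w'))); last by ring.
apply: le_lt_trans (ler_normB _ _) _; rewrite [ltRHS](splitr e).
by apply: ltrD; apply: hr; split=> /=; rewrite ?subrr ?normr0.
Qed.

Lemma line_derivable_eu (R : realType) (f : R * R -> R) (s v d : R) :
  is_derive (s, v) (eu R) f d <-> is_derive s 1 (fun s => f (s, v)) d.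
Proof.
split=> -[df <-]; split.
- by rewrite -(line_derivable (g := fun s => f (s, v)) (line_eu f s v)).
- by rewrite -(line_derive (g := fun s => f (s, v)) (line_eu f s v)).
- by rewrite (line_derivable (g := fun s => f (s, v)) (line_eu f s v)).
- by rewrite (line_derive (g := fun s => f (s, v)) (line_eu f s v)).
Qed.

Lemma line_derivable_ev (R : realType) (f : R * R -> R) (s v d : R) :
  is_derive (s, v) (ev R) f d <-> is_derive v 1 (fun v => f (s, v)) d.
Proof.
split=> -[df <-]; split.
- by rewrite -(line_derivable (g := fun v => f (s, v)) (line_ev f s v)).
- by rewrite -(line_derive (g := fun v => f (s, v)) (line_ev f s v)).
- by rewrite (line_derivable (g := fun v => f (s, v)) (line_ev f s v)).
- by rewrite (line_derive (g := fun v => f (s, v)) (line_ev f s v)).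
Qed.

Lemma section_continuous_fst (R : realType) (f : R * R -> R) (s v : R) :
  {for (s, v), continuous f} -> {for s, continuous (fun s => f (s, v))}.
Proof.
move=> cf; apply: (cvg_comp (fun s => (s, v)) f _ cf).
exact: (cvg_pair (@cvg_id _ _) (@cvg_cst _ _ _ _ _)).
Qed.

Lemma section_continuous_snd (R : realType) (f : R * R -> R) (s v : R) :
  {for (s, v), continuous f} -> {for v, continuous (fun v => f (s, v))}.
Proof.
move=> cf; apply: (cvg_comp (fun v => (s, v)) f _ cf).
exact: (cvg_pair (@cvg_cst _ _ _ _ _) (@cvg_id _ _)).
Qed.

(** The potential integrates P along the horizontal line through p and then Q vertically. Its
    v-derivative is Q by construction; the u-derivative would call for differentiation under the
    integral sign, which a mean value argument in v replaces. *)
Lemma poincare (R : realType) (U : set (R * R)) (P Q : R * R -> R)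
    (p : R * R) : open U -> U p -> Ck 1 U P -> Ck 1 U Q ->
  (forall z, U z -> 'D_(ev R) P z = 'D_(eu R) Q z) ->
  exists r, [/\ 0 < r, box p r `<=` U & exists S : R * R -> R,
    forall z, box p r z ->
      is_derive z (eu R) S (P z) /\ is_derive z (ev R) S (Q z)].
Proof.
move=> oU Up P1 Q1 PQ.
have /nbhs_box[r r0 rU] : nbhs p U by exact: open_nbhs_nbhs.
have r20 : 0 < r / 2 by rewrite divr_gt0.
(* [primitive] halves the radius. *)
exists (r / 2); split => //.
  by apply: subset_trans rU; apply: box_subset; lra.
have [F0 dF0] : exists G : R -> R, forall s, `|s - p.1| < r / 2 ->
    is_derive s 1 G (P (s, p.2)).
  apply: (@primitive _ (fun s => P (s, p.2)) p.1 r r0) => s hs.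
  apply: section_continuous_fst.
  by apply: (Ck_continuous P1); apply: rU; split=> //=; rewrite subrr normr0.
have Gex u : exists g : R -> R, `|u - p.1| < r -> forall s,
    `|s - p.2| < r / 2 -> is_derive s 1 g (Q (u, s)).
  have [hu|nu] := pselect (`|u - p.1| < r); last by exists id.
  have [g gP] : exists G : R -> R, forall s, `|s - p.2| < r / 2 ->
      is_derive s 1 G (Q (u, s)).
    apply: (@primitive _ (fun s => Q (u, s)) p.2 r r0) => s hs.
    apply: section_continuous_snd.
    by apply: (Ck_continuous Q1); apply: rU; split.
  by exists g.
have {Gex} [G dG] := choice Gex.
(* The primitive [G u] is chosen separately for each u, hence is known only up to a constant
   depending on u; subtracting its value at [p.2] removes that constant. *)
pose S (z : R * R) := F0 z.1 + (G z.1 z.2 - G z.1 p.2).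
have Sv u v : `|u - p.1| < r -> `|v - p.2| < r / 2 ->
    is_derive v 1 (fun v => S (u, v)) (Q (u, v)).
  move=> hu hv; rewrite -[X in is_derive _ _ _ X]addr0 -[X in is_derive _ _ _ X]add0r.
  rewrite -{2}oppr0.
  have d1 := is_derive_cst (F0 u) v 1; have d2 := is_derive_cst (G u p.2) v 1.
  exact: is_deriveD d1 (is_deriveB (dG u hu v hv) d2).
exists S => -[u v] [/= hu hv]; split; last first.
  by apply/line_derivable_ev; apply: Sv => //; apply: lt_trans hu _; lra.
have bw w : between p.2 v w -> `|w - p.2| < r / 2.
  by move=> hw; apply: le_lt_trans hv; exact: between_norm.
have Uw s w : `|s - p.1| < r / 2 -> between p.2 v w -> U (s, w).
  move=> hs hw; apply: rU; split=> /=; first by apply: lt_trans hs _; lra.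
  by apply: lt_trans (bw _ hw) _; lra.
apply/line_derivable_eu.
have cF : h^-1 * (F0 (h + u) - F0 u) @[h --> 0^'] --> P (u, p.2).
  have [dF <-] := dF0 u hu.
  have -> : (fun h : R => h^-1 * (F0 (h + u) - F0 u)) =
    (fun h => h^-1 *: ((F0 \o shift u) (h *: 1) - F0 u)).
    by apply/funext => h /=; rewrite [h *: 1]mulr1.
  exact: dF.
(* On the horizontal line through p the derivative is P by the choice of [F0], so only the vertical
   part of S remains. *)
suff cE : (h^-1 * (S (h + u, v) - S (u, v)) - h^-1 * (F0 (h + u) - F0 u))
    @[h --> 0^'] --> P (u, v) - P (u, p.2).
  have cS : h^-1 * (S (h + u, v) - S (u, v)) @[h --> 0^'] --> P (u, v).
    rewrite -[X in _ --> X](subrK (P (u, p.2))).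
    have -> : (fun h : R => h^-1 * (S (h + u, v) - S (u, v))) =
      (fun h => (h^-1 * (S (h + u, v) - S (u, v)) - h^-1 * (F0 (h + u) - F0 u))
        + h^-1 * (F0 (h + u) - F0 u)).
      by apply/funext => h; rewrite subrK.
    exact: cvgD.
  have {}cS : h^-1 *: (((fun s => S (s, v)) \o shift u) (h *: 1) - S (u, v))
      @[h --> 0^'] --> P (u, v).
    have -> : (fun h => h^-1 *: (((fun s => S (s, v)) \o shift u) (h *: 1) - S (u, v)))
      = (fun h : R => h^-1 * (S (h + u, v) - S (u, v))).
      by apply/funext => h /=; rewrite [h *: 1]mulr1.
    exact: cS.
  by split; [exact: (cvgP (P (u, v)))|exact: cvg_lim].
apply/cvgrPdist_le => e e0.
have e' : 0 < e / (`|v - p.2| + 1) by rewrite divr_gt0 // ltr_wpDl.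
have unif := @between_uniform R ('D_(eu R) Q) u p.2 v _ e'
  (fun w hw => Ck_continuous (Ck_derive Q1 (axis_eu R)) (Uw u w hu hw)).
have [d d0 dU] : exists2 d, 0 < d & forall s, `|s - u| < d ->
    `|s - p.1| < r / 2 /\ forall w, between p.2 v w ->
    `|'D_(eu R) Q (s, w) - 'D_(eu R) Q (u, w)| < e / (`|v - p.2| + 1).
  have nu : \forall s \near u, `|s - p.1| < r / 2.
    apply/nbhs_ballP; exists (r / 2 - `|u - p.1|); first by rewrite /= subr_gt0.
    move=> s; rewrite /ball /= distrC => hs.
    rewrite (_ : s - p.1 = (s - u) + (u - p.1)); last by ring.
    by apply: le_lt_trans (ler_normD _ _) _; rewrite -ltrBrDr.
  have /nbhs_ballP[d /= d0 dd] : \forall s \near u, `|s - p.1| < r / 2 /\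
     forall w, between p.2 v w ->
    `|'D_(eu R) Q (s, w) - 'D_(eu R) Q (u, w)| < e / (`|v - p.2| + 1).
    by near=> s; split; near: s.
  by exists d => // s hs; apply: dd; rewrite /ball /= distrC.
have small : \forall h \near (0 : R)^', `|h| < d.
  by apply: cvg_within; apply/nbhs_ballP; exists d => //= h;
     rewrite /ball /= sub0r normrN.
near=> h.
have h0 : h != 0 by near: h; exact: nbhs_dnbhs_neq.
have hd : `|h| < d by near: h.
have hdu s : between u (h + u) s -> `|s - u| < d.
  by move=> /between_norm; rewrite addrK => /le_lt_trans; apply.
have [hup _] := dU (h + u) (etrans (congr1 (fun x => `|x| < d) (addrK u h)) hd).
(* By closedness the derivative of D in w is Q (h + u, w) - Q (u, w) - h Q_u (u, w), which is o(h)
   uniformly in w. *)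
pose D := (fun w => S (h + u, w)) - (fun w => S (u, w)) - (h \*: (fun w => P (u, w))).
have dD w : between p.2 v w ->
    is_derive w 1 D (Q (h + u, w) - Q (u, w) - h *: 'D_(ev R) P (u, w)).
  move=> hw; apply: is_deriveB; last first.
    apply: is_deriveZ; apply/line_derivable_ev.
    exact: Ck_derivable P1 (Uw _ _ hu hw) (axis_ev R).
  apply: is_deriveB; apply: Sv; rewrite ?bw //; last by apply: lt_trans hu _; lra.
  by apply: lt_trans hup _; lra.
have [w hw /= E] := @MVT_between R D p.2 v
    (fun w hw => @ex_derive _ _ _ _ _ _ _ (dD w hw)).
have [s hs E'] := @MVT_eu R Q u (h + u) w
  (fun s hs => @ex_derive _ _ _ _ _ _ _
     (Ck_derivable Q1 (Uw _ _ (dU _ (hdu _ hs)).1 hw) (axis_eu R))).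
have {}E : S (h + u, v) - S (u, v) - (F0 (h + u) - F0 u) =
   h * (P (u, v) - P (u, p.2)) +
   h * (('D_(eu R) Q (s, w) - 'D_(eu R) Q (u, w)) * (v - p.2)).
  move: E; have [_ ->] := dD w hw.
  rewrite E' PQ; last exact: Uw.
  rewrite /D !fctE /S /= => E.
  rewrite !subrr !addr0 in E.
  have sE (y : R) : h *: y = h * y by [].
  move: E; rewrite !sE.
  move: ('D_(eu R) Q (s, w)) ('D_(eu R) Q (u, w)) (P (u, v)) (P (u, p.2)).
  move: (F0 (h + u)) (F0 u) (G (h + u) v) (G (h + u) p.2) (G u v) (G u p.2).
  move=> f1 f0 g1 g2 g3 g4 q1 q0 p1 p0 E.
  apply/eqP; rewrite -subr_eq0; apply/eqP.
  by move/eqP: E; rewrite -subr_eq0 => /eqP <-; ring.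
rewrite -mulrBr E mulrDr !mulKf // opprD addNKr normrN normrM.
have [_ hq] := dU s (hdu _ hs).
apply: le_trans (ler_wpM2r (normr_ge0 _) (ltW (hq _ hw))) _.
rewrite mulrAC ler_pdivrMr ?ltr_wpDl // ler_wpM2l ?ltW //.
by rewrite ltrDl.
Unshelve. all: by end_near. Qed.

(** * The inverse function theorem *)

Definition dist (R : realType) (z w : R * R) : R :=
  Num.max `|z.1 - w.1| `|z.2 - w.2|.

Lemma dist_le (R : realType) (z w : R * R) (m : R) :
  (dist z w <= m) = (`|z.1 - w.1| <= m) && (`|z.2 - w.2| <= m).
Proof. by rewrite /dist ge_max. Qed.

Lemma dist_box (R : realType) (z p : R * R) (m : R) :
  box p m z <-> dist z p < m.
Proof.
rewrite /dist gt_max; split=> [[h1 h2]|/andP[]//].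
by rewrite h1 h2.
Qed.

Lemma dist_triangle (R : realType) (y z w : R * R) :
  dist z w <= dist z y + dist y w.
Proof.
rewrite dist_le; apply/andP; split.
  rewrite (_ : z.1 - w.1 = (z.1 - y.1) + (y.1 - w.1)); last by ring.
  by apply: le_trans (ler_normD _ _) _; apply: lerD; rewrite /dist le_max lexx.
rewrite (_ : z.2 - w.2 = (z.2 - y.2) + (y.2 - w.2)); last by ring.
by apply: le_trans (ler_normD _ _) _; apply: lerD; rewrite /dist le_max lexx orbT.
Qed.

Lemma dist_eq0 (R : realType) (z w : R * R) : dist z w <= 0 -> z = w.
Proof.
rewrite dist_le !normr_le0 !subr_eq0 => /andP[/eqP h1 /eqP h2].
by rewrite (surjective_pairing z) h1 h2 -surjective_pairing.
Qed.

Lemma dist_ge0 (R : realType) (z w : R * R) : 0 <= dist z w.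
Proof. by rewrite /dist le_max normr_ge0. Qed.

Lemma mean_value_box (R : realType) (f : R * R -> R) (p z w : R * R)
    (r m : R) :
  (forall q, box p r q -> [/\ derivable f q (eu R), derivable f q (ev R),
     `|'D_(eu R) f q| <= m & `|'D_(ev R) f q| <= m]) ->
  box p r z -> box p r w -> `|f z - f w| <= m * (`|z.1 - w.1| + `|z.2 - w.2|).
Proof.
move=> df [z1 z2] [w1 w2].
have [s hs|c hc ec] := @MVT_eu R f w.1 z.1 z.2.
  by have [] // := df (s, z.2) _; split=> //=; apply: between_dist hs _ _.
have [s hs|d hd ed] := @MVT_ev R f w.2 z.2 w.1.
  by have [] // := df (w.1, s) _; split=> //=; apply: between_dist hs _ _.
have [|_ _ mc _] := df (c, z.2); first by split=> //=; apply: between_dist hc _ _.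
have [|_ _ _ md] := df (w.1, d); first by split=> //=; apply: between_dist hd _ _.
rewrite (_ : f z - f w = (f (z.1, z.2) - f (w.1, z.2)) +
  (f (w.1, z.2) - f (w.1, w.2))); last by rewrite -!surjective_pairing; ring.
rewrite ec ed; apply: le_trans (ler_normD _ _) _; rewrite [leRHS]mulrDr !normrM.
by apply: lerD; apply: ler_wpM2r.
Qed.

(** The box is the union of the segments from p to its points. Connectedness is needed because the
    domain of a chart must be a [domain]. *)
Lemma box_connected (R : realType) (p : R * R) (r : R) : 0 < r ->
  connected (box p r).
Proof.
move=> r0.
pose seg (z : R * R) := (fun t : R => t *: (z - p) + p) @` `[0, 1]%classic.
have -> : box p r = \bigcup_(z in box p r) seg z.
  apply/seteqP; split=> [z bz|w [z [z1 z2]] [t]].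
    exists z => //; exists 1; first by rewrite /= in_itv /= ler01 lexx.
    by rewrite scale1r subrK.
  rewrite /= in_itv /= => /andP[t0 t1] <-.
  split; rewrite /= addrK [t *: _]/(t * _) normrM (ger0_norm t0).
    by apply: le_lt_trans z1; rewrite ler_piMl.
  by apply: le_lt_trans z2; rewrite ler_piMl.
apply: bigcup_connected.
  exists p => z _; exists 0; first by rewrite /= in_itv /= ler01 lexx.
  by rewrite scale0r add0r.
move=> z _; apply: connected_continuous_connected; first exact: segment_connected.
apply: continuous_subspaceT => t; apply: cvgD; last exact: cvg_cst.
by apply: cvgZ; [exact: cvg_id|exact: cvg_cst].
Qed.
Lemma closed_boxE (R : realType) (p z : R * R) (m : R) :
  (`[p.1 - m, p.1 + m]%classic `*` `[p.2 - m, p.2 + m]%classic) z <->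
  dist z p <= m.
Proof.
rewrite dist_le /= !in_itv /= !ler_norml.
split=> [[/andP[h1 h2] /andP[h3 h4]]|/andP[/andP[h1 h2] /andP[h3 h4]]].
  by rewrite -!andbA; apply/and4P; split; lra.
by split; apply/andP; split; lra.
Qed.

(* The map [z |-> z - L^-1 (psi z)], with [L] the Jacobian matrix of
   [psi = (S, T)] at [p], has zero derivative at [p], hence is a contraction
   near [p]; solving [psi z = y] amounts to finding a fixed point of one of its
   translates. *)
Lemma local_inverse (R : realType) (U : set (R * R)) (S T : R * R -> R)
    (p : R * R) : open U -> U p -> Ck 1 U S -> Ck 1 U T ->
  'D_(eu R) S p * 'D_(ev R) T p - 'D_(ev R) S p * 'D_(eu R) T p != 0 ->
  exists r s C : R, [/\ 0 < r, 0 < s, box p r `<=` U,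
    (forall y, box (S p, T p) s y ->
       exists2 z, box p r z & (S z, T z) = y) &
    (forall z w, box p r z -> box p r w ->
       dist z w <= C * dist (S z, T z) (S w, T w))].
Proof.
move=> oU Up S1 T1.
(* If each of the four partial derivatives of (k1, k2) is at most 1/4, the map contracts the maximum
   distance by 1/2, two increments being added in each component. *)
have e4 : (0 : R) < 4^-1 by rewrite invr_gt0.
set a := 'D_(eu R) S p; set b := 'D_(ev R) S p.
set c := 'D_(eu R) T p; set d := 'D_(ev R) T p.
set D := a * d - b * c => D0.
(* (L1, L2) is the inverse of the Jacobian matrix, by Cramer's rule. *)
pose L1 s t := (d * s - b * t) / D; pose L2 s t := (a * t - c * s) / D.
pose k1 z := z.1 - L1 (S z) (T z); pose k2 z := z.2 - L2 (S z) (T z).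
have fstD z : is_derive z (eu R) (@fst R R) 1 /\ is_derive z (ev R) (@fst R R) 0.
  case: z => u v; split.
    by apply/line_derivable_eu; exact: is_derive_id.
  by apply/line_derivable_ev; exact: is_derive_cst.
have sndD z : is_derive z (eu R) (@snd R R) 0 /\ is_derive z (ev R) (@snd R R) 1.
  case: z => u v; split.
    by apply/line_derivable_eu; exact: is_derive_cst.
  by apply/line_derivable_ev; exact: is_derive_id.
have dS z e : U z -> is_axis e -> is_derive z e S ('D_e S z).
  exact: Ck_derivable S1.
have dT z e : U z -> is_axis e -> is_derive z e T ('D_e T z).
  exact: Ck_derivable T1.
have dL al be z e x (f : R * R -> R) : U z -> is_axis e -> is_derive z e f x ->
    is_derive z e (fun z => f z - (al * S z + be * T z) / D)
      (x - (al * 'D_e S z + be * 'D_e T z) / D).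
  move=> Uz ae df.
  have h1 := is_deriveZ (D^-1 * al) (dS z e Uz ae).
  have h2 := is_deriveZ (D^-1 * be) (dT z e Uz ae).
  have h3 := is_deriveB df (is_deriveD h1 h2).
  have -> : (fun z => f z - (al * S z + be * T z) / D) =
      f - ((D^-1 * al) \*: S + (D^-1 * be) \*: T).
    apply/funext => w; rewrite !fctE /= ![_ *: _]/(_ * _).
    by congr (_ - _); rewrite mulrC mulrDr !mulrA.
  apply: is_derive_eq h3 _.
  by congr (_ - _); rewrite ![_ *: _]/(_ * _) mulrC mulrDr !mulrA.
have k1D z e x : U z -> is_axis e -> is_derive z e (@fst R R) x ->
    is_derive z e k1 (x - (d * 'D_e S z + (- b) * 'D_e T z) / D).
  move=> Uz ae dx; have := dL d (- b) z e x _ Uz ae dx.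
  by congr is_derive; apply/funext => w; rewrite /k1 /L1 mulNr.
have k2D z e x : U z -> is_axis e -> is_derive z e (@snd R R) x ->
    is_derive z e k2 (x - (- c * 'D_e S z + a * 'D_e T z) / D).
  move=> Uz ae dx; have := dL (- c) a z e x _ Uz ae dx.
  by congr is_derive; apply/funext => w; rewrite /k2 /L2 mulNr [- (c * _) + _]addrC.
have small al be e x : is_axis e -> x - (al * 'D_e S p + be * 'D_e T p) / D = 0 ->
    \forall z \near p, `|x - (al * 'D_e S z + be * 'D_e T z) / D| <= 4^-1.
  move=> ae e0.
  have cv : (x - (al * 'D_e S z + be * 'D_e T z) / D) @[z --> p] --> (0 : R).
    rewrite -[X in _ --> X]e0.
    apply: cvgB; first exact: cvg_cst.
    apply: cvgM; last exact: cvg_cst.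
    apply: cvgD; apply: cvgM; try exact: cvg_cst.
      exact: Ck_continuous (Ck_derive S1 ae) _ Up.
    exact: Ck_continuous (Ck_derive T1 ae) _ Up.
  have cv4 : \forall z \near p,
      `|0 - (x - (al * 'D_e S z + be * 'D_e T z) / D)| < 4^-1.
    exact: (cvgr_dist_lt _ _ cv _ e4).
  by apply: filterS cv4 => z; rewrite sub0r normrN => /ltW.
have s1 : \forall z \near p, `|1 - (d * 'D_(eu R) S z + - b * 'D_(eu R) T z) / D| <= 4^-1.
  by apply: small => //; rewrite -/a -/c /D; field.
have s2 : \forall z \near p, `|0 - (d * 'D_(ev R) S z + - b * 'D_(ev R) T z) / D| <= 4^-1.
  by apply: small => //; rewrite -/b -/d /D; field.
have s3 : \forall z \near p, `|0 - (- c * 'D_(eu R) S z + a * 'D_(eu R) T z) / D| <= 4^-1.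
  by apply: small => //; rewrite -/a -/c /D; field.
have s4 : \forall z \near p, `|1 - (- c * 'D_(ev R) S z + a * 'D_(ev R) T z) / D| <= 4^-1.
  by apply: small => //; rewrite -/b -/d /D; field.
have DE : D = a * d - b * c by [].
clearbody D; clearbody a b c d.
have nU : nbhs p U by exact: open_nbhs_nbhs.
have [r r0 hr] := (nbhs_box p _).1 (filterI nU (filterI (filterI s1 s2) (filterI s3 s4))).
have kdist z w : box p r z -> box p r w ->
    dist (k1 z, k2 z) (k1 w, k2 w) <= dist z w / 2.
  move=> bz bw; have zw : 4^-1 * (`|z.1 - w.1| + `|z.2 - w.2|) <= dist z w / 2.
    have [] := andP (etrans (esym (dist_le z w (dist z w))) (lexx _)); lra.
  rewrite dist_le /=; apply/andP; split; apply: le_trans zw;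
    apply: (mean_value_box (p := p) (r := r)) => // q /hr[Uq [[q1 q2] [q3 q4]]].
    have [du Eu] := k1D q _ _ Uq (axis_eu R) (fstD q).1.
    have [dv Ev] := k1D q _ _ Uq (axis_ev R) (fstD q).2.
    by split; [exact: du|exact: dv|rewrite Eu; exact: q1|rewrite Ev; exact: q2].
  have [du Eu] := k2D q _ _ Uq (axis_eu R) (sndD q).1.
  have [dv Ev] := k2D q _ _ Uq (axis_ev R) (sndD q).2.
  by split; [exact: du|exact: dv|rewrite Eu; exact: q3|rewrite Ev; exact: q4].
(* A crude Lipschitz constant of (L1, L2), common to both components. *)
pose C := (`|a| + `|b| + `|c| + `|d|) / `|D|.
have C0 : 0 <= C by rewrite divr_ge0 // !addr_ge0.
have DL (x y : R * R) : dist (L1 x.1 x.2, L2 x.1 x.2) (L1 y.1 y.2, L2 y.1 y.2)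
    <= C * dist x y.
  have [m1 m2] := andP (etrans (esym (dist_le x y (dist x y))) (lexx _)).
  have m0 := dist_ge0 x y.
  rewrite /C -mulrA [_^-1 * _]mulrC mulrA.
  rewrite dist_le /=; apply/andP; split.
    rewrite (_ : L1 x.1 x.2 - L1 y.1 y.2 =
      (d * (x.1 - y.1) - b * (x.2 - y.2)) / D); last by rewrite /L1; ring.
    rewrite normrM normfV ler_wpM2r ?invr_ge0 //.
    apply: le_trans (ler_normB _ _) _; rewrite !normrM !mulrDl.
    have h1 := ler_wpM2l (normr_ge0 d) m1.
    have h2 := ler_wpM2l (normr_ge0 b) m2.
    have := mulr_ge0 (normr_ge0 a) m0; have := mulr_ge0 (normr_ge0 c) m0; lra.
  rewrite (_ : L2 x.1 x.2 - L2 y.1 y.2 =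
      (a * (x.2 - y.2) - c * (x.1 - y.1)) / D); last by rewrite /L2; ring.
  rewrite normrM normfV ler_wpM2r ?invr_ge0 //.
  apply: le_trans (ler_normB _ _) _; rewrite !normrM !mulrDl.
  have h1 := ler_wpM2l (normr_ge0 a) m2.
  have h2 := ler_wpM2l (normr_ge0 c) m1.
  have := mulr_ge0 (normr_ge0 b) m0; have := mulr_ge0 (normr_ge0 d) m0; lra.
pose rho := r / 2; have rho0 : 0 < rho by rewrite divr_gt0.
have rhor : rho < r by rewrite /rho; lra.
(* F p - p is the image under (L1, L2) of y minus the value at p, so this radius keeps F p within
   rho / 2 of p; with the contraction, F then maps the closed box of radius rho into itself. The 1
   makes the divisor positive. *)
pose s := rho / 2 / (C + 1).
have s0 : 0 < s by rewrite !divr_gt0 // ltr_wpDl.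
exists rho, s, (2 * C); split => //.
- by move=> z /(box_subset (ltW rhor)) /hr[].
- move=> y /dist_box hy.
  pose F z := (k1 z + L1 y.1 y.2, k2 z + L2 y.1 y.2).
  have F0 z : z = F z -> (S z, T z) = y.
    move=> zF.
    have E1 : d * (S z - y.1) = b * (T z - y.2).
      have : L1 (S z) (T z) = L1 y.1 y.2.
        by have /= := congr1 fst zF; rewrite /k1; lra.
      by rewrite /L1 => /(mulIf (invr_neq0 D0)); lra.
    have E2 : a * (T z - y.2) = c * (S z - y.1).
      have : L2 (S z) (T z) = L2 y.1 y.2.
        by have /= := congr1 snd zF; rewrite /k2; lra.
      by rewrite /L2 => /(mulIf (invr_neq0 D0)); lra.
    have : D * (S z - y.1) = 0.
      rewrite DE mulrBl -mulrA E1 mulrCA E2; ring.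
    move/eqP; rewrite mulf_eq0 (negbTE D0) subr_eq0 => /eqP Sy.
    have : D * (T z - y.2) = 0.
      rewrite DE mulrBl [a * d]mulrC -mulrA E2 [b * c]mulrC -mulrA -E1; ring.
    move/eqP; rewrite mulf_eq0 (negbTE D0) subr_eq0 => /eqP Ty.
    by rewrite Sy Ty -surjective_pairing.
  have FF z w : dist (F z) (F w) = dist (k1 z, k2 z) (k1 w, k2 w).
    have e1 (t t' l : R) : t + l - (t' + l) = t - t' by ring.
    by rewrite /dist /F /= !e1.
  have Fp : dist (F p) p < rho / 2.
    have -> : dist (F p) p = dist (L1 y.1 y.2, L2 y.1 y.2)
       (L1 (S p) (T p), L2 (S p) (T p)).
      have e1 : (F p).1 - p.1 = L1 y.1 y.2 - L1 (S p) (T p).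
        by rewrite /F /= /k1; move: (L1 _ _) (L1 _ _) => *; ring.
      have e2 : (F p).2 - p.2 = L2 y.1 y.2 - L2 (S p) (T p).
        by rewrite /F /= /k2; move: (L2 _ _) (L2 _ _) => *; ring.
      by rewrite /dist e1 e2.
    apply: le_lt_trans (DL y (S p, T p)) _.
    apply: (@le_lt_trans _ _ ((C + 1) * dist y (S p, T p))).
      by rewrite ler_wpM2r ?dist_ge0 // lerDl.
    by rewrite mulrC -ltr_pdivlMr // ltr_wpDl.
  (* The fixed point is found by minimizing the distance from z to F z over this compact box,
     instead of iterating F. *)
  pose K : set (R * R) :=
    `[p.1 - rho, p.1 + rho]%classic `*` `[p.2 - rho, p.2 + rho]%classic.
  have KE z : K z <-> dist z p <= rho by exact: closed_boxE.
  have KU z : K z -> box p r z.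
    by move=> /KE zr; apply/dist_box; apply: le_lt_trans rhor.
  have pK : K p by apply/KE; rewrite dist_le !subrr normr0 ltW.
  have FK z : K z -> dist (F z) p < dist z p / 2 + rho / 2.
    move=> Kz; apply: le_lt_trans (dist_triangle (F p) _ _) _.
    apply: ler_ltD Fp; rewrite FF; apply: kdist; first exact: KU.
    exact: KU.
  have cm : {within K, continuous (fun z => dist z (F z))}.
    have cS z : K z -> {for z, continuous S}.
      by move=> /KU /hr[Uz _]; exact: Ck_continuous S1 _ Uz.
    have cT z : K z -> {for z, continuous T}.
      by move=> /KU /hr[Uz _]; exact: Ck_continuous T1 _ Uz.
    apply: continuous_in_subspaceT => z /set_mem Kz.
    have c1 : {for z, continuous k1}.
      apply: cvgB; first exact: cvg_fst.
      apply: cvgM; last exact: cvg_cst.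
      apply: cvgB; apply: cvgM; try exact: cvg_cst; [exact: cS|exact: cT].
    have c2 : {for z, continuous k2}.
      apply: cvgB; first exact: cvg_snd.
      apply: cvgM; last exact: cvg_cst.
      apply: cvgB; apply: cvgM; try exact: cvg_cst; [exact: cT|exact: cS].
    have m1 : {for z, continuous (fun z => `|z.1 - (F z).1|)}.
      apply: cvg_norm; apply: cvgB; first exact: cvg_fst.
      by apply: cvgD; [exact: c1|exact: cvg_cst].
    have m2 : {for z, continuous (fun z => `|z.2 - (F z).2|)}.
      apply: cvg_norm; apply: cvgB; first exact: cvg_snd.
      by apply: cvgD; [exact: c2|exact: cvg_cst].
    exact: (continuous_max m1 m2).
  have [z /set_mem Kz zmin] := compact_EVT_min (ex_intro _ p pK)
    (compact_setX (@segment_compact _ _ _) (@segment_compact _ _ _)) cm.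
  have zr : dist z p <= rho by apply/KE.
  have FzK : K (F z).
    apply/KE; apply: ltW; apply: lt_le_trans (FK z Kz) _.
    by move: zr; lra.
  (* At F z the displacement is at most half of that at z; since z is a minimizer, it must be
     zero. *)
  have := zmin _ (mem_set FzK); rewrite FF => zm.
  have := le_trans zm (kdist _ _ (KU _ Kz) (KU _ FzK)).
  have zz : z = F z by apply: dist_eq0; move: zm (kdist _ _ (KU _ Kz) (KU _ FzK)); lra.
  exists z; last exact: F0.
  apply/dist_box; have := FK z Kz; rewrite -zz; move: zr; lra.
(* z - w is the difference of the k-values plus the difference of the L-values. The former is at
   most half of the distance of z and w; absorbing it on the left turns C into 2 C. *)
- move=> z w /(box_subset (ltW rhor)) bz /(box_subset (ltW rhor)) bw.
  have := kdist z w bz bw.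
  have := DL (S z, T z) (S w, T w).
  have : dist z w <= dist (k1 z, k2 z) (k1 w, k2 w) +
     dist (L1 (S z) (T z), L2 (S z) (T z)) (L1 (S w) (T w), L2 (S w) (T w)).
    rewrite dist_le; apply/andP; split.
      rewrite (_ : z.1 - w.1 = (k1 z - k1 w) +
        (L1 (S z) (T z) - L1 (S w) (T w))); last by rewrite /k1; ring.
      by apply: le_trans (ler_normD _ _) _; apply: lerD; rewrite /dist le_max lexx.
    rewrite (_ : z.2 - w.2 = (k2 z - k2 w) +
      (L2 (S z) (T z) - L2 (S w) (T w))); last by rewrite /k2; ring.
    by apply: le_trans (ler_normD _ _) _; apply: lerD; rewrite /dist le_max lexx orbT.
  move=> /=; lra.
Qed.

Lemma open_pos (R : realType) (k : nat) (U : set (R * R)) (f : R * R -> R) :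
  open U -> Ck k U f -> open [set z | U z /\ 0 < f z].
Proof.
move=> oU fk; rewrite openE => z [Uz fz].
have n1 : nbhs z U by exact: open_nbhs_nbhs.
have n2 : \forall w \near z, 0 < f w.
  exact: cvgr_gt (Ck_continuous fk Uz) _ fz.
exact: filterI n1 n2.
Qed.

Lemma smooth_subset (R : realType) (U V : set (R * R)) (f : R * R -> R) :
  V `<=` U -> smooth U f -> smooth V f.
Proof. by move=> VU fs k; exact: Ck_subset (fs k). Qed.

Lemma smooth_derive (R : realType) (U : set (R * R)) (f : R * R -> R)
    (e : R * R) : smooth U f -> is_axis e -> smooth U ('D_e f).
Proof. by move=> fs ae k; exact: Ck_derive (fs k.+1) ae. Qed.

Lemma smooth_is_derive (R : realType) (U : set (R * R)) (f : R * R -> R)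
    (p e : R * R) : smooth U f -> U p -> is_axis e ->
  is_derive p e f ('D_e f p).
Proof. by move=> fs; exact: Ck_derivable (fs 1%N). Qed.

(** Caratheodory's forms of S and T along [phi] are a linear system for the increment of [phi]. Its
    determinant tends to D, so Cramer's rule expresses the quotients by convergent functions; mere
    continuity of [phi] starts the argument. *)
Lemma inverse_derive (R : realType) (S T : R * R -> R) (phi : R * R -> R * R)
    (U V : set (R * R)) (q : R * R) (e : R * R) :
  open U -> open V -> V q -> U (phi q) -> Ck 1 U S -> Ck 1 U T ->
  {for q, continuous phi} ->
  (forall y, V y -> (S (phi y), T (phi y)) = y) ->
  let Su := 'D_(eu R) S (phi q) in let Sv := 'D_(ev R) S (phi q) in
  let Tu := 'D_(eu R) T (phi q) in let Tv := 'D_(ev R) T (phi q) in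
  let D := Su * Tv - Sv * Tu in D != 0 ->
  is_derive q e (fun y => (phi y).1) ((Tv * e.1 - Sv * e.2) / D) /\
  is_derive q e (fun y => (phi y).2) ((Su * e.2 - Tu * e.1) / D).
Proof.
move=> oU oV Vq Uq S1 T1 cphi psiK Su Sv Tu Tv D D0.
have [A [B [cA cB AB]]] := C1_caratheodory oU Uq S1.
have [A' [B' [cA' cB' AB']]] := C1_caratheodory oU Uq T1.
rewrite -/Su in cA; rewrite -/Sv in cB; rewrite -/Tu in cA'; rewrite -/Tv in cB'.
rewrite /D in D0 *; clear D; clearbody Su Sv Tu Tv.
set D := Su * Tv - Sv * Tu in D0 *.
pose c h := phi (h *: e + q).
have cl : c h @[h --> 0^'] --> phi q by exact: shift_continuous.
have cl' (F : R * R -> R) (l : R) : F @ phi q --> l ->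
    F (c h) @[h --> 0^'] --> l.
  exact: (cvg_comp c F cl).
have cAc := cl' _ _ cA; have cBc := cl' _ _ cB.
have cAc' := cl' _ _ cA'; have cBc' := cl' _ _ cB'.
have cD : (A (c h) * B' (c h) - B (c h) * A' (c h)) @[h --> 0^'] --> D.
  by apply: cvgB; [exact: (cvgM cAc cBc')|exact: (cvgM cBc cAc')].
have nD : \forall h \near (0 : R)^', A (c h) * B' (c h) - B (c h) * A' (c h) != 0.
  exact: (cvgr_neq0 _ cD D0).
have nV : \forall h \near (0 : R)^', V (h *: e + q).
  have oVq : nbhs q V by exact: open_nbhs_nbhs.
  have csh : h *: e + q @[h --> (0 : R)^'] --> q.
    by apply: cvg_within_filter; exact: shift_cvg.
  exact: (csh _ oVq).
have nS := cl _ AB; have nT := cl _ AB'; rewrite /nbhs /= in nS nT.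
have eqs : \forall h \near (0 : R)^',
    [/\ h != 0, A (c h) * B' (c h) - B (c h) * A' (c h) != 0,
      h * e.1 = A (c h) * ((c h).1 - (phi q).1) + B (c h) * ((c h).2 - (phi q).2) &
      h * e.2 = A' (c h) * ((c h).1 - (phi q).1) + B' (c h) * ((c h).2 - (phi q).2)].
  near=> h; split.
  - by near: h; exact: nbhs_dnbhs_neq.
  - by near: h.
  - have <- : S (c h) - S (phi q) = A (c h) * ((c h).1 - (phi q).1) +
      B (c h) * ((c h).2 - (phi q).2) by near: h.
    have /(congr1 fst) /= -> : (S (c h), T (c h)) = h *: e + q.
      by apply: psiK; near: h.
    by have /(congr1 fst) /= -> := psiK q Vq; rewrite addrK.
  - have <- : T (c h) - T (phi q) = A' (c h) * ((c h).1 - (phi q).1) +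
      B' (c h) * ((c h).2 - (phi q).2) by near: h.
    have /(congr1 snd) /= -> : (S (c h), T (c h)) = h *: e + q.
      by apply: psiK; near: h.
    by have /(congr1 snd) /= -> := psiK q Vq; rewrite addrK.
split; apply/is_deriveE.
  have E : \forall h \near (0 : R)^', (B' (c h) * e.1 - B (c h) * e.2) /
      (A (c h) * B' (c h) - B (c h) * A' (c h)) =
      h^-1 * ((c h).1 - (phi q).1).
    apply: filterS eqs => h [h0 nz e1 e2].
    apply: (mulfI h0); rewrite mulVKf //.
    apply: (mulIf nz); rewrite mulrA mulfVK // mulrBr !(mulrCA h) e1 e2; ring.
  apply: cvg_trans (near_eq_cvg E) _.
  apply: cvgM; last exact: cvgV.
  by apply: cvgB; apply: cvgM => //; exact: cvg_cst.
have E : \forall h \near (0 : R)^', (A (c h) * e.2 - A' (c h) * e.1) /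
    (A (c h) * B' (c h) - B (c h) * A' (c h)) =
    h^-1 * ((c h).2 - (phi q).2).
  apply: filterS eqs => h [h0 nz e1 e2].
  apply: (mulfI h0); rewrite mulVKf //.
  apply: (mulIf nz); rewrite mulrA mulfVK // mulrBr !(mulrCA h) e1 e2; ring.
apply: cvg_trans (near_eq_cvg E) _.
apply: cvgM; last exact: cvgV.
by apply: cvgB; apply: cvgM => //; exact: cvg_cst.
Unshelve. all: by end_near. Qed.

Lemma lipschitz_continuous (R : realType) (phi : R * R -> R * R)
    (V : set (R * R)) (C : R) (q : R * R) : open V -> V q ->
  (forall y, V y -> dist (phi y) (phi q) <= C * dist y q) ->
  {for q, continuous phi}.
Proof.
move=> oV Vq lip A /nbhs_box[e e0 eA].
have C0 : 0 < `|C| + 1 by rewrite ltr_wpDl.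
have n1 : nbhs q V by exact: open_nbhs_nbhs.
have n2 : nbhs q (box q (e / (`|C| + 1))).
  by apply/nbhs_box; exists (e / (`|C| + 1)) => //; rewrite divr_gt0.
apply: filterS (filterI n1 n2) => y [Vy /dist_box].
rewrite ltr_pdivlMr // => dy; apply: eA; apply/dist_box.
apply: le_lt_trans (lip y Vy) _; apply: le_lt_trans dy; rewrite mulrC.
apply: ler_wpM2l; first exact: dist_ge0.
by apply: le_trans (ler_norm _) _; rewrite lerDl.
Qed.

(** The last clause is the form in which the chart is used: if dg = a dS + b dT at a point, then a
    and b are the partial derivatives of g in the new coordinates. *)
Lemma inverse_function (R : realType) (U : set (R * R)) (S T : R * R -> R)
    (p : R * R) : open U -> U p -> smooth U S -> smooth U T ->
  'D_(eu R) S p * 'D_(ev R) T p - 'D_(ev R) S p * 'D_(eu R) T p != 0 ->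
  exists (V : set (R * R)) (phi : R * R -> R * R),
    coordinates_around U p V phi /\
    forall (q : R * R) (g : R * R -> R) (a b : R), V q -> smooth U g ->
      'D_(eu R) g (phi q) =
        a * 'D_(eu R) S (phi q) + b * 'D_(eu R) T (phi q) ->
      'D_(ev R) g (phi q) =
        a * 'D_(ev R) S (phi q) + b * 'D_(ev R) T (phi q) ->
      is_derive q (eu R) (fun z => g (phi z)) a /\
      is_derive q (ev R) (fun z => g (phi z)) b.
Proof.
move=> oU Up Ss Ts.
pose D z := 'D_(eu R) S z * 'D_(ev R) T z + - 1 * ('D_(ev R) S z * 'D_(eu R) T z).
have DE z : 'D_(eu R) S z * 'D_(ev R) T z - 'D_(ev R) S z * 'D_(eu R) T z = D z.
  by rewrite /D mulN1r.
have Ds : smooth U D.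
  move=> k; apply: Ck_add => //.
    by apply: Ck_mul => //; exact: smooth_derive.
  by apply: Ck_mul => //; [exact: Ck_cst|apply: Ck_mul => //; exact: smooth_derive].
rewrite DE => Dp.
(* The square turns the condition D != 0 into positivity, to which [open_pos] applies. *)
pose U0 := [set z | U z /\ 0 < D z * D z].
have U0U : U0 `<=` U by move=> z [].
have oU0 : open U0 by apply: (@open_pos _ 0) => //; exact: Ck_mul.
have U0p : U0 p by split=> //; rewrite -expr2 exprn_even_gt0.
have D0 z : U0 z -> D z != 0 by move=> [_]; rewrite -expr2 exprn_even_gt0.
have S0 := smooth_subset U0U Ss; have T0 := smooth_subset U0U Ts.
have Dp' := D0 p U0p; rewrite -DE in Dp'.
have [r [s [C [r0 s0 rU surj lip]]]] := local_inverse oU0 U0p (S0 1%N) (T0 1%N) Dp'.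
pose psi z := (S z, T z); pose V := box (psi p) s.
have Hphi y : exists z, V y -> box p r z /\ psi z = y.
  have [/surj[z bz zy]|nV] := pselect (V y); first by exists z.
  by exists p.
have [phi phiP] := choice Hphi.
have phib y : V y -> box p r (phi y) by move=> /phiP[].
have phiK y : V y -> psi (phi y) = y by move=> /phiP[].
have phiU y : V y -> U0 (phi y) by move=> /phib /rU.
have psiK z : box p r z -> V (psi z) -> phi (psi z) = z.
  move=> bz Vz; apply: dist_eq0.
  apply: le_trans (lip _ _ (phib _ Vz) bz) _.
  by rewrite -!/(psi _) phiK // /dist !subrr normr0 maxxx mulr0.
have oV : open V by exact: box_open.
have Vpsi : V (psi p) by exact: box_center.
have cphi q : V q -> {for q, continuous phi}.
  move=> Vq; apply: (lipschitz_continuous (C := C) oV Vq) => y Vy.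
  by have := lip _ _ (phib y Vy) (phib q Vq); rewrite -!/(psi _) !phiK.
have dphi q e : V q ->
  is_derive q e (fun y => (phi y).1)
    (('D_(ev R) T (phi q) * e.1 - 'D_(ev R) S (phi q) * e.2) / D (phi q)) /\
  is_derive q e (fun y => (phi y).2)
    (('D_(eu R) S (phi q) * e.2 - 'D_(eu R) T (phi q) * e.1) / D (phi q)).
  move=> Vq; have := @inverse_derive _ S T phi U0 V q e oU0 oV Vq (phiU q Vq)
    (S0 1%N) (T0 1%N) (cphi q Vq) phiK.
  by cbv zeta; rewrite DE; apply; apply: D0; exact: phiU.
have sD e : is_axis e ->
    smooth U0 (fun z => ('D_(ev R) T z * e.1 + - 1 * ('D_(ev R) S z * e.2)) * (D z)^-1) /\
    smooth U0 (fun z => ('D_(eu R) S z * e.2 + - 1 * ('D_(eu R) T z * e.1)) * (D z)^-1).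
  move=> ae; have iD k : Ck k U0 (fun z => (D z)^-1).
    by apply: Ck_inv => //; exact: smooth_subset Ds k.
  have mc f (c : R) d k : smooth U0 f -> is_axis d -> Ck k U0 (fun z => 'D_d f z * c).
    by move=> fs ad; apply: Ck_mul => //; [exact: smooth_derive|exact: Ck_cst].
  by split=> k; apply: Ck_mul => //; apply: Ck_add => //; try exact: mc;
    apply: Ck_mul => //; try exact: mc; exact: Ck_cst.
have cphi1 q : V q -> {for q, continuous (fun y => (phi y).1)}.
  by move=> Vq; apply: (cvg_comp phi fst (cphi q Vq)); exact: cvg_fst.
have cphi2 q : V q -> {for q, continuous (fun y => (phi y).2)}.
  by move=> Vq; apply: (cvg_comp phi snd (cphi q Vq)); exact: cvg_snd.
(* Bootstrap: the derivatives of [phi] are smooth functions composed with [phi] itself, so order k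
   yields order k + 1. *)
have phis k : Ck k V (fun y => (phi y).1) /\ Ck k V (fun y => (phi y).2).
  elim: k => [|k [IH1 IH2]].
    by split; (split; last exact: I); [exact: cphi1|exact: cphi2].
  split; apply: (Ck_is_derive oV) => [q Vq|e ae].
  - exact: Ck_continuous IH1 _ Vq.
  - exists (fun q => ('D_(ev R) T (phi q) * e.1 +
        - 1 * ('D_(ev R) S (phi q) * e.2)) * (D (phi q))^-1).
      exact: (Ck_comp oU0 oV (sD e ae).1).
    by move=> q Vq; rewrite mulN1r; exact: (dphi q e Vq).1.
  - exact: Ck_continuous IH2 _ Vq.
  - exists (fun q => ('D_(eu R) S (phi q) * e.2 +
        - 1 * ('D_(eu R) T (phi q) * e.1)) * (D (phi q))^-1).
      exact: (Ck_comp oU0 oV (sD e ae).2).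
    by move=> q Vq; rewrite mulN1r; exact: (dphi q e Vq).2.
(* The image of the inverse map is a preimage under the continuous [psi], which makes it open. *)
have imE : phi @` V = [set z | box p r z /\ V (psi z)].
  apply/seteqP; split=> [_ [y Vy <-]|z [bz Vz]].
    by split; [exact: phib|rewrite phiK].
  by exists (psi z) => //; exact: psiK.
have imU : phi @` V `<=` U by move=> _ [y Vy <-]; apply: U0U; exact: phiU.
exists V, phi; split.
  split=> //.
  - by split=> //; [exact: box_connected|exists (psi p)].
  - split=> //.
    + rewrite imE openE => z [bz Vz].
      have n1 : nbhs z (box p r) by apply: open_nbhs_nbhs; split=> //; exact: box_open.
      have n2 : nbhs (psi z) V by exact: open_nbhs_nbhs.
      have cpsi : {for z, continuous psi}.
        apply: pair_continuous; [exact: Ck_continuous (S0 0%N) _ (rU _ bz)|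
          exact: Ck_continuous (T0 0%N) _ (rU _ bz)].
      exact: filterI n1 (cpsi _ n2).
    + split.
      * by move=> y Vy; exists y.
      * move=> y y' /set_mem Vy /set_mem Vy' yy.
        by rewrite -(phiK y Vy) -(phiK y' Vy') yy.
      * by move=> z [y Vy <-]; exists y.
    + by split=> k; [exact: (phis k).1|exact: (phis k).2].
    + by exists psi => //; split; apply: smooth_subset imU _.
  - by exists (psi p) => //; apply: psiK => //; exact: box_center.
move=> q g a b Vq gs gu gv.
have Dq := D0 _ (phiU q Vq).
have ch e := chain_rule oU (U0U _ (phiU q Vq)) (gs 1%N) (cphi q Vq)
  (dphi q e Vq).1 (dphi q e Vq).2.
have DD : D (phi q) = 'D_(eu R) S (phi q) * 'D_(ev R) T (phi q) -
   'D_(ev R) S (phi q) * 'D_(eu R) T (phi q) by rewrite DE.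
move: Dq DD gu gv (ch (eu R)) (ch (ev R)) => /=.
move: (D (phi q)) ('D_(eu R) S (phi q)) ('D_(ev R) S (phi q))
  ('D_(eu R) T (phi q)) ('D_(ev R) T (phi q)) => d su sv tu tv d0 dE -> ->.
move=> chu chv; split.
  by apply: is_derive_eq chu _; rewrite !mulr0 !mulr1 sub0r subr0; apply: (mulIf d0);
    rewrite mulrDl -!mulrA !mulVf // dE; ring.
by apply: is_derive_eq chv _; rewrite !mulr0 !mulr1 sub0r subr0; apply: (mulIf d0);
    rewrite mulrDl -!mulrA !mulVf // dE; ring.
Qed.

(** [Ck] includes continuity, which does not follow from mere existence of the partial derivatives;
    it comes from Caratheodory's form, as P and Q are continuous. *)
Lemma smooth_gradient (R : realType) (U : set (R * R)) (S P Q : R * R -> R) :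
  open U -> smooth U P -> smooth U Q ->
  (forall z, U z -> is_derive z (eu R) S (P z) /\ is_derive z (ev R) S (Q z)) ->
  smooth U S.
Proof.
move=> oU Ps Qs dS.
have cS z : U z -> {for z, continuous S}.
  move=> Uz.
  have nU : nbhs z U by exact: open_nbhs_nbhs.
  have [|||A [B [cA cB AB]]] := @caratheodory R S z.
  - by apply: filterS nU => w /dS[[h1 _] [h2 _]].
  - apply: (continuous_local oU Uz _ (Ck_continuous (Ps 0%N) Uz)).
    by move=> w /dS[[_ ->] _].
  - apply: (continuous_local oU Uz _ (Ck_continuous (Qs 0%N) Uz)).
    by move=> w /dS[_ [_ ->]].
  have c1 : (w.1 - z.1) @[w --> z] --> (0 : R).
    by rewrite -(subrr z.1); apply: cvgB; [exact: cvg_fst|exact: cvg_cst].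
  have c2 : (w.2 - z.2) @[w --> z] --> (0 : R).
    by rewrite -(subrr z.2); apply: cvgB; [exact: cvg_snd|exact: cvg_cst].
  have c3 : (A w * (w.1 - z.1) + B w * (w.2 - z.2) + S z) @[w --> z] -->
      'D_(eu R) S z * 0 + 'D_(ev R) S z * 0 + S z.
    by apply: cvgD; [exact: (cvgD (cvgM cA c1) (cvgM cB c2))|exact: cvg_cst].
  rewrite !mulr0 !add0r in c3.
  have E : \forall w \near z, A w * (w.1 - z.1) + B w * (w.2 - z.2) + S z = S w.
    by apply: filterS AB => w <-; rewrite subrK.
  exact: cvg_trans (near_eq_cvg E) c3.
case=> [|k]; first by split; [exact: cS|exact: I].
apply: (Ck_is_derive oU cS) => e [] ->.
  by exists P; [exact: Ps|move=> z /dS[]].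
by exists Q; [exact: Qs|move=> z /dS[]].
Qed.

Lemma coordinates_around_subset (R : realType) (U U' : set (R * R))
    (p : R * R) (V : set (R * R)) (phi : R * R -> R * R) :
  U' `<=` U -> coordinates_around U' p V phi -> coordinates_around U p V phi.
Proof. by move=> UU [? ? im ?]; split=> //; exact: subset_trans UU. Qed.

(** Two closed forms, independent at p, become the differentials of the new coordinates. The
    coefficients of dg in this coframe are then the new partial derivatives of g, and the potentials
    themselves drop out of sight. *)
Lemma coframe_chart (R : realType) (U : set (R * R))
    (P1 Q1 P2 Q2 : R * R -> R) (p : R * R) :
  open U -> U p -> smooth U P1 -> smooth U Q1 -> smooth U P2 -> smooth U Q2 ->
  (forall z, U z -> 'D_(ev R) P1 z = 'D_(eu R) Q1 z) ->
  (forall z, U z -> 'D_(ev R) P2 z = 'D_(eu R) Q2 z) ->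
  P1 p * Q2 p - Q1 p * P2 p != 0 ->
  exists (V : set (R * R)) (phi : R * R -> R * R),
    coordinates_around U p V phi /\
    forall (q : R * R) (g : R * R -> R) (a b : R), V q -> smooth U g ->
      'D_(eu R) g (phi q) = a * P1 (phi q) + b * P2 (phi q) ->
      'D_(ev R) g (phi q) = a * Q1 (phi q) + b * Q2 (phi q) ->
      is_derive q (eu R) (fun z => g (phi z)) a /\
      is_derive q (ev R) (fun z => g (phi z)) b.
Proof.
move=> oU Up P1s Q1s P2s Q2s c1 c2 D0.
have [r1 [r10 r1U [S dS]]] := poincare oU Up (P1s 1%N) (Q1s 1%N) c1.
have [r2 [r20 r2U [T dT]]] := poincare oU Up (P2s 1%N) (Q2s 1%N) c2.
pose r := Num.min r1 r2.
have r0 : 0 < r by rewrite lt_min r10.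
have rr1 : box p r `<=` box p r1 by apply: box_subset; rewrite ge_min lexx.
have rr2 : box p r `<=` box p r2 by apply: box_subset; rewrite ge_min lexx orbT.
have rU : box p r `<=` U by exact: subset_trans r1U.
have bp : box p r p by exact: box_center.
have ob := @box_open R p r.
have Ss : smooth (box p r) S.
  apply: (smooth_gradient ob (smooth_subset rU P1s) (smooth_subset rU Q1s)).
  by move=> z /rr1 /dS.
have Ts : smooth (box p r) T.
  apply: (smooth_gradient ob (smooth_subset rU P2s) (smooth_subset rU Q2s)).
  by move=> z /rr2 /dT.
have Su z : box p r z -> 'D_(eu R) S z = P1 z by move=> /rr1 /dS[[]].
have Sv z : box p r z -> 'D_(ev R) S z = Q1 z by move=> /rr1 /dS[_ []].
have Tu z : box p r z -> 'D_(eu R) T z = P2 z by move=> /rr2 /dT[[]].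
have Tv z : box p r z -> 'D_(ev R) T z = Q2 z by move=> /rr2 /dT[_ []].
have [|V [phi [cV dV]]] := inverse_function ob bp Ss Ts.
  by rewrite Su // Sv // Tu // Tv.
exists V, phi; split; first exact: coordinates_around_subset rU cV.
move=> q g a b Vq gs gu gv.
have bq : box p r (phi q) by case: cV => _ _ + _; apply; exists q.
apply: dV => //; first exact: smooth_subset rU gs.
  by rewrite Su // Tu.
by rewrite Sv // Tv.
Qed.

(** * Bilinearity and nondegeneracy of the Lorentz product *)

Section LorentzProduct.
Context {A : comNzRingType} {n : nat}.
Implicit Types a b c : 'rV[A]_n.

Lemma lprodC a b : lprod a b = lprod b a.
Proof. by apply: eq_bigr => i _; rewrite mulrC. Qed.

Lemma lprodDl a b c : lprod (a + b) c = lprod a c + lprod b c.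
Proof.
rewrite /lprod -big_split; apply: eq_bigr => i _; rewrite /= mxE mulrDl.
by case: ifP => // _; rewrite opprD.
Qed.

Lemma lprodZl k a b : lprod (k *: a) b = k * lprod a b.
Proof.
rewrite /lprod big_distrr; apply: eq_bigr => i _; rewrite /= mxE -mulrA.
by case: ifP => // _; rewrite mulrN.
Qed.

Lemma lprodDr a b c : lprod a (b + c) = lprod a b + lprod a c.
Proof. by rewrite !(lprodC a) lprodDl. Qed.

Lemma lprodZr k a b : lprod a (k *: b) = k * lprod a b.
Proof. by rewrite !(lprodC a) lprodZl. Qed.

Lemma lprodNl a b : lprod (- a) b = - lprod a b.
Proof. by rewrite -scaleN1r lprodZl mulN1r. Qed.

Lemma lprodNr a b : lprod a (- b) = - lprod a b.
Proof. by rewrite !(lprodC a) lprodNl. Qed.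

Lemma lprod0l a : lprod 0 a = 0.
Proof. by rewrite -(scale0r a) lprodZl mul0r. Qed.

Lemma lprod0r a : lprod a 0 = 0.
Proof. by rewrite lprodC lprod0l. Qed.

Lemma lprodBl a b c : lprod (a - b) c = lprod a c - lprod b c.
Proof. by rewrite lprodDl lprodNl. Qed.

Lemma lprodBr a b c : lprod a (b - c) = lprod a b - lprod a c.
Proof. by rewrite lprodDr lprodNr. Qed.

Lemma lprod_sumr a m (F : 'I_m -> 'rV[A]_n) :
  lprod a (\sum_i F i) = \sum_i lprod a (F i).
Proof.
elim: m F => [|m IH] F; first by rewrite !big_ord0 lprod0r.
by rewrite !big_ord_recr lprodDr IH.
Qed.

Lemma lprod_delta a i :
  lprod a (delta_mx 0 i) = if i == 0%N :> nat then - a 0 i else a 0 i.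
Proof.
rewrite /lprod (bigD1 i) //= big1 => [|j ji].
  by rewrite addr0 mxE !eqxx mulr1.
by rewrite mxE eqxx (negbTE ji) mulr0 oppr0 if_same.
Qed.

Lemma lprod_nondegenerate a :
  (forall i, lprod a (delta_mx 0 i) = 0) -> a = 0.
Proof.
move=> a0; apply/rowP => i; rewrite mxE; have := a0 i; rewrite lprod_delta.
by case: ifP => // _ /eqP; rewrite oppr_eq0 => /eqP.
Qed.

End LorentzProduct.

Definition lprodE := (@lprodDl, @lprodDr, @lprodBl, @lprodBr, @lprodZl,
  @lprodZr, @lprodNl, @lprodNr, @lprod0l, @lprod0r).

(** * Calculus of vector-valued maps, by components *)

Section VectorCalculus.
Context {R : realType} {n : nat}.
Implicit Types (y w : R * R -> 'rV[R]_n) (f : R * R -> R) (z e : R * R).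

Definition is_vderive z e y (d : 'rV[R]_n) : Prop :=
  forall i, is_derive z e (fun q => y q 0 i) (d 0 i).

Lemma partial_val z e y d : is_vderive z e y d -> partial e y z = d.
Proof. by move=> dy; apply/rowP => i; rewrite mxE; have [_ ->] := dy i. Qed.

Lemma smooth_is_vderive (U : set (R * R)) z e y : smooth_vec U y -> U z ->
  is_axis e -> is_vderive z e y (partial e y z).
Proof.
by move=> ys Uz ae i; rewrite mxE; exact: smooth_is_derive (ys i) Uz ae.
Qed.

Lemma is_vderive_unique z e y d d' : is_vderive z e y d ->
  is_vderive z e y d' -> d = d'.
Proof. by move=> /partial_val <- /partial_val <-. Qed.

Lemma is_vderive_local (U : set (R * R)) z e y w d : open U -> U z ->
  (forall q, U q -> y q = w q) -> is_vderive z e y d -> is_vderive z e w d.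
Proof.
by move=> oU Uz yw dy i; apply: is_derive_local oU Uz _ (dy i) => q /yw ->.
Qed.

Lemma is_vderiveD z e y w dy dw : is_vderive z e y dy -> is_vderive z e w dw ->
  is_vderive z e (fun q => y q + w q) (dy + dw).
Proof.
move=> hy hw i; rewrite mxE.
have -> : (fun q => (y q + w q) 0 i) =
    (fun q => y q 0 i) + (fun q => w q 0 i) by apply/funext => q; rewrite mxE.
exact: is_deriveD (hy i) (hw i).
Qed.

Lemma is_vderiveZ z e f y df dy : is_derive z e f df -> is_vderive z e y dy ->
  is_vderive z e (fun q => f q *: y q) (df *: y z + f z *: dy).
Proof.
move=> hf hy i.
have -> : (fun q => (f q *: y q) 0 i) = f * (fun q => y q 0 i).
  by apply/funext => q; rewrite mxE.
apply: is_derive_eq (is_deriveM hf (hy i)) _.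
by rewrite !mxE addrC [y z 0 i *: _]mulrC.
Qed.

Lemma is_vderive_scale z e y (c : R) dy : is_vderive z e y dy ->
  is_vderive z e (fun q => c *: y q) (c *: dy).
Proof.
move=> hy; have := is_vderiveZ (is_derive_cst c z e) hy.
by rewrite scale0r add0r.
Qed.

Lemma is_derive_lprod z e y w dy dw : is_vderive z e y dy ->
  is_vderive z e w dw ->
  is_derive z e (fun q => lprod (y q) (w q)) (lprod dy (w z) + lprod (y z) dw).
Proof.
move=> hy hw.
have -> : (fun q => lprod (y q) (w q)) = \sum_(i < n)
    (fun q => if i == 0%N :> nat then - (y q 0 i * w q 0 i)
              else y q 0 i * w q 0 i).
  by apply/funext => q; rewrite fct_sumE.
rewrite /lprod -big_split; apply: is_derive_sum => i.
have h := is_deriveM (hy i) (hw i).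
case: ifP => _.
  by apply: is_derive_eq (is_deriveN h) _; rewrite [_ *: _]/(_ * _) addrC
    [w z 0 i *: _]mulrC opprD.
by apply: is_derive_eq h _; rewrite addrC [w z 0 i *: _]mulrC.
Qed.

Lemma smooth_vec_partial (U : set (R * R)) y e : smooth_vec U y -> is_axis e ->
  smooth_vec U (partial e y).
Proof.
move=> ys ae i; have -> : (fun p => partial e y p 0 i) = 'D_e (fun q => y q 0 i).
  by apply/funext => q; rewrite mxE.
exact: smooth_derive (ys i) ae.
Qed.

Lemma smooth_vec_subset (U V : set (R * R)) y :
  V `<=` U -> smooth_vec U y -> smooth_vec V y.
Proof. by move=> VU ys i; exact: smooth_subset VU (ys i). Qed.

Lemma smooth_add (U : set (R * R)) f g : open U -> smooth U f -> smooth U g ->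
  smooth U (fun q => f q + g q).
Proof. by move=> oU fs gs k; exact: Ck_add. Qed.

Lemma smooth_mul (U : set (R * R)) f g : open U -> smooth U f -> smooth U g ->
  smooth U (fun q => f q * g q).
Proof. by move=> oU fs gs k; exact: Ck_mul. Qed.

Lemma smooth_cst (U : set (R * R)) (c : R) : open U -> smooth U (fun=> c).
Proof. by move=> oU k; exact: Ck_cst. Qed.

Lemma smooth_opp (U : set (R * R)) f : open U -> smooth U f ->
  smooth U (fun q => - f q).
Proof.
move=> oU fs; have -> : (fun q => - f q) = fun q => (- 1) * f q.
  by apply/funext => q; rewrite mulN1r.
by apply: smooth_mul => //; exact: smooth_cst.
Qed.

Lemma smooth_inv (U : set (R * R)) f : open U -> smooth U f ->
  (forall q, U q -> f q != 0) -> smooth U (fun q => (f q)^-1).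
Proof. by move=> oU fs f0 k; exact: Ck_inv. Qed.

Lemma smooth_sqrt (U : set (R * R)) f : open U -> smooth U f ->
  (forall q, U q -> 0 < f q) -> smooth U (fun q => Num.sqrt (f q)).
Proof. by move=> oU fs f0 k; exact: Ck_sqrt. Qed.

Lemma smooth_vec_add (U : set (R * R)) y w : open U -> smooth_vec U y ->
  smooth_vec U w -> smooth_vec U (fun q => y q + w q).
Proof.
move=> oU ys ws i.
have -> : (fun p => (y p + w p) 0 i) = fun q => y q 0 i + w q 0 i.
  by apply/funext => q; rewrite mxE.
exact: smooth_add (ys i) (ws i).
Qed.

Lemma smooth_vec_scale (U : set (R * R)) f y : open U -> smooth U f ->
  smooth_vec U y -> smooth_vec U (fun q => f q *: y q).
Proof.
move=> oU fs ys i.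
have -> : (fun p => (f p *: y p) 0 i) = fun q => f q * y q 0 i.
  by apply/funext => q; rewrite mxE.
exact: smooth_mul (ys i).
Qed.

Lemma smooth_lprod (U : set (R * R)) y w : open U -> smooth_vec U y ->
  smooth_vec U w -> smooth U (fun q => lprod (y q) (w q)).
Proof.
move=> oU ys ws.
pose F (i : 'I_n) q := if i == 0%N :> nat then - (y q 0 i * w q 0 i)
  else y q 0 i * w q 0 i.
have Fs i : smooth U (F i).
  have ms := smooth_mul oU (ys i) (ws i).
  by rewrite /F; case: (nat_of_ord i == 0%N) => //; exact: smooth_opp.
suff H : forall s : seq 'I_n, smooth U (fun q => \sum_(i <- s) F i q).
  exact: H.
elim=> [|i s IH].
  have -> : (fun q => \sum_(i <- [::] : seq 'I_n) F i q) = fun=> 0.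
    by apply/funext => q; rewrite big_nil.
  exact: smooth_cst.
have -> : (fun q => \sum_(j <- i :: s) F j q) =
    fun q => F i q + \sum_(j <- s) F j q.
  by apply/funext => q; rewrite big_cons.
exact: smooth_add (Fs i) IH.
Qed.

Lemma schwarz_vec (U : set (R * R)) y z : open U -> U z -> smooth_vec U y ->
  partial (ev R) (partial (eu R) y) z = partial (eu R) (partial (ev R) y) z.
Proof.
move=> oU Uz ys;
apply/rowP => i.
have E e e' : partial e (partial e' y) z 0 i = 'D_e ('D_e' (fun q => y q 0 i)) z.
  rewrite mxE; congr ('D_e _ z); apply/funext => q.
  by rewrite mxE.
apply: etrans (E (ev R) (eu R)) _; apply: etrans (esym (E (eu R) (ev R))).
exact: (schwarz oU Uz (ys i 2%N)).
Qed.

End VectorCalculus.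

(** * Orthogonal projections *)

Section Projections.
Context {R : realType} {n : nat}.
Implicit Types X Y a w : 'rV[R]_n.

Definition perp2 X Y : set 'rV[R]_n :=
  [set w | lprod w X = 0 /\ lprod w Y = 0].

Lemma normal_spaceE (x : R * R -> 'rV[R]_n) (p : R * R) :
  Defs.normal_space x p = perp2 (partial (eu R) x p) (partial (ev R) x p).
Proof.
apply/seteqP; split=> w.
  move=> h; split; apply: h.
    by exists (1, 0) => //; rewrite /Defs.pushforward /= scale1r scale0r addr0.
  by exists (0, 1) => //; rewrite /Defs.pushforward /= scale1r scale0r add0r.
rewrite /perp2 /Defs.normal_space /tangent_space /= /Defs.pushforward.
move: (partial (eu R) x p) (partial (ev R) x p) => xu xv.
by move=> [h1 h2] _ [Z _ <-]; rewrite !lprodE h1 h2 !mulr0 addr0.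
Qed.

(** The coefficients solve the normal equations by Cramer's rule; the determinant is that of the
    Gram matrix. *)
Lemma perp2_decomposition X Y a :
  lprod X X * lprod Y Y - lprod X Y * lprod X Y != 0 ->
  exists c d, perp2 X Y (a - (c *: X + d *: Y)).
Proof.
set D := _ - _ => D0.
exists ((lprod Y Y * lprod a X - lprod X Y * lprod a Y) / D),
  ((lprod X X * lprod a Y - lprod X Y * lprod a X) / D).
by split; rewrite !lprodE ?(lprodC Y X); move: D0; rewrite /D;
  move: (lprod X X) (lprod Y Y) (lprod X Y) (lprod a X) (lprod a Y) => *; field.
Qed.

(** [oproj] picks some vector by [xget], so its value is determined only once uniqueness is known;
    the last premise is uniqueness, phrased for differences. *)
Lemma oproj_eq (A : comNzRingType) (S : set 'rV[A]_n) (a w : 'rV[A]_n) :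
  S w -> (forall z, S z -> lprod (a - w) z = 0) ->
  (forall v, S v -> (forall z, S z -> lprod (v - w) z = 0) -> v - w = 0) ->
  oproj S a = w.
Proof.
move=> Sw aw uw; apply: xget_unique; first by split.
move=> v [Sv av]; apply/eqP; rewrite -subr_eq0; apply/eqP; apply: uw => // z Sz.
rewrite (_ : v - w = (a - w) - (a - v)).
  by rewrite lprodBl aw // av // subrr.
by rewrite opprB [RHS]addrC addrA subrK.
Qed.

(** For uniqueness, each basis vector splits into a part in [perp2 X Y] and a part in the span of X
    and Y. A difference of two candidates is orthogonal to both parts, hence zero. *)
Lemma oproj_perp2 X Y a c d :
  lprod X X * lprod Y Y - lprod X Y * lprod X Y != 0 ->
  perp2 X Y (a - (c *: X + d *: Y)) ->
  oproj (perp2 X Y) a = a - (c *: X + d *: Y).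
Proof.
move=> D0 Sw; apply: oproj_eq => // [z [zX zY]|w' [wX wY] wz].
  by rewrite subKr !lprodE !(lprodC _ z) zX zY !mulr0 addr0.
case: Sw => aX aY.
apply: lprod_nondegenerate => i.
have [c' [d' Pd]] := @perp2_decomposition X Y (delta_mx 0 i) D0.
have := wz _ Pd; rewrite lprodBr => /eqP; rewrite subr_eq0 => /eqP ->.
by rewrite lprodDr !lprodZr !(lprodBl w') wX wY aX aY !subr0 !mulr0 addr0.
Qed.

Lemma lprod_dvec a w : lprod (dvec a) (dvec w) = dreal (lprod a w).
Proof.
have drD (s t : R) : dreal (s + t) = dreal s + dreal t.
  by congr DNum; rewrite /= addr0.
have drS m (F : 'I_m -> R) : dreal (\sum_i F i) = \sum_i dreal (F i).
  elim: m F => [|m IH] F; first by rewrite !big_ord0.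
  by rewrite !big_ord_recr /= drD IH.
rewrite /lprod drS; apply: eq_bigr => i _; rewrite !mxE.
case: ifP => _; congr DNum => /=; ring.
Qed.

Lemma dvecD a w : dvec (a + w) = dvec a + dvec w.
Proof. by apply/rowP => i; rewrite !mxE; congr DNum; rewrite /= addr0. Qed.

Lemma dvecZ k a : dvec (k *: a) = dreal k *: dvec a.
Proof. by apply/rowP => i; rewrite !mxE; congr DNum => /=; ring. Qed.

Lemma dspan_orth (S : set 'rV[R]_n) (y z : 'rV[dnum R]_n) :
  dspan S z -> (forall s, S s -> lprod y (dvec s) = 0) -> lprod y z = 0.
Proof.
move=> [m [c [w [Sw ->]]]] h; rewrite lprod_sumr big1 // => i _.
by rewrite lprodZr h // mulr0.
Qed.

Lemma dspan_mem (S : set 'rV[R]_n) s : S s -> dspan S (dvec s).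
Proof.
move=> Ss; exists 1%N, (fun=> 1), (fun=> s); split=> //.
by rewrite big_ord1 scale1r.
Qed.

Lemma dspan_comb (S : set 'rV[R]_n) (c d : dnum R) s t : S s -> S t ->
  dspan S (c *: dvec s + d *: dvec t).
Proof.
move=> Ss St; exists 2%N, (fun i => if i == ord0 then c else d),
  (fun i => if i == ord0 then s else t); split=> [i|]; first by case: ifP.
by rewrite big_ord_recl big_ord1.
Qed.

(** The standard basis of the double module consists of real vectors, so the real decomposition
    still gives uniqueness, and orthogonality has to be tested on real normal vectors only. *)
Lemma oproj_dspan X Y (z w : 'rV[dnum R]_n) :
  lprod X X * lprod Y Y - lprod X Y * lprod X Y != 0 ->
  dspan (perp2 X Y) w ->
  (forall s, perp2 X Y s -> lprod (z - w) (dvec s) = 0) ->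
  oproj (dspan (perp2 X Y)) z = w.
Proof.
move=> D0 Sw zw; apply: oproj_eq => // [s Ss|w' Sw' h].
  exact: dspan_orth Ss _.
have orth t : dspan (perp2 X Y) t -> lprod t (dvec X) = 0 /\ lprod t (dvec Y) = 0.
  move=> St; rewrite !(lprodC t); split; apply: (dspan_orth St) => s [sX sY];
    by rewrite lprodC lprod_dvec ?sX ?sY.
have [wX wY] := orth w Sw; have [wX' wY'] := orth w' Sw'.
apply: lprod_nondegenerate => i.
have -> : delta_mx 0 i = dvec (delta_mx 0 i) :> 'rV[dnum R]_n.
  by apply/rowP => j; rewrite !mxE; case: (_ && _).
have [c' [d' Pd]] := @perp2_decomposition X Y (delta_mx 0 i) D0.
rewrite -[delta_mx 0 i](subrK (c' *: X + d' *: Y)) dvecD lprodDr.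
rewrite h; last exact: dspan_mem.
by rewrite dvecD !dvecZ !(lprodDr, lprodZr) !lprodBl wX wY wX' wY' !subrr !mulr0 !addr0.
Qed.

Lemma lprod_split (m : nat) (a b : 'rV[R]_m.+1) :
  lprod a b = - (a 0 0 * b 0 0) + \sum_(i < m) a 0 (lift ord0 i) * b 0 (lift ord0 i).
Proof. by rewrite /lprod big_ord_recl. Qed.

(** Let t, s be the time components of T, w. The spatial part of t w - s T has nonnegative square,
    orthogonality makes the spatial product equal to s t, and the spatial square of T is below t^2;
    together these give t^2 (w . w) >= 0 with t != 0. *)
Lemma orth_timelike_ge0 T w : lprod T T < 0 -> lprod w T = 0 -> 0 <= lprod w w.
Proof.
case: n T w => [|m] T w; first by rewrite /lprod big_ord0 ltxx.
rewrite !lprod_split; set t := T 0 0; set s := w 0 0.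
set TT := \sum_(i < m) _ * _ => hT; set wT := \sum_(i < m) _ => hwT.
set ww := \sum_(i < m) _.
have sq : 0 <= t * t * ww - 2 * t * s * wT + s * s * TT.
  have -> : t * t * ww - 2 * t * s * wT + s * s * TT = \sum_(i < m)
      (t * w 0 (lift ord0 i) - s * T 0 (lift ord0 i)) ^+ 2.
    rewrite /ww /wT /TT !big_distrr -sumrB -big_split /=.
    by apply: eq_bigr => i _; ring.
  by apply: sumr_ge0 => i _; exact: sqr_ge0.
have wTE : wT = s * t by lra.
have t0 : 0 < t * t.
  have TT0 : 0 <= TT by apply: sumr_ge0 => i _; rewrite -expr2 sqr_ge0.
  lra.
rewrite -(pmulr_rge0 _ t0).
have s0 : 0 <= s * s by rewrite -expr2 sqr_ge0.
have : s * s * TT <= s * s * (t * t) by rewrite ler_wpM2l //; lra.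
by move: sq; rewrite wTE; lra.
Qed.

End Projections.

(** * The induced metric and the second fundamental form in arbitrary coordinates *)

Section Minimal.
Context {R : realType} {n : nat}.

(** If F^2 - E G <= 0, completing the square shows that E times any value of the form is
    nonnegative. As both signs occur among the values, E = 0; likewise G = 0, then F = 0, and the
    form vanishes. *)
Lemma indefinite_disc (E F G a b c d : R) :
  a * a * E + 2 * a * b * F + b * b * G < 0 ->
  0 < c * c * E + 2 * c * d * F + d * d * G -> 0 < F * F - E * G.
Proof.
move=> h1 h2; rewrite ltNge; apply/negP => D.
have sq (x : R) : 0 <= x * x by rewrite -expr2 sqr_ge0.
have main (e g x y : R) : F * F - e * g <= 0 ->
    0 <= e * (x * x * e + 2 * x * y * F + y * y * g).
  move=> De.
  have -> : e * (x * x * e + 2 * x * y * F + y * y * g) =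
     (e * x + F * y) * (e * x + F * y) - (F * F - e * g) * (y * y) by ring.
  have := sq (e * x + F * y); have := mulr_le0_ge0 De (sq y); lra.
have E0 : E = 0.
  have k1 := main E G a b D; have k2 := main E G c d D.
  have [e|e|//] := ltgtP E 0.
    by move: k2; rewrite leNgt nmulr_rlt0 // h2.
  by move: k1; rewrite leNgt pmulr_rlt0 // h1.
have D' : F * F - G * E <= 0 by rewrite mulrC [G * E]mulrC [F * F]mulrC.
have G0 : G = 0.
  have k1 := main G E b a D'; have k2 := main G E d c D'.
  have [e|e|//] := ltgtP G 0.
    by move: k2; rewrite leNgt nmulr_rlt0 //; move: h2; lra.
  by move: k1; rewrite leNgt pmulr_rlt0 //; move: h1; lra.
have F0 : F = 0.
  by apply/eqP; rewrite -sqrf_eq0 expr2; move: D (sq F); rewrite E0; lra.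
by move: h1; rewrite E0 F0 G0; lra.
Qed.

Lemma metricE (x : R * R -> 'rV[R]_n) (p X Y : R * R) :
  metric x p X Y =
    X.1 * Y.1 * lprod (partial (eu R) x p) (partial (eu R) x p) +
    (X.1 * Y.2 + X.2 * Y.1) * lprod (partial (eu R) x p) (partial (ev R) x p) +
    X.2 * Y.2 * lprod (partial (ev R) x p) (partial (ev R) x p).
Proof.
rewrite /metric /Defs.pushforward.
move: (partial (eu R) x p) (partial (ev R) x p) => xu xv.
rewrite !lprodE (lprodC xv xu).
by move: (lprod xu xu) (lprod xu xv) (lprod xv xv) => *; ring.
Qed.

Lemma second_formE (U : set (R * R)) (x : R * R -> 'rV[R]_n) (p X : R * R) :
  open U -> U p -> smooth_vec U x ->
  second_form x (cst X) (cst X) p =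
  oproj (perp2 (partial (eu R) x p) (partial (ev R) x p))
    (X.1 * X.1 *: partial (eu R) (partial (eu R) x) p +
     (2 * X.1 * X.2) *: partial (ev R) (partial (eu R) x) p +
     X.2 * X.2 *: partial (ev R) (partial (ev R) x) p).
Proof.
move=> oU Up xs; rewrite /second_form normal_spaceE; congr oproj.
have xus := smooth_vec_partial xs (axis_eu R).
have xvs := smooth_vec_partial xs (axis_ev R).
have D e : is_axis e -> partial e (fun q => Defs.pushforward x q X) p =
    X.1 *: partial e (partial (eu R) x) p + X.2 *: partial e (partial (ev R) x) p.
  move=> ae; apply: partial_val.
  have h1 := is_vderive_scale X.1 (smooth_is_vderive xus Up ae).
  have h2 := is_vderive_scale X.2 (smooth_is_vderive xvs Up ae).
  exact: (is_vderiveD h1 h2).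
rewrite /flat_derivative /=.
have := D _ (axis_eu R); have := D _ (axis_ev R).
have := schwarz_vec oU Up xs.
move: (partial (eu R) (fun q => Defs.pushforward x q (cst X q)) p)
  (partial (ev R) (fun q => Defs.pushforward x q (cst X q)) p).
move: (partial (eu R) (partial (eu R) x) p) (partial (ev R) (partial (eu R) x) p)
 (partial (eu R) (partial (ev R) x) p) (partial (ev R) (partial (ev R) x) p).
move=> xuu xuv xvu xvv y1 y2 <- -> ->.
by apply/rowP => i; rewrite !mxE; ring.
Qed.

End Minimal.

(** * The conjugate of a minimal immersion *)

Section Conjugate.
Context {R : realType} {n : nat}.

(** (c, d) is (a, b) turned by the conjugation, which maps unit time-like vectors to orthogonal unit
    space-like ones. The mean curvature is the trace of the second fundamental form, so its
    vanishing makes the trace combination of second derivatives tangent. *)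
Lemma mean_curvature_trace (X Y uu uv vv : 'rV[R]_n) (a b W : R) :
  let E := lprod X X in let F := lprod X Y in let G := lprod Y Y in
  let c := - (a * F + b * G) / W in let d := (a * E + b * F) / W in
  W != 0 -> W * W = F * F - E * G ->
  a * a * E + 2 * a * b * F + b * b * G = - 1 ->
  - oproj (perp2 X Y) (a * a *: uu + (2 * a * b) *: uv + b * b *: vv) +
    oproj (perp2 X Y) (c * c *: uu + (2 * c * d) *: uv + d * d *: vv) = 0 ->
  exists k l, E *: vv - (2 * F) *: uv + G *: uu = k *: X + l *: Y.
Proof.
move=> E F G c d W0 WW ab.
have D0 : E * G - F * F != 0.
  by rewrite -opprB -WW oppr_eq0 mulf_neq0.
have [k1 [l1 h1]] := perp2_decomposition
  (a * a *: uu + (2 * a * b) *: uv + b * b *: vv) D0.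
have [k2 [l2 h2]] := perp2_decomposition
  (c * c *: uu + (2 * c * d) *: uv + d * d *: vv) D0.
rewrite (oproj_perp2 D0 h1) (oproj_perp2 D0 h2) => sum0.
have WW0 : W * W != 0 by rewrite mulf_neq0.
(* Here and in [cd], [db]: the entries of the inverse metric, with determinant E G - F^2 = - W^2. *)
have ca : c * c - a * a = - G / (W * W).
  apply: (mulIf WW0); rewrite divfK // mulrBl.
  have -> : c * c * (W * W) = (a * F + b * G) * (a * F + b * G).
    by rewrite /c; field.
  rewrite WW -[- G]mulrN1 -ab; ring.
have cd : 2 * c * d - 2 * a * b = 2 * F / (W * W).
  apply: (mulIf WW0); rewrite divfK // mulrBl.
  have -> : 2 * c * d * (W * W) = - 2 * (a * F + b * G) * (a * E + b * F).
    by rewrite /c /d; field.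
  have -> : 2 * F = - (2 * F) * - 1 by ring.
  rewrite WW -ab; ring.
have db : d * d - b * b = - E / (W * W).
  apply: (mulIf WW0); rewrite divfK // mulrBl.
  have -> : d * d * (W * W) = (a * E + b * F) * (a * E + b * F).
    by rewrite /d; field.
  rewrite WW -[- E]mulrN1 -ab; ring.
exists (- (W * W) * (k2 - k1)), (- (W * W) * (l2 - l1)).
have {}sum0 : (c * c - a * a) *: uu + (2 * c * d - 2 * a * b) *: uv +
    (d * d - b * b) *: vv = (k2 - k1) *: X + (l2 - l1) *: Y.
  apply/rowP => i; move/rowP: sum0 => /(_ i); rewrite !mxE; lra.
rewrite ca cd db in sum0.
rewrite -!(scalerA (- (W * W))) -scalerDr -sum0.
apply/rowP => i; rewrite !mxE;
by field.
Qed.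

(** Apart from multiples of X and Y, Pv - Qu is (E vv - 2 F uv + G uu) / W, which is tangent by
    [tang]. The remaining premises, derivatives of algebraic identities, make it orthogonal to X and
    Y, hence zero. The derivatives p1, p2, q1, q2 of the coefficients need not be computed. *)
Lemma conjugate_closed_alg (X Y uu uv vv P Q Pv Qu : 'rV[R]_n)
    (W Wu Wv p1 p2 q1 q2 k l : R) :
  let E := lprod X X in let F := lprod X Y in let G := lprod Y Y in
  W != 0 -> W * W = F * F - E * G ->
  E *: vv - (2 * F) *: uv + G *: uu = k *: X + l *: Y ->
  P = (- F / W) *: X + (E / W) *: Y ->
  Q = (- G / W) *: X + (F / W) *: Y ->
  Pv = (p1 *: X + (- F / W) *: uv) + (p2 *: Y + (E / W) *: vv) ->
  Qu = (q1 *: X + (- G / W) *: uu) + (q2 *: Y + (F / W) *: uv) ->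
  lprod Pv X + lprod P uv = 0 -> lprod Pv Y + lprod P vv = - Wv ->
  lprod Qu X + lprod Q uu = Wu -> lprod Qu Y + lprod Q uv = 0 ->
  Wu * W + W * Wu = (lprod uu Y + lprod X uv) * F + F * (lprod uu Y + lprod X uv) -
    ((lprod uu X + lprod X uu) * G + E * (lprod uv Y + lprod Y uv)) ->
  Wv * W + W * Wv = (lprod uv Y + lprod X vv) * F + F * (lprod uv Y + lprod X vv) -
    ((lprod uv X + lprod X uv) * G + E * (lprod vv Y + lprod Y vv)) ->
  Pv = Qu.
Proof.
move=> E F G W0 WW tang PE QE PvE QuE r1 r2 r3 r4 rWu rWv.
pose s := p1 - q1 + k / W; pose t := p2 - q2 + l / W.
have ZE : Pv - Qu = s *: X + t *: Y.
  have -> : s *: X + t *: Y = (p1 - q1) *: X + (p2 - q2) *: Y +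
      W^-1 *: (k *: X + l *: Y).
    by apply/rowP => i; rewrite !mxE /s /t; ring.
  rewrite -tang PvE QuE.
  by apply/rowP => i; rewrite !mxE; ring.
have ZX : lprod (Pv - Qu) X = 0.
  have h : lprod (Pv - Qu) X = lprod Q uu - lprod P uv - Wu.
    by rewrite lprodBl; move: r1 r3; lra.
  apply: (mulIf W0); rewrite mul0r h PE QE !lprodE.
  rewrite -/E -/F -/G; move: rWu; rewrite (lprodC uu X) (lprodC uu Y) (lprodC uv Y).
  move: E F G {h WW tang PE QE PvE QuE rWv} => E F G.
  move: (lprod X uu) (lprod Y uu) (lprod X uv) (lprod Y uv) => a1 a2 a3 a4 rWu.
  have -> : (- G / W * a1 + F / W * a2 - (- F / W * a3 + E / W * a4) - Wu) * W =
     - G * a1 + F * a2 + F * a3 - E * a4 - Wu * W by field.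
  by move: rWu; lra.
have ZY : lprod (Pv - Qu) Y = 0.
  have h : lprod (Pv - Qu) Y = lprod Q uv - lprod P vv - Wv.
    by rewrite lprodBl; move: r2 r4; lra.
  apply: (mulIf W0); rewrite mul0r h PE QE !lprodE.
  rewrite -/E -/F -/G; move: rWv; rewrite (lprodC uv X) (lprodC uv Y) (lprodC vv Y).
  move: E F G {h WW tang PE QE PvE QuE rWu} => E F G.
  move: (lprod X vv) (lprod Y vv) (lprod X uv) (lprod Y uv) => a1 a2 a3 a4 rWv.
  have -> : (- G / W * a3 + F / W * a4 - (- F / W * a1 + E / W * a2) - Wv) * W =
     - G * a3 + F * a4 + F * a1 - E * a2 - Wv * W by field.
  by move: rWv; lra.
have WW0 : W * W != 0 by rewrite mulf_neq0.
have e1 : s * E + t * F = 0 by rewrite -ZX ZE !lprodE (lprodC Y X).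
have e2 : s * F + t * G = 0 by rewrite -ZY ZE !lprodE.
have s0 : s = 0.
  apply: (mulIf WW0); rewrite mul0r WW.
  have -> : s * (F * F - E * G) = F * (s * F + t * G) - G * (s * E + t * F) by ring.
  by rewrite e1 e2 !mulr0 subrr.
have t0 : t = 0.
  apply: (mulIf WW0); rewrite mul0r WW.
  have -> : t * (F * F - E * G) = F * (s * E + t * F) - E * (s * F + t * G) by ring.
  by rewrite e1 e2 !mulr0 subrr.
by apply/eqP; rewrite -subr_eq0 ZE s0 t0 !scale0r addr0.
Qed.

End Conjugate.

(** * From minimality to closedness of the conjugate form *)

Section HarmonicCoordinates.
Context {R : realType} {n : nat}.

Lemma is_derive_unique (f : R * R -> R) (z e : R * R) (d d' : R) :
  is_derive z e f d -> is_derive z e f d' -> d = d'.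
Proof. by move=> [_ <-] [_ <-]. Qed.

(** A time-like vector is normalized to (a, b) and then turned by the conjugation. The square of (a,
    b) appears twice, in the shapes required by [mean_curvature_trace] and by [metricE]. *)
Lemma orthonormal_coefficients (E F G W c d : R) :
  W != 0 -> W * W = F * F - E * G ->
  c * c * E + (c * d + d * c) * F + d * d * G < 0 ->
  exists a b, let c := - (a * F + b * G) / W in let d := (a * E + b * F) / W in
    [/\ a * a * E + 2 * a * b * F + b * b * G = - 1,
        a * a * E + (a * b + b * a) * F + b * b * G = - 1,
        c * c * E + (c * d + d * c) * F + d * d * G = 1 &
        a * c * E + (a * d + b * c) * F + b * d * G = 0].
Proof.
move=> W0 WW cd.
pose m := - (c * c * E + (c * d + d * c) * F + d * d * G).
have m0 : 0 < m by rewrite oppr_gt0.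
have sm : Num.sqrt m != 0 by rewrite gt_eqF // sqrtr_gt0.
have smm : Num.sqrt m * Num.sqrt m = m by rewrite -expr2 sqr_sqrtr // ltW.
pose a := c / Num.sqrt m; pose b := d / Num.sqrt m.
have ab : a * a * E + 2 * a * b * F + b * b * G = - 1.
  have mn0 : m != 0 by rewrite gt_eqF.
  apply: (mulIf mn0).
  have -> : (a * a * E + 2 * a * b * F + b * b * G) * m =
    (c * c * E + (c * d + d * c) * F + d * d * G).
    by rewrite -smm /a /b; field.
  by rewrite mulN1r /m opprK.
exists a, b; clearbody a b; split.
- exact: ab.
- by rewrite -ab; ring.
- have WW0 : W * W != 0 by rewrite mulf_neq0.
  apply: (mulIf WW0); rewrite mul1r.
  have -> : (- (a * F + b * G) / W * (- (a * F + b * G) / W) * E +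
      (- (a * F + b * G) / W * ((a * E + b * F) / W) +
       (a * E + b * F) / W * (- (a * F + b * G) / W)) * F +
       (a * E + b * F) / W * ((a * E + b * F) / W) * G) * (W * W) =
       - (F * F - E * G) * (a * a * E + 2 * a * b * F + b * b * G) by field.
  by rewrite ab mulrN1 opprK.
- by field.
Qed.

Lemma minimal_tangential (U : set (R * R)) (x : R * R -> 'rV[R]_n)
    (p : R * R) (W : R) :
  timelike_surface U x -> minimal_surface U x -> U p ->
  let X := partial (eu R) x p in let Y := partial (ev R) x p in
  W != 0 -> W * W = lprod X Y * lprod X Y - lprod X X * lprod Y Y ->
  exists k l, lprod X X *: partial (ev R) (partial (ev R) x) p
    - (2 * lprod X Y) *: partial (ev R) (partial (eu R) x) p
    + lprod Y Y *: partial (eu R) (partial (eu R) x) p = k *: X + l *: Y.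
Proof.
move=> [[oU _ _] [xs _] tl] mini Up X Y W0 WW.
have [[[c d] cd] _] := tl p Up.
rewrite metricE /= -/X -/Y in cd.
have [a [b [ab ab' c1 c2]]] := orthonormal_coefficients W0 WW cd.
pose X1 : R * R := (a, b).
pose X2 : R * R := (- (a * lprod X Y + b * lprod Y Y) / W,
  (a * lprod X X + b * lprod X Y) / W).
have ob : orthonormal_basis x p X1 X2.
  by split; rewrite metricE; [exact: ab'|exact: c1|exact: c2].
have := mini p Up X1 X2 ob.
rewrite /mean_curvature !(second_formE _ oU Up xs) -/X -/Y /X1 /X2 /= => /eqP.
rewrite scaler_eq0 invr_eq0 pnatr_eq0 /= => /eqP mc.
exact: mean_curvature_trace W0 WW ab mc.
Qed.

(** W may be either square root of the discriminant; the opposite root gives the opposite conjugate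
    form. *)
Lemma conjugate_closed (U : set (R * R)) (xu xv : R * R -> 'rV[R]_n)
    (W : R * R -> R) :
  let E z := lprod (xu z) (xu z) in let F z := lprod (xu z) (xv z) in
  let G z := lprod (xv z) (xv z) in
  open U -> smooth_vec U xu -> smooth_vec U xv -> smooth U W ->
  (forall z, U z -> [/\ W z != 0, W z * W z = F z * F z - E z * G z,
     partial (ev R) xu z = partial (eu R) xv z & exists k l,
     E z *: partial (ev R) xv z - (2 * F z) *: partial (ev R) xu z
     + G z *: partial (eu R) xu z = k *: xu z + l *: xv z]) ->
  exists P Q : R * R -> 'rV[R]_n, [/\ smooth_vec U P, smooth_vec U Q &
    forall z, U z -> [/\ P z = (- F z / W z) *: xu z + (E z / W z) *: xv z,
      Q z = (- G z / W z) *: xu z + (F z / W z) *: xv z &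
      partial (ev R) P z = partial (eu R) Q z]].
Proof.
move=> E F G oU us vs Ws H.
have Es : smooth U E by exact: smooth_lprod.
have Fs : smooth U F by exact: smooth_lprod.
have Gs : smooth U G by exact: smooth_lprod.
have iW : smooth U (fun z => (W z)^-1).
  by apply: smooth_inv => // z /H[].
have p1s : smooth U (fun z => - F z / W z).
  by apply: smooth_mul => //; exact: smooth_opp.
have p2s : smooth U (fun z => E z / W z) by exact: smooth_mul.
have q1s : smooth U (fun z => - G z / W z).
  by apply: smooth_mul => //; exact: smooth_opp.
have q2s : smooth U (fun z => F z / W z) by exact: smooth_mul.
pose P z := (- F z / W z) *: xu z + (E z / W z) *: xv z.
pose Q z := (- G z / W z) *: xu z + (F z / W z) *: xv z.
have Ps : smooth_vec U P.
  by apply: smooth_vec_add => //; exact: smooth_vec_scale.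
have Qs : smooth_vec U Q.
  by apply: smooth_vec_add => //; exact: smooth_vec_scale.
exists P, Q; split; [exact: Ps|exact: Qs|] => z Uz.
split; [exact: erefl|exact: erefl|].
have [W0 WW su [k [l tang]]] := H z Uz.
have D1 (y : R * R -> 'rV[R]_n) e ys ae := @smooth_is_vderive R n U z e y ys Uz ae.
have uu := D1 _ _ us (axis_eu R); have uv := D1 _ _ us (axis_ev R).
have vu := D1 _ _ vs (axis_eu R); have vv := D1 _ _ vs (axis_ev R).
rewrite -su in vu.
have Pu := D1 _ _ Ps (axis_eu R); have Pv := D1 _ _ Ps (axis_ev R).
have Qu := D1 _ _ Qs (axis_eu R); have Qv := D1 _ _ Qs (axis_ev R).
have Wu := smooth_is_derive Ws Uz (axis_eu R).
have Wv := smooth_is_derive Ws Uz (axis_ev R).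
have PvE := is_vderive_unique Pv (is_vderiveD
  (is_vderiveZ (smooth_is_derive p1s Uz (axis_ev R)) uv)
  (is_vderiveZ (smooth_is_derive p2s Uz (axis_ev R)) vv)).
have QuE := is_vderive_unique Qu (is_vderiveD
  (is_vderiveZ (smooth_is_derive q1s Uz (axis_eu R)) uu)
  (is_vderiveZ (smooth_is_derive q2s Uz (axis_eu R)) vu)).
(* These products do not involve E, F, G separately; differentiating them yields [r1] to [r4]. *)
have alg q : U q -> [/\ lprod (P q) (xu q) = 0, lprod (P q) (xv q) = - W q,
    lprod (Q q) (xu q) = W q & lprod (Q q) (xv q) = 0].
  move=> /H[w0 ww _ _]; rewrite /P /Q !lprodE (lprodC (xv q) (xu q)).
  rewrite -/(E q) -/(F q) -/(G q).
  split.
  - by move: (E q) (F q) => e f; field.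
  - apply: (mulIf w0); rewrite [- W q * _]mulNr ww.
    by move: (E q) (F q) (G q) => e f g; field.
  - apply: (mulIf w0); rewrite ww.
    by move: (E q) (F q) (G q) => e f g; field.
  - by move: (F q) (G q) => f g; field.
have c0 e : is_derive z e (fun=> 0 : R) 0 by exact: is_derive_cst.
have r1 : lprod (partial (ev R) P z) (xu z) + lprod (P z) (partial (ev R) xu z) = 0.
  apply: (is_derive_unique (is_derive_lprod Pv uv)).
  by apply: (is_derive_local oU Uz _ (c0 (ev R))) => q /alg[->].
have r2 : lprod (partial (ev R) P z) (xv z) + lprod (P z) (partial (ev R) xv z) =
    - 'D_(ev R) W z.
  apply: (is_derive_unique (is_derive_lprod Pv vv)).
  by apply: (is_derive_local oU Uz _ (is_deriveN Wv)) => q /alg[_ ->].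
have r3 : lprod (partial (eu R) Q z) (xu z) + lprod (Q z) (partial (eu R) xu z) =
    'D_(eu R) W z.
  apply: (is_derive_unique (is_derive_lprod Qu uu)).
  by apply: (is_derive_local oU Uz (f := W)) => // q /alg[_ _ ->].
have r4 : lprod (partial (eu R) Q z) (xv z) + lprod (Q z) (partial (ev R) xu z) = 0.
  apply: (is_derive_unique (is_derive_lprod Qu vu)).
  by apply: (is_derive_local oU Uz _ (c0 (eu R))) => q /alg[_ _ _ ->].
(* The derivative of W^2 = F^2 - E G in either direction. *)
have disc e du dv dW : is_vderive z e xu du -> is_vderive z e xv dv ->
    is_derive z e W dW -> dW * W z + W z * dW =
    (lprod du (xv z) + lprod (xu z) dv) * F z +
    F z * (lprod du (xv z) + lprod (xu z) dv) -
    ((lprod du (xu z) + lprod (xu z) du) * G z +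
    E z * (lprod dv (xv z) + lprod (xv z) dv)).
  move=> hu hv hW.
  have dE := is_derive_lprod hu hu; have dF := is_derive_lprod hu hv.
  have dG := is_derive_lprod hv hv.
  have h1 := is_deriveB (is_deriveM dF dF) (is_deriveM dE dG).
  have h2 := is_deriveM hW hW.
  have WE q : U q -> (F * F - E * G) q = (W * W) q by move=> /H[_ ww _ _].
  have := is_derive_unique h2 (is_derive_local oU Uz WE h1).
  rewrite -[lprod (xu z) (xu z)]/(E z) -[lprod (xu z) (xv z)]/(F z).
  rewrite -[lprod (xv z) (xv z)]/(G z).
  move: (E z) (F z) (G z) (W z) (lprod du (xv z)) (lprod (xu z) dv)
   (lprod du (xu z)) (lprod (xu z) du) (lprod dv (xv z)) (lprod (xv z) dv).
  move=> e' f g w b1 b2 b3 b4 b5 b6 h.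
  have sE (a b : R) : a *: b = a * b by [].
  by move: h; rewrite !sE => h; rewrite mulrC h; ring.
have dWu := disc _ _ _ _ uu vu Wu; have dWv := disc _ _ _ _ uv vv Wv.
exact: conjugate_closed_alg W0 WW tang (erefl (P z)) (erefl (Q z)) PvE QuE
  r1 r2 r3 r4 dWu dWv.
Qed.

End HarmonicCoordinates.

(** * Null forms *)

Section NullFactors.
Context {R : realType} {n : nat}.

(* [(P du + Q dv) a] is a closed vector-valued form of rank one with null
   values; [b] is the derivative of [a] with respect to a primitive of
   [P du + Q dv]. *)
Definition null_factor (U : set (R * R)) (P Q : R * R -> R)
    (a b : R * R -> 'rV[R]_n) : Prop :=
  [/\ smooth U P, smooth U Q, smooth_vec U a, smooth_vec U b &
   forall z, U z -> [/\ 'D_(ev R) P z = 'D_(eu R) Q z,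
     0 < P z * P z + Q z * Q z,
     partial (eu R) a z = P z *: b z, partial (ev R) a z = Q z *: b z &
     lprod (a z) (a z) = 0 /\ lprod (a z) (b z) = 0]].

Lemma null_factor_subset (U U' : set (R * R)) P Q a b : U' `<=` U ->
  null_factor U P Q a b -> null_factor U' P Q a b.
Proof.
move=> UU [Ps Qs as_ bs H]; split; try exact: smooth_subset UU _;
  try exact: smooth_vec_subset UU _.
by move=> z /UU /H.
Qed.

(** The product of form and vector is unchanged, and so is b, since th and da both change sign. This
    serves to adjust the sign of a product [lprod a a']. *)
Lemma null_factorN (U : set (R * R)) P Q a b : open U ->
  null_factor U P Q a b ->
  null_factor U (fun z => - P z) (fun z => - Q z) (fun z => - 1 *: a z) b.
Proof.
move=> oU [Ps Qs as_ bs H]; split=> //; try exact: smooth_opp.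
  exact: smooth_vec_scale (smooth_cst _ oU) as_.
move=> z Uz; have [PQ nz au av [aa ab]] := H z Uz.
have Pv := smooth_is_derive Ps Uz (axis_ev R).
have Qu := smooth_is_derive Qs Uz (axis_eu R).
have au' := smooth_is_vderive as_ Uz (axis_eu R).
have av' := smooth_is_vderive as_ Uz (axis_ev R).
rewrite au in au'; rewrite av in av'; split.
- have [_ h1] := is_deriveN Pv; have [_ h2] := is_deriveN Qu.
  by apply: etrans h1 (etrans _ (esym h2)); rewrite PQ.
- by rewrite !mulrNN.
- by rewrite (partial_val (is_vderive_scale (- 1) au')) scaleN1r scaleNr.
- by rewrite (partial_val (is_vderive_scale (- 1) av')) scaleN1r scaleNr.
- by rewrite !lprodE aa ab !mulr0.
Qed.

(** Contracting with (P, Q) divides a proportional vector-valued form without a case distinction on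
    which of P and Q is nonzero, so the quotient is smooth. *)
Lemma divide_form (P Q : R) (X Y : 'rV[R]_n) : 0 < P * P + Q * Q ->
  Q *: X = P *: Y -> let c := (P * P + Q * Q)^-1 *: (P *: X + Q *: Y) in
  X = P *: c /\ Y = Q *: c.
Proof.
move=> nz XY c; have n0 : P * P + Q * Q != 0 by rewrite gt_eqF.
have e i : Q * X 0 i = P * Y 0 i by move/rowP: XY => /(_ i); rewrite !mxE.
have eP (x y : R) : Q * x = P * y ->
    P * ((P * P + Q * Q)^-1 * (P * x + Q * y)) = x.
  move=> xy; have -> : P * ((P * P + Q * Q)^-1 * (P * x + Q * y)) =
    (P * P + Q * Q)^-1 * (P * P * x + Q * (P * y)) by ring.
  by rewrite -xy; field.
have eQ (x y : R) : Q * x = P * y ->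
    Q * ((P * P + Q * Q)^-1 * (P * x + Q * y)) = y.
  move=> xy; have -> : Q * ((P * P + Q * Q)^-1 * (P * x + Q * y)) =
    (P * P + Q * Q)^-1 * (P * (Q * x) + Q * Q * y) by ring.
  by rewrite xy; field.
by split; apply/rowP => i; rewrite !mxE ?eP ?eQ.
Qed.

Lemma cancel_form (d1 d2 s t : R) (v w1 w2 : 'rV[R]_n) : d1 = d2 ->
  d1 *: v + s *: w1 = d2 *: v + t *: w2 -> t *: w2 = s *: w1.
Proof. by move=> -> /addrI. Qed.

Lemma lprod_comb0 (c s t : R) (v w1 w2 : 'rV[R]_n) : lprod v w1 = 0 ->
  lprod v w2 = 0 -> lprod v (c *: (s *: w1 + t *: w2)) = 0.
Proof. by move=> h1 h2; rewrite !lprodE h1 h2 !mulr0 addr0 mulr0. Qed.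

(** The scalar form th is one component of the vector-valued form, hence closed for free. Rank one
    makes the whole form a multiple th a, and differentiating a . a = 0 gives a . b = 0. *)
Lemma null_factorization (U : set (R * R)) (X Y : R * R -> 'rV[R]_n)
    (p : R * R) :
  open U -> U p -> smooth_vec U X -> smooth_vec U Y ->
  (forall z, U z -> [/\ partial (ev R) X z = partial (eu R) Y z,
     forall i j, X z 0 i * Y z 0 j = X z 0 j * Y z 0 i,
     lprod (X z) (X z) = 0, lprod (X z) (Y z) = 0 & lprod (Y z) (Y z) = 0]) ->
  ~ (X p = 0 /\ Y p = 0) ->
  exists (U' : set (R * R)) P Q a b, [/\ open U', U' `<=` U, U' p,
    null_factor U' P Q a b &
    forall z, U' z -> X z = P z *: a z /\ Y z = Q z *: a z].
Proof.
move=> oU Up Xs Ys H nz.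
(* A component of the form that does not vanish at p; the neighbourhood is shrunk to where it stays
   nonzero. *)
have [i ip] : exists i, 0 < X p 0 i * X p 0 i + Y p 0 i * Y p 0 i.
  apply: contrapT => hn; apply: nz; split; apply/rowP => i; rewrite mxE;
  apply/eqP; rewrite -sqrf_eq0; apply/eqP/le_anti/andP; split;
  rewrite ?sqr_ge0 // leNgt; apply/negP => h; apply: hn; exists i;
  rewrite -!expr2; by [apply: ltr_pwDl => //; exact: sqr_ge0|
    apply: ltr_wpDl => //; exact: sqr_ge0].
pose P z := X z 0 i; pose Q z := Y z 0 i.
pose N z := P z * P z + Q z * Q z.
have Ps : smooth U P by exact: Xs.
have Qs : smooth U Q by exact: Ys.
have Ns : smooth U N by apply: smooth_add => //; exact: smooth_mul.
pose U' := [set z | U z /\ 0 < N z].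
have oU' : open U' by exact: open_pos oU (Ns 0%N).
have UU : U' `<=` U by move=> z [].
have Ps' := smooth_subset UU Ps; have Qs' := smooth_subset UU Qs.
have Xs' := smooth_vec_subset UU Xs; have Ys' := smooth_vec_subset UU Ys.
have iN : smooth U' (fun z => (N z)^-1).
  by apply: smooth_inv (smooth_subset UU Ns) _ => // z [_ h]; rewrite gt_eqF.
pose a z := (N z)^-1 *: (P z *: X z + Q z *: Y z).
have div_smooth (F G : R * R -> 'rV[R]_n) : smooth_vec U' F -> smooth_vec U' G ->
    smooth_vec U' (fun z => (N z)^-1 *: (P z *: F z + Q z *: G z)).
  move=> Fs Gs; apply: smooth_vec_scale => //.
  by apply: smooth_vec_add => //; exact: smooth_vec_scale.
have as_ : smooth_vec U' a by exact: div_smooth.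
have XY z : U' z -> X z = P z *: a z /\ Y z = Q z *: a z.
  move=> [Uz nzz]; apply: divide_form => //.
  have [_ r1 _ _ _] := H z Uz.
  by apply/rowP => j; rewrite !mxE mulrC r1.
pose b z := (N z)^-1 *: (P z *: partial (eu R) a z + Q z *: partial (ev R) a z).
have aus := smooth_vec_partial as_ (axis_eu R).
have avs := smooth_vec_partial as_ (axis_ev R).
have bs : smooth_vec U' b by exact: div_smooth.
exists U', P, Q, a, b; split=> //; split=> // z Uz'.
have [Uz nzz] := Uz'.
have [cl r1 XX XY0 YY] := H z Uz.
have PQ : 'D_(ev R) P z = 'D_(eu R) Q z.
  by move/rowP: cl => /(_ i); rewrite !mxE.
have hau := smooth_is_vderive as_ Uz' (axis_eu R).
have hav := smooth_is_vderive as_ Uz' (axis_ev R).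
have [au av] : partial (eu R) a z = P z *: b z /\ partial (ev R) a z = Q z *: b z.
  (* Since th and th a are both closed, the wedge product of th and da is zero, so da is a multiple
     of th. *)
  suff dv : Q z *: partial (eu R) a z = P z *: partial (ev R) a z.
    exact: (divide_form nzz dv).
  have Pv := smooth_is_derive Ps' Uz' (axis_ev R).
  have Qu := smooth_is_derive Qs' Uz' (axis_eu R).
  have Xv := smooth_is_vderive Xs' Uz' (axis_ev R).
  have Yu := smooth_is_vderive Ys' Uz' (axis_eu R).
  have e1 := is_vderive_unique Xv (is_vderive_local oU' Uz'
    (fun q Uq => esym (XY q Uq).1) (is_vderiveZ Pv hav)).
  have e2 := is_vderive_unique Yu (is_vderive_local oU' Uz'
    (fun q Uq => esym (XY q Uq).2) (is_vderiveZ Qu hau)).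
  exact: cancel_form PQ (etrans (esym e1) (etrans cl e2)).
have aa q : U' q -> lprod (a q) (a q) = 0.
  move=> [Uq nq]; have [_ _ xx xy yy] := H q Uq.
  by rewrite /a !lprodE (lprodC (Y q) (X q)) xx xy yy; ring.
have ad e d : is_vderive z e a d -> lprod (a z) d = 0.
  move=> hd; have h := is_derive_unique (is_derive_lprod hd hd)
    (is_derive_local oU' Uz' (fun q Uq => esym (aa q Uq)) (is_derive_cst 0 z e)).
  by move: h; rewrite (lprodC d); lra.
split=> //; split; first exact: aa.
exact: lprod_comb0 (ad _ _ hau) (ad _ _ hav).
Qed.

Lemma cross_cancel (k c s t lu lv bu bv : R) : k != 0 -> k * lu = c * bu ->
  k * lv = c * bv -> s * bv = t * bu -> s * lv = t * lu.
Proof.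
move=> k0 hu hv e; apply: (mulfI k0).
by rewrite mulrCA hv mulrCA e mulrCA -hu mulrCA.
Qed.

Lemma divide_scalar (s t lu lv : R) : s * s + t * t != 0 -> s * lv = t * lu ->
  lu = (s * lu + t * lv) * (s * s + t * t)^-1 * s /\
  lv = (s * lu + t * lv) * (s * s + t * t)^-1 * t.
Proof.
move=> n0 e; split; apply: (mulIf n0); rewrite [RHS]mulrAC mulfVK // mulrDl.
  by rewrite [t * lv * s]mulrC mulrCA e; ring.
by rewrite [s * lu * t]mulrC mulrCA -e; ring.
Qed.

(** L is a function of the primitive of th alone, which keeps L th closed; the square of b is
    divided by L^4. *)
Lemma null_factor_rescale (U : set (R * R)) P Q a b : open U ->
  null_factor U P Q a b -> (forall z, U z -> 0 < lprod (b z) (b z)) ->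
  exists L b', [/\ forall z, U z -> 0 < L z,
    null_factor U (fun z => L z * P z) (fun z => L z * Q z)
      (fun z => (L z)^-1 *: a z) b' &
    forall z, U z -> lprod (b' z) (b' z) = 4^-1].
Proof.
move=> oU [Ps Qs as_ bs H] b0.
pose f z := 4 * lprod (b z) (b z).
have f0 z : U z -> 0 < f z by move=> /b0 h; rewrite /f mulr_gt0.
have fs : smooth U f.
  by apply: smooth_mul => //; [exact: smooth_cst|exact: smooth_lprod].
have sfs := smooth_sqrt oU fs f0.
have sf0 z : U z -> 0 < Num.sqrt (f z) by move=> /f0; rewrite sqrtr_gt0.
(* L^4 = 4 b^2, so that b^2 / L^4 = 1/4. *)
pose L z := Num.sqrt (Num.sqrt (f z)).
have Ls : smooth U L by exact: smooth_sqrt.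
have L0 z : U z -> 0 < L z by move=> /sf0 h; rewrite sqrtr_gt0.
have L4 z : U z -> L z * L z * (L z * L z) = f z.
  move=> Uz; rewrite -!expr2 /L sqr_sqrtr ?ltW ?sf0 //.
  by rewrite sqr_sqrtr // ltW // f0.
have iLs : smooth U (fun z => (L z)^-1).
  by apply: smooth_inv => // z /L0 h; rewrite gt_eqF.
clearbody L.
pose N z := P z * P z + Q z * Q z.
have Ns : smooth U N by apply: smooth_add => //; exact: smooth_mul.
have iN : smooth U (fun z => (N z)^-1).
  by apply: smooth_inv => // z /H[_ h _ _ _]; rewrite gt_eqF.
pose L' z := (P z * 'D_(eu R) L z + Q z * 'D_(ev R) L z) * (N z)^-1.
have Lus := smooth_derive Ls (axis_eu R); have Lvs := smooth_derive Ls (axis_ev R).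
have L's : smooth U L'.
  exact: smooth_mul oU (smooth_add oU (smooth_mul oU Ps Lus)
    (smooth_mul oU Qs Lvs)) iN.
(* With dL = L' th, the derivative of a / L is (b / L - L' a / L^2) th; dividing by L expresses it
   through L th. *)
pose b' z := ((L z)^-1 * (L z)^-1) *: b z +
  (- ((L z)^-1 * (L z)^-1 * (L z)^-1 * L' z)) *: a z.
have i2 : smooth U (fun z => (L z)^-1 * (L z)^-1) by exact: smooth_mul.
have i3 : smooth U (fun z => (L z)^-1 * (L z)^-1 * (L z)^-1) by exact: smooth_mul.
have bs' : smooth_vec U b'.
  exact: smooth_vec_add oU (smooth_vec_scale oU i2 bs)
    (smooth_vec_scale oU (smooth_opp oU (smooth_mul oU i3 L's)) as_).
(* Equality of the mixed derivatives of a makes db proportional to th, and 4 L^3 dL = 8 b . db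
   passes this on to dL. *)
have LL z : U z -> 'D_(eu R) L z = L' z * P z /\ 'D_(ev R) L z = L' z * Q z.
  move=> Uz; have [PQ nz au av [aa ab]] := H z Uz.
  have hbu := smooth_is_vderive bs Uz (axis_eu R).
  have hbv := smooth_is_vderive bs Uz (axis_ev R).
  have Pv := smooth_is_derive Ps Uz (axis_ev R).
  have Qu := smooth_is_derive Qs Uz (axis_eu R).
  have aus := smooth_vec_partial as_ (axis_eu R).
  have avs := smooth_vec_partial as_ (axis_ev R).
  have auv := smooth_is_vderive aus Uz (axis_ev R).
  have avu := smooth_is_vderive avs Uz (axis_eu R).
  have auE q : U q -> P q *: b q = partial (eu R) a q by move=> /H[_ _ ->].
  have avE q : U q -> Q q *: b q = partial (ev R) a q by move=> /H[_ _ _ ->].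
  have e1 := is_vderive_unique auv (is_vderive_local oU Uz auE (is_vderiveZ Pv hbv)).
  have e2 := is_vderive_unique avu (is_vderive_local oU Uz avE (is_vderiveZ Qu hbu)).
  have e3 : P z *: partial (ev R) b z = Q z *: partial (eu R) b z.
    exact: esym (cancel_form PQ
      (etrans (esym e1) (etrans (schwarz_vec oU Uz as_) e2))).
  have hL e dL db : is_derive z e L dL -> is_vderive z e b db ->
      4 * L z * L z * L z * dL = 8 * lprod (b z) db.
    move=> hdL hdb.
    have h1 := is_deriveM (is_deriveM hdL hdL) (is_deriveM hdL hdL).
    have h2 := is_deriveM (is_derive_cst (4 : R) z e) (is_derive_lprod hdb hdb).
    have fE q : U q -> (cst 4 * (fun q => lprod (b q) (b q))) q =
       (L * L * (L * L)) q by move=> Uq; rewrite !fctE L4.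
    have := is_derive_unique h1 (is_derive_local oU Uz fE h2).
    have sE (s t : R) : s *: t = s * t by [].
    rewrite (lprodC db) !fctE !sE /=.
    move: (L z) (lprod (b z) db) (lprod (b z) (b z)) => l u w; lra.
  have Lu := smooth_is_derive Ls Uz (axis_eu R).
  have Lv := smooth_is_derive Ls Uz (axis_ev R).
  have hu := hL _ _ _ Lu hbu; have hv := hL _ _ _ Lv hbv.
  have e4 : P z * lprod (b z) (partial (ev R) b z) =
     Q z * lprod (b z) (partial (eu R) b z) by rewrite -!lprodZr e3.
  have l0 := L0 z Uz; have l0' : L z != 0 by rewrite gt_eqF.
  have l3 : 4 * L z * L z * L z != 0 by rewrite !mulf_neq0 // pnatr_eq0.
  have e5 : P z * 'D_(ev R) L z = Q z * 'D_(eu R) L z.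
    exact: cross_cancel l3 hu hv e4.
  have n0 : N z != 0 by rewrite gt_eqF.
  exact: divide_scalar n0 e5.
exists L, b'; split; first exact: L0.
  split; try exact: smooth_mul; [exact: smooth_vec_scale|exact: bs'|].
  move=> z Uz; have [PQ nz au av [aa ab]] := H z Uz.
  have [Lu Lv] := LL z Uz.
  have l0 := L0 z Uz; have l0' : L z != 0 by rewrite gt_eqF.
  have Pv := smooth_is_derive Ps Uz (axis_ev R).
  have Qu := smooth_is_derive Qs Uz (axis_eu R).
  have hLu := smooth_is_derive Ls Uz (axis_eu R).
  have hLv := smooth_is_derive Ls Uz (axis_ev R).
  have hau := smooth_is_vderive as_ Uz (axis_eu R).
  have hav := smooth_is_vderive as_ Uz (axis_ev R).
  rewrite Lu in hLu; rewrite Lv in hLv; rewrite au in hau; rewrite av in hav.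
  have dV e d : is_derive z e L d ->
      is_derive z e (fun q => (L q)^-1) (- (L z)^-1 ^+ 2 * d).
    move=> [hd hd']; split; first exact: derivableV.
    by rewrite deriveV // hd' exprVn.
  have sE (s t : R) : s *: t = s * t by [].
  split.
  - have [_ h1] := is_deriveM hLv Pv; have [_ h2] := is_deriveM hLu Qu.
    apply: etrans h1 (etrans _ (esym h2)); rewrite PQ !sE.
    move: ('D_(eu R) Q z) => qu; ring.
  - have -> : L z * P z * (L z * P z) + L z * Q z * (L z * Q z) =
      L z * L z * (P z * P z + Q z * Q z) by ring.
    by rewrite !mulr_gt0.
  - rewrite (partial_val (is_vderiveZ (dV _ _ hLu) hau)) /b'.
    apply/rowP => i; rewrite !mxE.
    move: (L' z) (P z) (a z 0 i) (b z 0 i) => l' s ai bi; field.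
    exact: l0'.
  - rewrite (partial_val (is_vderiveZ (dV _ _ hLv) hav)) /b'.
    apply/rowP => i; rewrite !mxE.
    move: (L' z) (Q z) (a z 0 i) (b z 0 i) => l' s ai bi; field.
    exact: l0'.
  - by split; rewrite /b' !lprodE aa ?ab; ring.
move=> z Uz; have [_ _ _ _ [aa ab]] := H z Uz.
have l0 := L0 z Uz; have l0' : L z != 0 by rewrite gt_eqF.
rewrite /b' !lprodE (lprodC (b z) (a z)) aa ab !mulr0 !addr0.
have := L4 z Uz; rewrite /f => h.
have four : (4 : R) != 0 by rewrite pnatr_eq0.
apply: (mulIf four); rewrite mulVf //.
have l4 : L z * L z * (L z * L z) != 0 by rewrite !mulf_neq0.
apply: (mulIf l4); rewrite mul1r {2}h; field.
exact: l0'.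
Qed.

End NullFactors.

(** * Charts from null coframes *)

Section NullCharts.
Context {R : realType} {n : nat}.

Lemma dnum_ext (s t : dnum R) : dRe s = dRe t -> dIm s = dIm t -> s = t.
Proof. by case: s t => [? ?] [? ?] /= -> ->. Qed.

Lemma Phi_val (y : R * R -> 'rV[R]_n) (q : R * R) (yu yv : 'rV[R]_n) :
  is_vderive q (eu R) y yu -> is_vderive q (ev R) y yv ->
  Phi y q = \row_i DNum (yu 0 i) (yv 0 i).
Proof.
move=> hu hv; apply/rowP => i; rewrite !mxE.
have reE : (fun z => dRe (dvec (y z) 0 i)) = (fun z => y z 0 i).
  by apply/funext => z; rewrite mxE.
have imE : (fun z => dIm (dvec (y z) 0 i)) = cst 0.
  by apply/funext => z; rewrite mxE.
rewrite reE imE !derive_cst; have [_ ->] := hu i; have [_ ->] := hv i.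
rewrite mulr_natl mulr2n.
by apply: dnum_ext => /=; field.
Qed.

(** With Phi = (1 + j) a + (1 - j) a', da = b (du + dv) and da' = b' (du - dv), this computes Phi'.
    The factors 1 + j and 1 - j are absorbed by j up to sign. *)
Lemma ddt_rows (b b' : 'rV[R]_n) :
  dreal 2^-1 *: (\row_i DNum ((b + b') 0 i) ((b - b') 0 i) +
    dj R *: \row_i DNum ((b - b') 0 i) ((b + b') 0 i)) =
  DNum 1 1 *: dvec b + DNum 1 (- 1) *: dvec b'.
Proof.
have comb (c d : dnum R) (S T : 'rV[dnum R]_n) i :
    (c *: (S + d *: T)) 0 i = c * (S 0 i + d * T 0 i).
  by rewrite mxE mxE [X in _ + X]mxE.
have lin (c d : dnum R) (S T : 'rV[dnum R]_n) i :
    (c *: S + d *: T) 0 i = c * S 0 i + d * T 0 i.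
  by rewrite mxE [X in X + _]mxE [X in _ + X]mxE.
have row (f : 'I_n -> dnum R) i : (\row_j f j) 0 i = f i by rewrite mxE.
have dv (v : 'rV[R]_n) i : dvec v 0 i = dreal (v 0 i) by rewrite mxE.
have sum (v w : 'rV[R]_n) i : (v + w) 0 i = v 0 i + w 0 i by rewrite mxE.
have opp (v : 'rV[R]_n) i : (- v) 0 i = - v 0 i by rewrite mxE.
apply/rowP => i; rewrite comb lin !row !dv !sum !opp.
move: (b 0 i) (b' 0 i) => s t.
by apply: dnum_ext => /=; field.
Qed.

Lemma ddt_val (F : R * R -> 'rV[dnum R]_n) (f g : R * R -> 'rV[R]_n)
    (V : set (R * R)) (q : R * R) (b b' : 'rV[R]_n) : open V -> V q ->
  (forall z, V z -> F z = \row_i DNum (f z 0 i) (g z 0 i)) ->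
  is_vderive q (eu R) f (b + b') -> is_vderive q (ev R) f (b - b') ->
  is_vderive q (eu R) g (b - b') -> is_vderive q (ev R) g (b + b') ->
  ddt F q = DNum 1 1 *: dvec b + DNum 1 (- 1) *: dvec b'.
Proof.
move=> oV Vq Ffg fu fv gu gv.
have reD e d : is_vderive q e f d -> forall i,
    'D_e (fun z => dRe (F z 0 i)) q = d 0 i.
  move=> hf i; have fE z : V z -> f z 0 i = dRe (F z 0 i).
    by move=> /Ffg ->; rewrite mxE.
  by have [_ ->] := is_derive_local oV Vq fE (hf i).
have imD e d : is_vderive q e g d -> forall i,
    'D_e (fun z => dIm (F z 0 i)) q = d 0 i.
  move=> hf i; have fE z : V z -> g z 0 i = dIm (F z 0 i).
    by move=> /Ffg ->; rewrite mxE.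
  by have [_ ->] := is_derive_local oV Vq fE (hf i).
have du : dpartial (eu R) F q =
    \row_i DNum ((b + b') 0 i) ((b - b') 0 i).
  apply/rowP => i; rewrite mxE [RHS]mxE.
  by congr DNum; [exact: reD|exact: imD].
have dv : dpartial (ev R) F q =
    \row_i DNum ((b - b') 0 i) ((b + b') 0 i).
  apply/rowP => i; rewrite mxE [RHS]mxE.
  by congr DNum; [exact: reD|exact: imD].
apply: etrans (congr2 (fun s t => dreal 2^-1 *: (s + dj R *: t)) du dv) _.
exact: ddt_rows.
Qed.

(** As a . b = 0, subtracting a multiple of a from b makes it normal, and does not change its square
    because a is null; likewise for b'. The mixed terms disappear by (1 + j) (1 - j) = 0, and (1 +
    j)^2 = 2 (1 + j), (1 - j)^2 = 2 (1 - j). *)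
Lemma projected_square (a a' b b' : 'rV[R]_n) :
  lprod a a = 0 -> lprod a' a' = 0 -> lprod a a' != 0 ->
  lprod a b = 0 -> lprod a' b' = 0 ->
  let w := oproj (dspan (perp2 (a + a') (a - a')))
    (DNum 1 1 *: dvec b + DNum 1 (- 1) *: dvec b') in
  lprod w w = DNum (2 * (lprod b b + lprod b' b')) (2 * (lprod b b - lprod b' b')).
Proof.
move=> aa aa' m0 ab ab'.
set m := lprod a a' in m0.
pose c := lprod b a' / m; pose c' := lprod b' a / m.
pose v := b - c *: a; pose v' := b' - c' *: a'.
have perpE s : perp2 (a + a') (a - a') s <-> lprod s a = 0 /\ lprod s a' = 0.
  rewrite /perp2 /= !lprodE; split=> [[h1 h2]|[-> ->]]; last by rewrite addr0 subr0.
  by split; lra.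
have va : perp2 (a + a') (a - a') v.
  apply/perpE; rewrite /v !lprodE aa (lprodC b a) ab -/m /c; split; first by ring.
  by field.
have va' : perp2 (a + a') (a - a') v'.
  apply/perpE; rewrite /v' !lprodE aa' (lprodC b' a') ab' (lprodC a' a) -/m /c'.
  by split; [field|ring].
have -> : oproj (dspan (perp2 (a + a') (a - a')))
    (DNum 1 1 *: dvec b + DNum 1 (- 1) *: dvec b') =
    DNum 1 1 *: dvec v + DNum 1 (- 1) *: dvec v'.
  apply: oproj_dspan; last 2 first.
  - exact: dspan_comb.
  - move=> s /perpE[sa sa'].
    rewrite !lprodE !lprod_dvec /v /v' !lprodE (lprodC a s) (lprodC a' s) sa sa'.
    by rewrite !mulr0 !subr0 subrr.
  rewrite !lprodE aa aa' (lprodC a' a) -/m.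
  rewrite [X in X != 0](_ : _ = - (4 * (m * m))); last by ring.
  by rewrite oppr_eq0 !mulf_neq0 // pnatr_eq0.
have vv : lprod v v = lprod b b.
  by rewrite /v !lprodE aa (lprodC b a) ab; ring.
have vv' : lprod v' v' = lprod b' b'.
  by rewrite /v' !lprodE aa' (lprodC b' a') ab'; ring.
cbv zeta; rewrite !lprodE !lprod_dvec vv vv' (lprodC v' v).
by apply: dnum_ext => /=; ring.
Qed.

(** The new coordinates have differentials (th + th') / 2 and (th - th') / 2, so x_u = a + a' and
    x_v = a - a'. Nullity of a and a' gives E = 2 a . a' = - G and F = 0. *)
Lemma null_chart (U : set (R * R)) (x : R * R -> 'rV[R]_n) P Q a b P' Q' a' b'
    (p : R * R) :
  open U -> U p -> smooth_vec U x ->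
  null_factor U P Q a b -> null_factor U P' Q' a' b' ->
  (forall z, U z -> [/\ partial (eu R) x z = P z *: a z + P' z *: a' z,
     partial (ev R) x z = Q z *: a z + Q' z *: a' z,
     lprod (a z) (a' z) < 0 & P z * Q' z - Q z * P' z != 0]) ->
  exists (V : set (R * R)) (phi : R * R -> R * R),
    [/\ coordinates_around U p V phi, isothermal V (x \o phi)%FUN &
     forall q, V q -> let z := phi q in
       Phi'_perp_sq (x \o phi)%FUN q =
       DNum (2 * (lprod (b z) (b z) + lprod (b' z) (b' z)))
            (2 * (lprod (b z) (b z) - lprod (b' z) (b' z)))].
Proof.
move=> oU Up xs [Ps Qs as_ bs H] [Ps' Qs' as' bs' H'] D.
have half_smooth (f g : R * R -> R) (c : R) : smooth U f -> smooth U g ->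
    smooth U (fun z => 2^-1 * (f z + c * g z)).
  move=> fs gs; apply: smooth_mul => //; first exact: smooth_cst.
  by apply: smooth_add => //; apply: smooth_mul => //; exact: smooth_cst.
have half_derive z e (f g : R * R -> R) (c df dg : R) : is_derive z e f df ->
    is_derive z e g dg ->
    'D_e (fun z => 2^-1 * (f z + c * g z)) z = 2^-1 * (df + c * dg).
  move=> hf hg.
  by have [_] := is_deriveZ (2^-1) (is_deriveD hf (is_deriveZ c hg)).
have closed c z : U z -> 'D_(ev R) (fun z => 2^-1 * (P z + c * P' z)) z =
    'D_(eu R) (fun z => 2^-1 * (Q z + c * Q' z)) z.
  move=> Uz; have [PQ _ _ _ _] := H z Uz; have [PQ' _ _ _ _] := H' z Uz.
  have Pv := smooth_is_derive Ps Uz (axis_ev R).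
  have Pv' := smooth_is_derive Ps' Uz (axis_ev R).
  have Qu := smooth_is_derive Qs Uz (axis_eu R).
  have Qu' := smooth_is_derive Qs' Uz (axis_eu R).
  apply: etrans (half_derive _ _ _ _ c _ _ Pv Pv') _.
  apply: etrans (esym (half_derive _ _ _ _ c _ _ Qu Qu')).
  by congr (_ * (_ + _ * _)).
have det0 : 2^-1 * (P p + 1 * P' p) * (2^-1 * (Q p + - 1 * Q' p)) -
    2^-1 * (Q p + 1 * Q' p) * (2^-1 * (P p + - 1 * P' p)) != 0.
  have [_ _ _ d0] := D p Up.
  have -> : 2^-1 * (P p + 1 * P' p) * (2^-1 * (Q p + - 1 * Q' p)) -
    2^-1 * (Q p + 1 * Q' p) * (2^-1 * (P p + - 1 * P' p)) =
    - (2^-1 * (P p * Q' p - Q p * P' p)) by field.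
  by rewrite oppr_eq0 mulf_neq0 // invr_eq0 pnatr_eq0.
have [V [phi [cV dV]]] := coframe_chart oU Up
  (half_smooth _ _ 1 Ps Ps') (half_smooth _ _ 1 Qs Qs')
  (half_smooth _ _ (- 1) Ps Ps') (half_smooth _ _ (- 1) Qs Qs')
  (closed 1) (closed (- 1)) det0.
have [[oV _ _] _ imU _] := cV.
have phiU q : V q -> U (phi q) by move=> Vq; apply: imU; exists q.
(* If dy = th c + th' c', then dy = (c + c') du + (c - c') dv in the new coordinates; this is
   applied to x, a and a'. *)
have dchart (y : R * R -> 'rV[R]_n) (q : R * R) (c c' : 'rV[R]_n) :
    V q -> smooth_vec U y ->
    partial (eu R) y (phi q) = P (phi q) *: c + P' (phi q) *: c' ->
    partial (ev R) y (phi q) = Q (phi q) *: c + Q' (phi q) *: c' ->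
    is_vderive q (eu R) (fun z => y (phi z)) (c + c') /\
    is_vderive q (ev R) (fun z => y (phi z)) (c - c').
  move=> Vq ys yu yv.
  have di i := dV q (fun z => y z 0 i) ((c + c') 0 i) ((c - c') 0 i) Vq (ys i).
  have cu i : 'D_(eu R) (fun z => y z 0 i) (phi q) =
      P (phi q) * c 0 i + P' (phi q) * c' 0 i.
    by move/rowP: yu => /(_ i); rewrite !mxE.
  have cv i : 'D_(ev R) (fun z => y z 0 i) (phi q) =
      Q (phi q) * c 0 i + Q' (phi q) * c' 0 i.
    by move/rowP: yv => /(_ i); rewrite !mxE.
  by split=> i; have [] := di i _ _; rewrite ?cu ?cv ?mxE //; field.
have dx q : V q ->
    is_vderive q (eu R) (fun z => x (phi z)) (a (phi q) + a' (phi q)) /\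
    is_vderive q (ev R) (fun z => x (phi z)) (a (phi q) - a' (phi q)).
  by move=> Vq; have [xu xv _ _] := D _ (phiU q Vq); exact: dchart.
have da q : V q -> is_vderive q (eu R) (fun z => a (phi z)) (b (phi q) + 0) /\
    is_vderive q (ev R) (fun z => a (phi z)) (b (phi q) - 0).
  move=> Vq; have [_ _ au av _] := H _ (phiU q Vq).
  by apply: dchart => //; rewrite ?au ?av scaler0 addr0.
have da' q : V q -> is_vderive q (eu R) (fun z => a' (phi z)) (0 + b' (phi q)) /\
    is_vderive q (ev R) (fun z => a' (phi z)) (0 - b' (phi q)).
  move=> Vq; have [_ _ au av _] := H' _ (phiU q Vq).
  by apply: dchart => //; rewrite ?au ?av scaler0 add0r.
have pu q : V q -> partial (eu R) (x \o phi)%FUN q = a (phi q) + a' (phi q).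
  by move=> Vq; exact: partial_val (dx q Vq).1.
have pv q : V q -> partial (ev R) (x \o phi)%FUN q = a (phi q) - a' (phi q).
  by move=> Vq; exact: partial_val (dx q Vq).2.
exists V, phi; split=> //.
  move=> q Vq; have [_ _ _ _ [aa _]] := H _ (phiU q Vq).
  have [_ _ _ _ [aa' _]] := H' _ (phiU q Vq).
  have [_ _ m0 _] := D _ (phiU q Vq).
  rewrite (pu q Vq) (pv q Vq).
  move: aa aa' m0; move: (a (phi q)) (a' (phi q)) => c c' aa aa' m0.
  rewrite /= !lprodE aa aa' (lprodC c' c).
  by split; [ring|ring|lra].
move=> q Vq z.
have [_ _ _ _ [aa ab]] := H _ (phiU q Vq).
have [_ _ _ _ [aa' ab']] := H' _ (phiU q Vq).
have [_ _ m0 _] := D _ (phiU q Vq).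
have PhiE q' : V q' -> Phi (x \o phi)%FUN q' =
    \row_i DNum ((a (phi q') + a' (phi q')) 0 i)
      ((a (phi q') + - 1 *: a' (phi q')) 0 i).
  move=> Vq'; have [hu hv] := dx q' Vq'; rewrite scaleN1r; exact: Phi_val.
have [au av] := da q Vq; have [au' av'] := da' q Vq.
rewrite addr0 in au; rewrite subr0 in av; rewrite add0r in au'; rewrite sub0r in av'.
have gu := is_vderiveD au (is_vderive_scale (- 1) au').
have gv := is_vderiveD av (is_vderive_scale (- 1) av').
rewrite scaleN1r in gu; rewrite scaleN1r opprK in gv.
rewrite /Phi'_perp_sq.
rewrite (ddt_val oV Vq PhiE (is_vderiveD au au') (is_vderiveD av av') gu gv).
rewrite normal_spaceE (pu q Vq) (pv q Vq).
apply: projected_square aa aa' _ ab ab'.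
by rewrite lt_eqF.
Qed.

(** The normal part v of b has the same square as b and is orthogonal to a + a', which is time-like
    since its square is 2 a . a'. *)
Lemma null_derivative_ge0 (a a' b : 'rV[R]_n) : lprod a a = 0 ->
  lprod a' a' = 0 -> lprod a a' < 0 -> lprod a b = 0 -> 0 <= lprod b b.
Proof.
move=> aa aa' m0 ab; have mn : lprod a a' != 0 by rewrite lt_eqF.
pose v := b - (lprod b a' / lprod a a') *: a.
have <- : lprod v v = lprod b b by rewrite /v !lprodE aa (lprodC b a) ab; ring.
apply: (@orth_timelike_ge0 _ _ (a + a')).
  by rewrite !lprodE aa aa' (lprodC a' a); lra.
by rewrite /v !lprodE aa (lprodC b a) ab; field.
Qed.

End NullCharts.

(** * The two null forms of a minimal surface and the canonical chart *)

Section Assembly.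
Context {R : realType} {n : nat}.

(** The coefficients of S and T in X and Y form a matrix of determinant zero, and the minors and
    products are all multiples of W^2 - F^2 + E G = 0. If S and T vanished, pairing them with Y and
    X would give F W = W^2 and F W = - W^2. *)
Lemma conjugate_rank_one (X Y : 'rV[R]_n) (W : R) :
  let E := lprod X X in let F := lprod X Y in let G := lprod Y Y in
  W != 0 -> W * W = F * F - E * G ->
  let S := 2^-1 *: (X + ((- F / W) *: X + (E / W) *: Y)) in
  let T := 2^-1 *: (Y + ((- G / W) *: X + (F / W) *: Y)) in
  [/\ forall i j, S 0 i * T 0 j = S 0 j * T 0 i, lprod S S = 0,
      lprod S T = 0, lprod T T = 0 & ~ (S = 0 /\ T = 0)].
Proof.
move=> E F G W0 WW S T.
have WW0 : W * W != 0 by rewrite mulf_neq0.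
have SE : S = ((W - F) / (2 * W)) *: X + (E / (2 * W)) *: Y.
  by apply/rowP => i; rewrite !mxE; field.
have TE : T = (- G / (2 * W)) *: X + ((W + F) / (2 * W)) *: Y.
  by apply/rowP => i; rewrite !mxE; field.
clearbody S T; subst S T.
have EG : E * G = F * F - W * W by rewrite WW; ring.
have XY : lprod Y X = F by rewrite lprodC.
split.
- move=> i j; rewrite !mxE; move: (X 0 i) (X 0 j) (Y 0 i) (Y 0 j) => s t u v.
  apply/eqP; rewrite -subr_eq0.
  rewrite [X in X == 0](_ : _ = (W * W - F * F + E * G) / (4 * (W * W)) *
    (s * v - t * u)); last by field.
  by rewrite EG; apply/eqP; ring.
- rewrite !lprodE XY -/E -/F -/G.
  rewrite [LHS](_ : _ = E * (W * W - F * F + E * G) / (4 * (W * W))); last by field.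
  by rewrite EG; ring.
- rewrite !lprodE XY -/E -/F -/G.
  rewrite [LHS](_ : _ = F * (W * W - F * F + E * G) / (4 * (W * W))); last by field.
  by rewrite EG; ring.
- rewrite !lprodE XY -/E -/F -/G.
  rewrite [LHS](_ : _ = G * (W * W - F * F + E * G) / (4 * (W * W))); last by field.
  by rewrite EG; ring.
move=> [S0 T0].
have := congr1 (fun v => lprod v Y) S0; have := congr1 (fun v => lprod v X) T0.
rewrite !lprodE XY -/E -/F -/G => h1 h2.
have e1 : F * W = W * W.
  have : ((W - F) / (2 * W) * F + E / (2 * W) * G) * (2 * W) = 0 by rewrite h2 mul0r.
  rewrite (_ : _ * (2 * W) = W * F - F * F + E * G); last by field.
  by rewrite EG; lra.
have e2 : F * W = - (W * W).
  have : (- G / (2 * W) * E + (W + F) / (2 * W) * F) * (2 * W) = 0 by rewrite h1 mul0r.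
  rewrite (_ : _ * (2 * W) = W * F + F * F - E * G); last by field.
  by rewrite EG; lra.
by move/eqP: WW0; apply; lra.
Qed.

Lemma null_form (U : set (R * R)) (x : R * R -> 'rV[R]_n) (W : R * R -> R)
    (p : R * R) :
  timelike_surface U x -> minimal_surface U x -> U p -> smooth U W ->
  let xu := partial (eu R) x in let xv := partial (ev R) x in
  (forall z, U z -> W z != 0 /\ W z * W z = lprod (xu z) (xv z) *
     lprod (xu z) (xv z) - lprod (xu z) (xu z) * lprod (xv z) (xv z)) ->
  exists (U' : set (R * R)) P Q a b, [/\ open U', U' `<=` U, U' p,
    null_factor U' P Q a b & forall z, U' z ->
    2^-1 *: (xu z + ((- lprod (xu z) (xv z) / W z) *: xu z +
       (lprod (xu z) (xu z) / W z) *: xv z)) = P z *: a z /\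
    2^-1 *: (xv z + ((- lprod (xv z) (xv z) / W z) *: xu z +
       (lprod (xu z) (xv z) / W z) *: xv z)) = Q z *: a z].
Proof.
move=> tl mini Up Ws xu xv HW.
have [[oU _ _] [xs _] _] := tl.
have us : smooth_vec U xu by exact: smooth_vec_partial.
have vs : smooth_vec U xv by exact: smooth_vec_partial.
have [|A [B [As Bs AB]]] := conjugate_closed oU us vs Ws.
  move=> z Uz; have [W0 WW] := HW z Uz.
  split; [exact: W0|exact: WW|exact: schwarz_vec oU Uz xs|].
  exact: minimal_tangential tl mini Uz W0 WW.
pose X z := 2^-1 *: (xu z + A z); pose Y z := 2^-1 *: (xv z + B z).
have hs (y w : R * R -> 'rV[R]_n) : smooth_vec U y -> smooth_vec U w ->
    smooth_vec U (fun z => 2^-1 *: (y z + w z)).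
  move=> ys ws; apply: smooth_vec_scale => //; first exact: smooth_cst.
  exact: smooth_vec_add.
have Xs : smooth_vec U X by exact: hs.
have Ys : smooth_vec U Y by exact: hs.
have XYp z : U z -> [/\ partial (ev R) X z = partial (eu R) Y z,
     forall i j, X z 0 i * Y z 0 j = X z 0 j * Y z 0 i,
     lprod (X z) (X z) = 0, lprod (X z) (Y z) = 0 & lprod (Y z) (Y z) = 0].
  move=> Uz; have [W0 WW] := HW z Uz; have [Az Bz cl] := AB z Uz.
  have [r1 XX XY YY _] := conjugate_rank_one W0 WW.
  rewrite /X /Y Az Bz; split=> //.
  have huv := smooth_is_vderive us Uz (axis_ev R).
  have hvu := smooth_is_vderive vs Uz (axis_eu R).
  have hA := smooth_is_vderive As Uz (axis_ev R).
  have hB := smooth_is_vderive Bs Uz (axis_eu R).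
  apply: etrans (partial_val (is_vderive_scale 2^-1 (is_vderiveD huv hA))) _.
  apply: etrans _ (esym (partial_val (is_vderive_scale 2^-1 (is_vderiveD hvu hB)))).
  exact: (congr2 (fun s t => 2^-1 *: (s + t)) (schwarz_vec oU Uz xs) cl).
have nz : ~ (X p = 0 /\ Y p = 0).
  have [W0 WW] := HW p Up; have [Az Bz _] := AB p Up.
  have [_ _ _ _] := conjugate_rank_one W0 WW.
  by rewrite /X /Y Az Bz.
have [U' [P [Q [a [b [oU' UU U'p nf fac]]]]]] := null_factorization oU Up Xs Ys XYp nz.
exists U', P, Q, a, b; split=> // z U'z.
have [Az Bz _] := AB z (UU z U'z).
by have := fac z U'z; rewrite /X /Y Az Bz.
Qed.

(** A nonzero discriminant thus yields at once that a . a' is nonzero and that the two scalar forms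
    are independent. *)
Lemma null_disc (X Y a a' : 'rV[R]_n) (P Q P' Q' : R) :
  X = P *: a + P' *: a' -> Y = Q *: a + Q' *: a' ->
  lprod a a = 0 -> lprod a' a' = 0 ->
  lprod X Y * lprod X Y - lprod X X * lprod Y Y =
  (lprod a a' * (P * Q' - Q * P')) ^+ 2.
Proof.
move=> -> -> aa aa'; rewrite !lprodE aa aa' (lprodC a' a).
by move: (lprod a a') => m; ring.
Qed.

Lemma conjugate_sum (X Y Z : 'rV[R]_n) (s t w : R) :
  2^-1 *: (X + ((s / w) *: Y + (t / w) *: Z)) +
  2^-1 *: (X + ((s / - w) *: Y + (t / - w) *: Z)) = X.
Proof.
rewrite invrN; move: (w^-1) => v.
by apply/rowP => i; rewrite !mxE; field.
Qed.

(** [null_form] is applied to both roots W and - W; the two halves add up to dx. *)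
Lemma null_coframe (U : set (R * R)) (x : R * R -> 'rV[R]_n) (p : R * R) :
  timelike_surface U x -> minimal_surface U x -> U p ->
  exists (U' : set (R * R)) P Q a b P' Q' a' b',
    [/\ open U', U' `<=` U, U' p,
       null_factor U' P Q a b /\ null_factor U' P' Q' a' b' &
    forall z, U' z -> [/\ partial (eu R) x z = P z *: a z + P' z *: a' z,
     partial (ev R) x z = Q z *: a z + Q' z *: a' z,
     lprod (a z) (a' z) < 0 & P z * Q' z - Q z * P' z != 0]].
Proof.
move=> tl mini Up.
have [[oU _ _] [xs _] tm] := tl.
pose xu := partial (eu R) x; pose xv := partial (ev R) x.
have us : smooth_vec U xu by exact: smooth_vec_partial.
have vs : smooth_vec U xv by exact: smooth_vec_partial.
pose D z := lprod (xu z) (xv z) * lprod (xu z) (xv z) +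
  - (lprod (xu z) (xu z) * lprod (xv z) (xv z)).
have Ds : smooth U D.
  apply: smooth_add => //; first by apply: smooth_mul => //; exact: smooth_lprod.
  by apply: smooth_opp => //; apply: smooth_mul => //; exact: smooth_lprod.
have D0 z : U z -> 0 < D z.
  move=> Uz; have [[[a b] h1] [[c d] h2]] := tm z Uz.
  rewrite metricE /= -/xu -/xv in h1; rewrite metricE /= -/xu -/xv in h2.
  apply: (@indefinite_disc _ (lprod (xu z) (xu z)) (lprod (xu z) (xv z))
    (lprod (xv z) (xv z)) a b c d).
    by rewrite (_ : 2 * a * b = a * b + b * a) //; ring.
  by rewrite (_ : 2 * c * d = c * d + d * c) //; ring.
pose W z := Num.sqrt (D z).
have Ws : smooth U W by exact: smooth_sqrt.
have W0 z : U z -> W z != 0 /\ W z * W z = D z.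
  move=> /D0 h; split; first by rewrite gt_eqF // sqrtr_gt0.
  by rewrite -expr2 sqr_sqrtr // ltW.
have [|U1 [P [Q [a [b [oU1 UU1 U1p nf fac]]]]]] := null_form tl mini Up Ws.
  by move=> z /W0.
have [|U2 [P' [Q' [a' [b' [oU2 UU2 U2p nf' fac']]]]]] :=
    null_form tl mini Up (smooth_opp oU Ws).
  by move=> z /W0[w0 ww]; rewrite oppr_eq0 mulrNN.
pose U3 := U1 `&` U2.
have oU3 : open U3 by exact: openI.
have U31 : U3 `<=` U1 by move=> z [].
have U32 : U3 `<=` U2 by move=> z [].
have U3p : U3 p by [].
have nf3 := null_factor_subset U31 nf; have nf3' := null_factor_subset U32 nf'.
have dx z : U3 z -> xu z = P z *: a z + P' z *: a' z /\
    xv z = Q z *: a z + Q' z *: a' z.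
  move=> [z1 z2]; have [<- <-] := fac z z1; have [<- <-] := fac' z z2.
  by split; exact: esym (conjugate_sum _ _ _ _ _ _).
have nz z : U3 z -> lprod (a z) (a' z) != 0 /\ P z * Q' z - Q z * P' z != 0.
  move=> Uz; have [_ _ _ _ h] := nf3; have [_ _ _ _ h'] := nf3'.
  have [_ _ _ _ [aa _]] := h z Uz; have [_ _ _ _ [aa' _]] := h' z Uz.
  have [xuE xvE] := dx z Uz.
  have := null_disc xuE xvE aa aa'; rewrite -[LHS]/(D z) => DE.
  have : (lprod (a z) (a' z) * (P z * Q' z - Q z * P' z)) ^+ 2 != 0.
    by rewrite -DE gt_eqF // D0 //; exact: UU1 _ (U31 _ Uz).
  by rewrite expf_eq0 /= mulf_eq0 negb_or => /andP[].
have ms : smooth U3 (fun z => lprod (a z) (a' z)).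
  by have [_ _ h _ _] := nf3; have [_ _ h' _ _] := nf3'; exact: smooth_lprod.
have [mp _] := nz p U3p.
(* The sign decides which coordinate is time-like; if positive, the second factor is replaced by its
   negative. *)
have [mneg|mpos] : lprod (a p) (a' p) < 0 \/ 0 < lprod (a p) (a' p).
  by apply/orP; rewrite -neq_lt.
- pose U4 := [set z | U3 z /\ 0 < - lprod (a z) (a' z)].
  have U43 : U4 `<=` U3 by move=> z [].
  exists U4, P, Q, a, b, P', Q', a', b'; split.
  + exact: open_pos oU3 (smooth_opp oU3 ms 0%N).
  + by move=> z /U43 /U31 /UU1.
  + by split=> //; rewrite oppr_gt0.
  + by split; exact: null_factor_subset U43 _.
  + move=> z [Uz m0]; have [h1 h2] := dx z Uz; have [_ h3] := nz z Uz.
    by split=> //; rewrite -oppr_gt0.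
- pose U4 := [set z | U3 z /\ 0 < lprod (a z) (a' z)].
  have U43 : U4 `<=` U3 by move=> z [].
  exists U4, P, Q, a, b, (fun z => - P' z), (fun z => - Q' z),
    (fun z => - 1 *: a' z), b'; split.
  + exact: open_pos oU3 (ms 0%N).
  + by move=> z /U43 /U31 /UU1.
  + by split.
  + split; apply: null_factor_subset U43 _; first exact: nf3.
    exact: null_factorN oU3 nf3'.
  + move=> z [Uz m0]; have [h1 h2] := dx z Uz; have [_ h3] := nz z Uz.
    split.
    * by rewrite -/xu h1 scalerA mulrN1 opprK.
    * by rewrite -/xv h2 scalerA mulrN1 opprK.
    * by rewrite lprodZr mulN1r oppr_lt0.
    * by rewrite !mulrN -opprD oppr_eq0.
Qed.

End Assembly.

Theorem theorem6p7 (R : realType) (n : nat) (hn : (3 <= n)%N)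
    (U : set (R * R)) (x : R * R -> 'rV[R]_n)
    (hx : timelike_surface U x) (hmin : minimal_surface U x)
    (hgen : general_type U x) :
  forall p : R * R, U p ->
    exists (V : set (R * R)) (phi : R * R -> R * R),
      coordinates_around U p V phi /\ canonical_coordinates V (x \o phi)%FUN.
Proof.
move=> p Up.
have [U1 [P [Q [a [b [P' [Q' [a' [b' [oU1 U1U U1p [nf nf'] D]]]]]]]]]] :=
  null_coframe hx hmin Up.
have [_ [xs _] _] := hx.
have xs1 := smooth_vec_subset U1U xs.
have [_ _ as_ bs H] := nf; have [_ _ as' bs' H'] := nf'.
have bge z : U1 z -> 0 <= lprod (b z) (b z) /\ 0 <= lprod (b' z) (b' z).
  move=> Uz; have [_ _ _ _ [aa ab]] := H z Uz.
  have [_ _ _ _ [aa' ab']] := H' z Uz; have [_ _ m0 _] := D z Uz.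
  split; first exact: null_derivative_ge0 aa aa' m0 ab.
  by apply: null_derivative_ge0 aa' aa _ ab'; rewrite lprodC.
(* A provisional isothermal chart, built only to apply the absence of degenerate points at p. *)
have [V0 [phi0 [cV0 iso0 sq0]]] := null_chart oU1 U1p xs1 nf nf' D.
(* With s = b^2 and t = b'^2, the double number 2 (s + t) + 2 j (s - t) has squared modulus 16 s
   t. *)
have cp : lprod (b p) (b p) * lprod (b' p) (b' p) != 0.
  apply/eqP => b0; apply: (hgen p Up).
  have [_ _ _ [q Vq qp]] := cV0.
  exists V0, phi0, q; split=> //; first exact: coordinates_around_subset U1U cV0.
  rewrite /D0 /= (sq0 q Vq) qp; move: b0.
  move: (lprod (b p) (b p)) (lprod (b' p) (b' p)) => s t b0.
  apply: dnum_ext => /=; last by ring.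
  have -> : (0 : R) = 16 * (s * t) by rewrite b0 mulr0.
  by ring.
have {}cp : 0 < lprod (b p) (b p) /\ 0 < lprod (b' p) (b' p).
  have [b0 b0'] := bge p U1p; move: cp; rewrite mulf_eq0 negb_or => /andP[n1 n2].
  by rewrite !lt_neqAle b0 b0' !(eq_sym 0) n1 n2.
pose U2 := [set z | U1 z /\ 0 < lprod (b z) (b z)].
have oU2 : open U2 by exact: open_pos oU1 (smooth_lprod oU1 bs bs 0%N).
have U21 : U2 `<=` U1 by move=> z [].
pose U3 := [set z | U2 z /\ 0 < lprod (b' z) (b' z)].
have bs2 := smooth_vec_subset U21 bs'.
have oU3 : open U3 by exact: open_pos oU2 (smooth_lprod oU2 bs2 bs2 0%N).
have U31 : U3 `<=` U1 by move=> z [[]].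
have U3p : U3 p by case: cp.
have [|L [c [L0 nfL cc]]] := null_factor_rescale oU3 (null_factor_subset U31 nf).
  by move=> z [[]].
have [|L' [c' [L0' nfL' cc']]] :=
    null_factor_rescale oU3 (null_factor_subset U31 nf').
  by move=> z [].
(* Each vector is divided by the factor that multiplies its form, so the decomposition of dx is
   unchanged; L and L' being positive, so is the sign of a . a'. *)
have [|V [phi [cV iso sq]]] :=
    null_chart oU3 U3p (smooth_vec_subset U31 xs1) nfL nfL'.
  move=> z Uz; have [h1 h2 m0 det0] := D z (U31 z Uz).
  have l0 := L0 z Uz; have l0' := L0' z Uz.
  have ln : L z != 0 by rewrite gt_eqF.
  have ln' : L' z != 0 by rewrite gt_eqF.
  split.
  - by rewrite h1 !scalerA mulrAC mulfV // mul1r [L' z * _ * _]mulrAC mulfV // mul1r.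
  - by rewrite h2 !scalerA mulrAC mulfV // mul1r [L' z * _ * _]mulrAC mulfV // mul1r.
  - by rewrite lprodZl lprodZr pmulr_rlt0 ?invr_gt0 // pmulr_rlt0 ?invr_gt0.
  - rewrite (_ : _ - _ = L z * L' z * (P z * Q' z - Q z * P' z)); last by ring.
    by rewrite !mulf_neq0.
exists V, phi; split.
  by apply: coordinates_around_subset cV; exact: subset_trans U1U.
split; first exact: iso.
move=> q Vq; rewrite (sq q Vq).
have [_ _ imU _] := cV; have Uq : U3 (phi q) by apply: imU; exists q.
rewrite (cc _ Uq) (cc' _ Uq).
(* Both squares are 1/4: the real part is 2 (1/4 + 1/4) = 1 and the imaginary part is 0. *)
by apply: dnum_ext => /=; field.
Qed.
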